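(* Let $(U_N)$ and $(\widetilde U_N)$ be families of operators satisfying Hypotheses 1, 2 and 3 (stated in the context). Let $a<b$ be real numbers and let $c>0$. For any $\varepsilon>0$, we have $$\limsup_{N\to+\infty}\frac1N\mathcal{N}_{a+\varepsilon,b-\varepsilon,-c,0}(U_N)\le\limsup_{N\to+\infty}\frac1N\mathcal{N}_{a,b}(\widetilde U_N),$$ $$\liminf_{N\to+\infty}\frac1N\mathcal{N}_{a-\varepsilon,b+\varepsilon,-c,0}(U_N)\ge\liminf_{N\to+\infty}\frac1N\mathcal{N}_{a,b}(\widetilde U_N).$$
   Context: Let $Y_0\in(0,+\infty]$ and $\mathbb{C}^{Y_0}=\{z\in\mathbb{C}:\Im z<Y_0\}$. For each $N\in\mathbb{N}$, $\mathcal{H}_N$ is a Hilbert space and $U_N(z):\mathcal{H}_N\to\mathcal{H}_N$ is a family of trace-class operators depending holomorphically on $z\in\mathbb{C}^{Y_0}$. $\|\cdot\|$ is the operator norm and $\|\cdot\|_1$ the trace norm. A resonance of $U_N$ (resp. $\widetilde U_N$) is a solution $z\in\mathbb{C}^{Y_0}$ of $\det(U_N(z)-\mathrm{Id})=0$ (resp. $\det(\widetilde U_N(z)-\mathrm{Id})=0$); its multiplicity is the dimension of $\ker(U_N(z)-\mathrm{Id})$ (resp. $\ker(\widetilde U_N(z)-\mathrm{Id})$). $\mathcal{N}_{a,b,c,d}(U_N)$ is the number of resonances $z$ of $U_N$ with $a\le\Re z\le b$ and $c\le\Im z\le d$, counted with multiplicity, and $\mathcal{N}_{a,b}(\widetilde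 U_N)$ is the number of resonances of $\widetilde U_N$ in $[a,b]\subset\mathbb{R}$ counted with multiplicity. Hypothesis 1. 1. For any $N$, $U_N$ has no resonances in $\{0<\Im z<Y_0\}$. 2. For every compact $\mathcal{K}\subset\{0<\Im z<Y_0\}$ there is $C_0(\mathcal{K})>0$ independent of $N$ such that $\|(\mathrm{Id}-U_N(z))^{-1}\|\le\frac{C_0(\mathcal{K})}{|\Im z|}$ for all $N$ and $z\in\mathcal{K}$. 3. There exists $Y_1>0$ such that for any $N$, $U_N$ has no resonances in $\{\Im z\le-Y_1\}$; and for every compact $\mathcal{K}\subset\{\Im z\le-Y_1\}$ there is $C_0'(\mathcal{K})>0$ independent of $N$ such that $\|(\mathrm{Id}-U_N(z))^{-1}\|\le C_0'(\mathcal{K})$ for all $N$ and $z\in\mathcal{K}$. 4. For every compact $\mathcal{K}\subset\mathbb{C}^{Y_0}$ there is $C_1(\mathcal{K})>0$ such that $\|U_N(z)\|\le C_1(\mathcal{K})$ for all $N$ and $z\in\mathcal{K}$. Hypothesis 2. For each $N$ there is another family $\widetilde U_N(z):\mathcal{H}_N\to\mathcal{H}_N$ of invertible operators depending holomorphically on $z\in\mathbb{C}^{Y_0}$ such that: 1. For every compact $\mathcal{K}\subset\mathbb{C}^{Y_0}$ there is a constant $c(\mathcal{K})>0$ such that for all $N$ and $z\in\mathcal{K}$: if $\Im z>0$ then $\|\widetilde U_N(z)\|\le\frac{1}{1+c(\mathcal{K})\Im z}$; if $\Im z<0$ then $\|\widetilde U_N(z)^{-1}\|\le\frac{1}{1+c(\mathcal{K})|\Im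 z|}$. In particular, for every compact $\mathcal{K}\subset\mathbb{C}^{Y_0}\setminus\mathbb{R}$ there is $C_2(\mathcal{K})$ such that $\|(\mathrm{Id}-\widetilde U_N(z))^{-1}\|\le\frac{C_2(\mathcal{K})}{|\Im z|}$ for all $N$ and $z\in\mathcal{K}$. 2. There is a sequence $(\gamma_N)$ of positive numbers such that for every compact $\mathcal{K}\subset\mathbb{C}^{Y_0}$ there is $C(\mathcal{K})$ independent of $N$ with $\|U_N(z)-\widetilde U_N(z)\|_1\le C(\mathcal{K})\gamma_N$ for all $N$ and all $z\in\mathcal{K}$. Hypothesis 3. 1. There exist $D_0,D_1>0$ such that $\mathcal{H}_N=\mathbb{C}^{d_N}$ with $D_0N\le d_N\le D_1N$. 2. $\gamma_N=o(N)$. 3. $\widetilde U_N(x)$ is unitary for all $x\in\mathbb{R}$. 4. For every compact $\mathcal{K}\subset\mathbb{R}$ there is $c(\mathcal{K})>0$ such that for all $x\in\mathcal{K}$ and all $N$, $-i\frac{\mathrm{d}\widetilde U_N(x)}{\mathrm{d}x}\widetilde U_N(x)^{-1}-c(\mathcal{K})\mathrm{Id}$ is a positive self-adjoint operator. 5. For any $z$ (in the domain $\mathbb{C}^{Y_0}$), the matrix $U_N(z)$ is similar to $U_N(-\overline z)^*$, and $\widetilde U_N(z)$ is similar to $\widetilde U_N(-\overline z)^*$.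
   Formalization: In the liminf inequality, resonances of U_N are counted by their order as zeros of det(U_N(z)-Id), not by dim ker(U_N(z)-Id): with dim ker the inequality fails for Jordan-block perturbations of e^{iz}Id. The limsup inequality is stated with both multiplicities. *)

(* Defs.v *)
From HB Require Import structures.
From mathcomp Require Import all_boot all_order all_algebra.
From mathcomp Require Import all_classical all_reals all_analysis.
From mathcomp Require Export complex.

Set Implicit Arguments.
Unset Strict Implicit.
Unset Printing Implicit Defensive.

Import Order.TTheory GRing.Theory Num.Theory.
Import numFieldNormedType.Exports.

Local Open Scope classical_set_scope.
Local Open Scope ring_scope.
Local Open Scope complex_scope.
Local Open Scope sesquilinear_scope.

(* The norm topology of R[i], and its structure of normed space over itself:
   [derivable f z 1] is then complex differentiability at z. *)
#[warnings="-redundant-canonical-projection"]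
HB.instance Definition _ (R : realType) := NormedModule.copy R[i] (R[i])^o.

Section Norms.
Variable R : realType.

Definition vnorm (n : nat) (v : 'cV[R[i]]_n) : R :=
  Num.sqrt (\sum_(i < n) complex.Re `|v i 0| ^+ 2).

Definition opnorm (n : nat) (A : 'M[R[i]]_n) : R :=
  sup [set vnorm (A *m v) | v in [set v : 'cV[R[i]]_n | vnorm v <= 1]].

(* The sum of the singular values: A^* A is normal, so spectral_diag lists its
   (real, nonnegative) eigenvalues with multiplicity. *)
Definition trnorm (n : nat) (A : 'M[R[i]]_n) : R :=
  \sum_(i < n) Num.sqrt (complex.Re (spectral_diag (A ^t* *m A) 0 i)).

Definition positive_mx (n : nat) (A : 'M[R[i]]_n) : Prop :=
  A \is hermsymmx /\ forall v : 'cV[R[i]]_n, 0 <= (v ^t* *m A *m v) 0 0.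

End Norms.

Section Families.
Variables (R : realType) (Y0 : \bar R).

Definition lower_domain : set R[i] := [set z : R[i] | ((complex.Im z)%:E < Y0)%E].

Definition holomorphic_mx (n : nat) (A : R[i] -> 'M[R[i]]_n) : Prop :=
  forall i j (z : R[i]), lower_domain z ->
    derivable (fun w : R[i] => A w i j) z 1.

Definition derive_mx (n : nat) (A : R[i] -> 'M[R[i]]_n) (z : R[i]) : 'M[R[i]]_n :=
  \matrix_(i, j) derive1 (fun w : R[i] => A w i j) z.

Definition resonance (n : nat) (A : R[i] -> 'M[R[i]]_n) (z : R[i]) : Prop :=
  lower_domain z /\ \det (A z - 1%:M) = 0.

(* dim ker (A(z) - Id); mathcomp kernels are row kernels, whence the transpose. *)
Definition ker_mult (n : nat) (A : R[i] -> 'M[R[i]]_n) (z : R[i]) : \bar R :=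
  (\rank (kermx (A z - 1%:M)^T))%:R%:E.

(* Vanishing order at z: the largest k such that f = (w - z)^k g near z with g
   holomorphic; it is +oo when f vanishes near z. *)
Definition vanishing_order (f : R[i] -> R[i]) (z : R[i]) : \bar R :=
  ereal_sup [set k%:R%:E | k in [set k : nat | exists g : R[i] -> R[i],
    \forall w \near z, derivable g w 1 /\ f w = (w - z) ^+ k * g w]].

(* The order of z as a zero of det (A - Id). For holomorphic A it is at least
   ker_mult, and strictly larger at, e.g., a Jordan block:
   A(z) = e^(iz) [[1, 1], [0, 1]] at z = 0 has kernel dimension 1 and order 2.
   Small perturbations can destroy kernel dimension but not order, so a lower
   bound on the number of resonances of U needs det_mult. *)
Definition det_mult (n : nat) (A : R[i] -> 'M[R[i]]_n) (z : R[i]) : \bar R :=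
  vanishing_order (fun w => \det (A w - 1%:M)) z.

(* esum is the unordered sum of nonnegative terms, so infinitely many
   resonances in the rectangle give the count +oo. *)
Definition resonance_count (n : nat)
    (mult : (R[i] -> 'M[R[i]]_n) -> R[i] -> \bar R)
    (a b c d : R) (A : R[i] -> 'M[R[i]]_n) : \bar R :=
  \esum_(z in [set z | [/\ resonance A z, a <= complex.Re z <= b
                         & c <= complex.Im z <= d]]) mult A z.

Definition real_resonance_count (n : nat) (a b : R) (A : R[i] -> 'M[R[i]]_n) :
    \bar R :=
  \esum_(z in [set z | exists x : R,
    [/\ z = x%:C, a <= x <= b & resonance A z]]) ker_mult A z.

Variable d : nat -> nat.
Implicit Types U V : forall N : nat, R[i] -> 'M[R[i]]_(d N).

Record hypothesis1 U : Prop := Hypothesis1 {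
  no_resonance_above : forall N (z : R[i]), 0 < complex.Im z -> ~ resonance (U N) z ;
  resolvent_above : forall K : set R[i], compact K ->
    K `<=` lower_domain `&` [set z : R[i] | 0 < complex.Im z] ->
    exists2 C0 : R, 0 < C0 & forall N z, K z ->
      opnorm (invmx (1%:M - U N z)) <= C0 / `|complex.Im z| ;
  resolvent_below : exists2 Y1 : R, 0 < Y1 &
    (forall N (z : R[i]), complex.Im z <= - Y1 -> ~ resonance (U N) z) /\
    (forall K : set R[i], compact K ->
      K `<=` [set z : R[i] | complex.Im z <= - Y1] ->
      exists2 C0' : R, 0 < C0' & forall N z, K z ->
        opnorm (invmx (1%:M - U N z)) <= C0') ;
  opnorm_bound : forall K : set R[i], compact K -> K `<=` lower_domain ->
    exists2 C1 : R, 0 < C1 & forall N z, K z -> opnorm (U N z) <= C1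
}.

(* The bound on (Id - V)^-1 off the real axis follows from expansion_bound
   and is not a separate field. *)
Record hypothesis2 U V (gamma : nat -> R) : Prop := Hypothesis2 {
  reference_holomorphic : forall N, holomorphic_mx (V N) ;
  reference_unit : forall N (z : R[i]), lower_domain z -> V N z \in unitmx ;
  expansion_bound : forall K : set R[i], compact K -> K `<=` lower_domain ->
    exists2 c : R, 0 < c & forall N z, K z ->
      (0 < complex.Im z -> opnorm (V N z) <= (1 + c * complex.Im z)^-1) /\
      (complex.Im z < 0 ->
        opnorm (invmx (V N z)) <= (1 + c * `|complex.Im z|)^-1) ;
  gamma_gt0 : forall N, 0 < gamma N ;
  trnorm_bound : forall K : set R[i], compact K -> K `<=` lower_domain ->
    exists C : R, forall N z, K z -> trnorm (U N z - V N z) <= C * gamma N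
}.

Record hypothesis3 U V (gamma : nat -> R) : Prop := Hypothesis3 {
  dimension_bound : exists D0 D1 : R, [/\ 0 < D0, 0 < D1 &
    forall N : nat, D0 * N%:R <= (d N)%:R <= D1 * N%:R] ;
  gamma_small : gamma =o_\oo (fun N : nat => N%:R : R) ;
  reference_unitary : forall N (x : R), V N x%:C \is unitarymx ;
  reference_monotone : forall K : set R, compact K ->
    exists2 c : R, 0 < c & forall N (x : R), K x ->
      positive_mx ((0 -i* 1) *: (derive_mx (V N) x%:C *m invmx (V N x%:C))
                   - (c%:C)%:M) ;
  conjugation_symmetry : forall N (z : R[i]), lower_domain z ->
    similar_in unitmx (U N z) ((U N (- z^*)) ^t*) /\
    similar_in unitmx (V N z) ((V N (- z^*)) ^t*)
}.

End Families.

(* Main.v *)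
(* The resonances of U and V are the zeros of F = det (U - 1) and
   G = det (V - 1); those of G are real, those of F satisfy - Y1 < Im z <= 0.
   Both functions are bounded by e^(C N), and F / G is controlled by
   e^(C gamma_N) wherever 1 - U, respectively 1 - V, has a bounded inverse, since
   |det (1 + D B)| <= exp (|D| trnorm B).

   Such bounds control the number of zeros and the logarithmic derivative of
   the zero-free part (Blaschke factors, Borel-Caratheodory).  At x + i d the
   quotient F / G has no zero, so F'/F - G'/G = O(gamma_N) there.  At x - i d the
   same holds once the zeros of F of depth at least d^3, of which there are only
   O(gamma_N), are taken out; a disc centred far below the real axis covers them.
   Subtracting the two estimates leaves only the jumps of the terms 1 / (z - p)
   across the real axis, which are Poisson kernels: for x in a fixed window,
   the sums of d / ((x - Re p)^2 + d^2) over the zeros p of F near the axis and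
   over those of G differ by O_d(gamma_N) + O(N d).  Integrating over the window
   turns kernels into differences of arctangents, which count zeros up to the
   ends of the window.  As gamma_N = o(N), the counts agree up to O(N d), and d
   is arbitrary.  The kernel multiplicity of V at a real point is the order of
   the zero of G, because V is unitary with strictly monotone phase there. *)

Require Import Defs.
From mathcomp Require Import all_boot all_order all_algebra.
From mathcomp Require Import all_classical all_reals all_analysis.
From mathcomp Require Import ring lra.

Set Implicit Arguments.
Unset Strict Implicit.
Unset Printing Implicit Defensive.

Import Order.TTheory GRing.Theory Num.Theory.
Import numFieldNormedType.Exports.

Local Open Scope classical_set_scope.
Local Open Scope ring_scope.
Local Open Scope complex_scope.

(** The obstacle is the real axis: the hypotheses bound neither resolvent uniformly near it, so no
    estimate of F / G reaches the zeros that are to be counted. Below the axis even less is known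
    than above. There 1 - U has a bounded inverse only at depth at least Y1, so F / G is bounded
    above on rectangles but bounded below only at deep points; an upper bound on a disc and a lower
    bound at its centre are what a Jensen-type count of zeros needs. The exponent in d^3 comes from
    moving a zero p to Re p: this changes 1 / (z - p) by at most a constant times depth / d^2, that
    is O(d) per zero. The rest of O(N d) comes from the zero-free parts of F and G, whose
    logarithmic derivatives are Lipschitz with constant O(N) on a disc crossing the axis. There are
    no residues. Integrals over rectangles serve only to produce primitives on discs; the maximum
    principle applied to divided differences takes the place of Cauchy's estimates, and the mean
    value theorem that of integrating the kernels. *)

Notation normc := Normc.normc.
Notation Re := complex.Re.
Notation Im := complex.Im.

(** * Continuity and complex differentiability in epsilon form *)

Section ComplexCalculus.
Variable R : realType.
Local Notation C := R[i].
Implicit Types (f g : C -> C) (z w l h : C) (e d r x y : R).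

Lemma ler_normcD z w : normc (z + w) <= normc z + normc w.
Proof. exact: le_normcD. Qed.

Lemma normcN z : normc (- z) = normc z.
Proof. by case: z => a b; rewrite /= !sqrrN. Qed.

Lemma normcB z w : normc (z - w) = normc (w - z).
Proof. by rewrite -normcN opprB. Qed.

Lemma ler_normcB z w : normc (z - w) <= normc z + normc w.
Proof. by rewrite -(normcN w) ler_normcD. Qed.

Lemma lerB_normc z w : normc z - normc w <= normc (z - w).
Proof. by rewrite lerBlDr -{1}(subrK w z) ler_normcD. Qed.

Lemma lerB_normcD z w : normc z - normc w <= normc (z + w).
Proof. by rewrite -{2}(opprK w) -(normcN w) lerB_normc. Qed.

Lemma normc_ge0 z : 0 <= normc z.
Proof. by case: z => a b /=; rewrite sqrtr_ge0. Qed.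

Lemma normc0 : normc (0 : C) = 0. Proof. exact: Normc.normc0. Qed.

Lemma normc1 : normc (1 : C) = 1. Proof. exact: Normc.normc1. Qed.

Lemma normcM z w : normc (z * w) = normc z * normc w.
Proof. exact: Normc.normcM. Qed.

Lemma normcV z : normc z^-1 = (normc z)^-1.
Proof. exact: Normc.normcV. Qed.

Lemma normc_eq0 z : (normc z == 0) = (z == 0).
Proof.
by apply/eqP/eqP => [/Normc.eq0_normc|->]; rewrite ?normc0.
Qed.

Lemma normc_gt0 z : (0 < normc z) = (z != 0).
Proof. by rewrite lt_def normc_ge0 andbT normc_eq0. Qed.

Lemma normcX z n : normc (z ^+ n) = normc z ^+ n.
Proof.
elim: n => [|n IH]; first by rewrite !expr0 normc1.
by rewrite !exprS normcM IH.
Qed.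

Lemma normcr x : normc x%:C = `|x|.
Proof. by rewrite /= expr0n addr0 sqrtr_sqr. Qed.

Lemma ger0_normcr x : 0 <= x -> normc x%:C = x.
Proof. by move=> x0; rewrite normcr ger0_norm. Qed.

Lemma sqr_normcE z : normc z ^+ 2 = Re z ^+ 2 + Im z ^+ 2.
Proof. by case: z => a b /=; rewrite sqr_sqrtr // addr_ge0 // sqr_ge0. Qed.

Lemma ler_normRe z : `|Re z| <= normc z.
Proof.
rewrite -(ler_pXn2r (n := 2)) ?nnegrE ?normc_ge0 // sqr_normcE real_normK ?num_real //.
by rewrite lerDl sqr_ge0.
Qed.

Lemma ler_normIm z : `|Im z| <= normc z.
Proof.
rewrite -(ler_pXn2r (n := 2)) ?nnegrE ?normc_ge0 // sqr_normcE real_normK ?num_real //.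
by rewrite lerDr sqr_ge0.
Qed.

Lemma ler_Re z : Re z <= normc z.
Proof. exact: le_trans (ler_norm _) (ler_normRe z). Qed.

Lemma ler_normcReIm z : normc z <= `|Re z| + `|Im z|.
Proof.
rewrite -(ler_pXn2r (n := 2)) ?nnegrE ?normc_ge0 ?addr_ge0 // sqr_normcE sqrrD.
rewrite !real_normK ?num_real // [leRHS]addrAC lerDl.
by rewrite mulrn_wge0 // mulr_ge0.
Qed.

Lemma ReD z w : Re (z + w) = Re z + Re w. Proof. by case: z w => a b []. Qed.
Lemma ImD z w : Im (z + w) = Im z + Im w. Proof. by case: z w => a b []. Qed.
Lemma ReN z : Re (- z) = - Re z. Proof. by case: z. Qed.
Lemma ImN z : Im (- z) = - Im z. Proof. by case: z. Qed.
Lemma ReB z w : Re (z - w) = Re z - Re w. Proof. by rewrite ReD ReN. Qed.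
Lemma ImB z w : Im (z - w) = Im z - Im w. Proof. by rewrite ImD ImN. Qed.
Lemma ReM z w : Re (z * w) = Re z * Re w - Im z * Im w.
Proof. by case: z w => a b []. Qed.
Lemma ImM z w : Im (z * w) = Re z * Im w + Im z * Re w.
Proof. by case: z w => a b [c d]. Qed.
Lemma ReMr x z : Re (x%:C * z) = x * Re z.
Proof. by rewrite ReM /= mul0r subr0. Qed.
Lemma ImMr x z : Im (x%:C * z) = x * Im z.
Proof. by rewrite ImM /= mul0r addr0. Qed.

Lemma ReMl x z : Re (z * x%:C) = Re z * x.
Proof. by rewrite mulrC ReMr mulrC. Qed.
Lemma ImMl x z : Im (z * x%:C) = Im z * x.
Proof. by rewrite mulrC ImMr mulrC. Qed.

Lemma complexP z w : Re z = Re w -> Im z = Im w -> z = w.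
Proof. by case: z w => a b [c d] /= -> ->. Qed.

(* Witness: the conjugate of the phase of z. *)
Lemma phase_exists z : exists2 u : C, normc u = 1 & u * z = (normc z)%:C.
Proof.
have [->|z0] := eqVneq z 0; first by exists 1; rewrite ?normc1 // mulr0 normc0.
exists ((normc z)%:C / z); last by rewrite divfK.
by rewrite normcM normcV ger0_normcr ?normc_ge0 // divff // normc_eq0.
Qed.

(** Here and in [cderiv] the moduli are the real numbers [normc], so that estimates stay in [R] and
    are open to [lra] and [nra]. [is_derive_cderiv] identifies [cderiv] with [is_derive]. *)
Definition ccont f z := forall e, 0 < e ->
  exists2 d, 0 < d & forall w, normc (w - z) < d -> normc (f w - f z) < e.

Definition cderiv f z l := forall e, 0 < e ->
  exists2 d, 0 < d & forall w, normc (w - z) < d ->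
    normc (f w - f z - l * (w - z)) <= e * normc (w - z).

Lemma ccont_eq_near f g z r : 0 < r ->
  (forall w, normc (w - z) < r -> f w = g w) -> ccont f z -> ccont g z.
Proof.
move=> r0 fg cf e e0; have [d d0 H] := cf e e0.
exists (Num.min d r); first by rewrite lt_min d0.
move=> w; rewrite lt_min => /andP[wd wr].
rewrite -fg // -(fg z) ?subrr ?normc0 //; exact: H.
Qed.

Lemma cderiv_eq_near f g z l r : 0 < r ->
  (forall w, normc (w - z) < r -> f w = g w) -> cderiv f z l -> cderiv g z l.
Proof.
move=> r0 fg cf e e0; have [d d0 H] := cf e e0.
exists (Num.min d r); first by rewrite lt_min d0.
move=> w; rewrite lt_min => /andP[wd wr].
rewrite -fg // -(fg z) ?subrr ?normc0 //; exact: H.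
Qed.

Lemma ccont_cst c z : ccont (fun=> c) z.
Proof. by move=> e e0; exists 1 => // w _; rewrite subrr normc0. Qed.

Lemma ccont_id z : ccont id z.
Proof. by move=> e e0; exists e. Qed.

Lemma ccontD f g z : ccont f z -> ccont g z -> ccont (fun w => f w + g w) z.
Proof.
move=> cf cg e e0; have e20 : 0 < e / 2 by rewrite divr_gt0.
have [d1 d10 H1] := cf _ e20; have [d2 d20 H2] := cg _ e20.
exists (Num.min d1 d2); first by rewrite lt_min d10.
move=> w; rewrite lt_min => /andP[/H1 h1 /H2 h2].
rewrite opprD addrACA (le_lt_trans (ler_normcD _ _)) // [ltRHS](splitr e).
exact: ltrD.
Qed.

Lemma ccontM f g z : ccont f z -> ccont g z -> ccont (fun w => f w * g w) z.
Proof.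
move=> cf cg e e0.
pose M := normc (f z) + normc (g z) + 1.
have M0 : 0 < M by rewrite ltr_wpDl // addr_ge0 ?normc_ge0.
pose k := Num.min 1 (e / (2 * M)).
have k0 : 0 < k by rewrite lt_min ltr01 divr_gt0 // mulr_gt0.
have [d1 d10 H1] := cf _ k0; have [d2 d20 H2] := cg _ k0.
exists (Num.min d1 d2); first by rewrite lt_min d10.
move=> w; rewrite lt_min => /andP[/H1 h1 /H2 h2].
have -> : f w * g w - f z * g z =
  (f w - f z) * (g w - g z) + (f w - f z) * g z + f z * (g w - g z) by ring.
apply: le_lt_trans (ler_normcD _ _) _.
apply: le_lt_trans (lerD (ler_normcD _ _) (lexx _)) _.
rewrite !normcM.
have k1 : k <= 1 by rewrite ge_min lexx.
have ke : k * (2 * M) <= e.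
  by rewrite -ler_pdivlMr ?mulr_gt0 // ge_min lexx orbT.
move: h1 h2 ke M0; rewrite /M.
move: (normc (f w - f z)) (normc (g w - g z)) (normc_ge0 (f w - f z))
  (normc_ge0 (g w - g z)) (normc_ge0 (f z)) (normc_ge0 (g z)) => a b.
move: (normc (f z)) (normc (g z)) => A B a0 b0 A0 B0 ak bk ke M0.
nra.
Qed.

Lemma ccont_neq0 f z : ccont f z -> f z != 0 ->
  exists2 d, 0 < d & forall w, normc (w - z) < d -> normc (f z) / 2 <= normc (f w).
Proof.
move=> cf fz0; have e0 : 0 < normc (f z) / 2 by rewrite divr_gt0 ?normc_gt0.
have [d d0 H] := cf _ e0; exists d => // w /H.
rewrite normcB => h; have := lerB_normc (f z) (f w).
have : normc (f z) = normc (f z) / 2 + normc (f z) / 2 by rewrite -splitr.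
lra.
Qed.

Lemma ccontV f z : ccont f z -> f z != 0 -> ccont (fun w => (f w)^-1) z.
Proof.
move=> cf fz0 e e0; have [d1 d10 H1] := ccont_neq0 cf fz0.
pose A := normc (f z); have A0 : 0 < A by rewrite normc_gt0.
have k0 : 0 < e * A ^+ 2 / 2 by rewrite divr_gt0 // mulr_gt0 // exprn_gt0.
have [d2 d20 H2] := cf _ k0.
exists (Num.min d1 d2); first by rewrite lt_min d10.
move=> w; rewrite lt_min => /andP[/H1 h1 /H2 h2].
have B0 : 0 < normc (f w) by apply: lt_le_trans h1; rewrite divr_gt0.
have fw0 : f w != 0 by rewrite -normc_gt0.
have -> : (f w)^-1 - (f z)^-1 = (f z - f w) / (f w * f z) by field; rewrite fw0 fz0.
rewrite normcM normcV normcM normcB ltr_pdivrMr ?mulr_gt0 //.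
apply: lt_le_trans h2 _; rewrite -/A -mulrA ler_pM2l // expr2 -mulrA [leRHS]mulrC.
by rewrite ler_pM2l.
Qed.

(* Caratheodory's form of differentiability: the slope extends continuously. *)
Lemma cderivP f z l : cderiv f z l <-> exists s : C -> C,
  [/\ ccont s z, s z = l & forall w, f w = f z + s w * (w - z)].
Proof.
split=> [df|[s [cs <- fE]] e e0].
- pose s w := if w == z then l else (f w - f z) / (w - z).
  exists s; split; rewrite /s ?eqxx //.
  + move=> e e0; have e20 : 0 < e / 2 by rewrite divr_gt0.
    have [d d0 H] := df _ e20; exists d => // w /H h; rewrite eqxx.
    case: eqVneq => [_|wz]; first by rewrite subrr normc0.
    have wz0 : w - z != 0 by rewrite subr_eq0.
    have -> : (f w - f z) / (w - z) - l = (f w - f z - l * (w - z)) / (w - z).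
      by field.
    rewrite normcM normcV ltr_pdivrMr ?normc_gt0 //.
    apply: le_lt_trans h _; rewrite ltr_pM2r ?normc_gt0 //.
    by rewrite ltr_pdivrMr // ltr_pMr // ltr1n.
  + move=> w; case: eqVneq => [->|wz]; first by rewrite subrr mulr0 addr0.
    by rewrite divfK ?subr_eq0 // addrC subrK.
- have [d d0 H] := cs e e0; exists d => // w /H /ltW h.
  have -> : f w - f z - s z * (w - z) = (s w - s z) * (w - z) by rewrite (fE w); ring.
  rewrite normcM.
  by rewrite ler_wpM2r // normc_ge0.
Qed.

Lemma cderiv_ccont f z l : cderiv f z l -> ccont f z.
Proof.
move=> /cderivP[s [cs _ fE]].
apply: (@ccont_eq_near (fun w => f z + s w * (w - z)) _ _ 1) => //.
apply: ccontD; first exact: ccont_cst.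
apply: ccontM => //; apply: ccontD; [exact: ccont_id|exact: ccont_cst].
Qed.

Lemma cderiv_cst c z : cderiv (fun=> c) z 0.
Proof. by move=> e e0; exists 1 => // w _; rewrite subrr mul0r subr0 normc0 mulr_ge0 ?normc_ge0 // ltW. Qed.

Lemma cderiv_id z : cderiv id z 1.
Proof. by move=> e e0; exists 1 => // w _; rewrite mul1r subrr normc0 mulr_ge0 ?normc_ge0 // ltW. Qed.

Lemma cderivD f g z l m : cderiv f z l -> cderiv g z m ->
  cderiv (fun w => f w + g w) z (l + m).
Proof.
move=> /cderivP[s [cs <- fE]] /cderivP[t [ct <- gE]]; apply/cderivP.
exists (fun w => s w + t w); split => //; first exact: ccontD.
by move=> w; rewrite (fE w) (gE w); ring.
Qed.

Lemma cderivM f g z l m : cderiv f z l -> cderiv g z m ->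
  cderiv (fun w => f w * g w) z (l * g z + f z * m).
Proof.
move=> df dg; have cg := cderiv_ccont dg.
move: df dg => /cderivP[s [cs <- fE]] /cderivP[t [ct <- gE]]; apply/cderivP.
exists (fun w => s w * g w + f z * t w); split => //.
  by apply: ccontD; [exact: ccontM|apply: ccontM => //; exact: ccont_cst].
by move=> w; rewrite (fE w) (gE w); ring.
Qed.

Lemma cderivZ c f z l : cderiv f z l -> cderiv (fun w => c * f w) z (c * l).
Proof. by move=> df; have := cderivM (cderiv_cst c z) df; rewrite mul0r add0r. Qed.

Lemma cderivN f z l : cderiv f z l -> cderiv (fun w => - f w) z (- l).
Proof.
move=> /(cderivZ (-1)); rewrite mulN1r.
by apply: (@cderiv_eq_near _ _ _ _ 1) => // w _; rewrite mulN1r.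
Qed.

Lemma cderivB f g z l m : cderiv f z l -> cderiv g z m ->
  cderiv (fun w => f w - g w) z (l - m).
Proof. by move=> df /cderivN; exact: cderivD. Qed.

Lemma cderivV f z l : cderiv f z l -> f z != 0 ->
  cderiv (fun w => (f w)^-1) z (- l / f z ^+ 2).
Proof.
move=> df fz0; have cf := cderiv_ccont df.
have [d d0 H] := ccont_neq0 cf fz0.
move: df => /cderivP[s [cs <- fE]].
have dz0 : 0 < normc (f z) / 2 by rewrite divr_gt0 ?normc_gt0.
(* The slope must factor the difference at every [w], including points far from [z] where [f]
   vanishes and the inverse is 0 by convention; there [t] is the literal difference quotient. *)
pose t w := if f w == 0 then ((f w)^-1 - (f z)^-1) / (w - z) else - s w / (f w * f z).
apply/cderivP; exists t; rewrite {2}/t (negbTE fz0) -expr2; split => //.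
  apply: (@ccont_eq_near (fun w => - s w / (f w * f z)) _ _ d) => //.
    by move=> w /H /(lt_le_trans dz0); rewrite normc_gt0 /t => /negbTE->.
  apply: ccontM.
    apply: (@ccont_eq_near (fun w => (-1) * s w) _ _ 1) => //; first by move=> w _; rewrite mulN1r.
    by apply: ccontM => //; exact: ccont_cst.
  apply: ccontV; last by rewrite mulf_neq0.
  by apply: ccontM => //; exact: ccont_cst.
move=> w; have [->|wz] := eqVneq w z; first by rewrite subrr mulr0 addr0.
rewrite /t; case: eqVneq => [fw0|fw0].
  by rewrite divfK ?subr_eq0 // addrC subrK.
have sE : s w = (f w - f z) / (w - z).
  have wz0 : w - z != 0 by rewrite subr_eq0.
  by rewrite (fE w); field.
rewrite sE; field; rewrite fw0 fz0 subr_eq0 //.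
Qed.

Lemma cderiv_div f g z l m : cderiv f z l -> cderiv g z m -> g z != 0 ->
  cderiv (fun w => f w / g w) z ((l * g z - f z * m) / g z ^+ 2).
Proof.
move=> df dg gz0; have := cderivM df (cderivV dg gz0).
by congr cderiv; field.
Qed.

Lemma cderiv_uniq f z l m : cderiv f z l -> cderiv f z m -> l = m.
Proof.
move=> dl dm; apply/eqP; rewrite -subr_eq0 -normc_eq0 eq_le normc_ge0 andbT.
apply/ler_addgt0Pr => e e0; rewrite add0r.
have e20 : 0 < e / 2 by rewrite divr_gt0.
have [d1 d10 H1] := dl _ e20; have [d2 d20 H2] := dm _ e20.
pose k := Num.min d1 d2 / 2.
have k0 : 0 < k by rewrite divr_gt0 // lt_min d10.
have kd : k < Num.min d1 d2 by rewrite ltr_pdivrMr // ltr_pMr ?ltr1n // lt_min d10.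
move: kd; rewrite lt_min => /andP[k1 k2].
have E : normc (z + k%:C - z) = k by rewrite addrC addKr ger0_normcr // ltW.
have := H1 (z + k%:C); have := H2 (z + k%:C); rewrite !E => /(_ k2) h2 /(_ k1) h1.
rewrite -(ler_pM2r k0) -{1}(ger0_normcr (ltW k0)) -normcM.
have -> : (l - m) * k%:C = (f (z + k%:C) - f z - m * (z + k%:C - z))
                         - (f (z + k%:C) - f z - l * (z + k%:C - z)) by ring.
apply: le_trans (ler_normcB _ _) _; apply: le_trans (lerD h2 h1) _.
by rewrite -mulrDl -splitr.
Qed.

Lemma cderiv_shift f c z l :
  cderiv f (c + z) l -> cderiv (fun w => f (c + w)) z l.
Proof.
move=> df e e0; have [d d0 H] := df e e0; exists d => // w wd.
have E : c + w - (c + z) = w - z by ring.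
by have := H (c + w); rewrite E; apply.
Qed.

Lemma ccont_shift f c z : ccont f (c + z) -> ccont (fun w => f (c + w)) z.
Proof.
move=> df e e0; have [d d0 H] := df e e0; exists d => // w wd.
by apply: H; rewrite opprD addrACA subrr add0r.
Qed.

End ComplexCalculus.

(** * Paths in the complex plane and real primitives *)

Section RealPaths.
Variable R : realType.
Local Notation C := R[i].

(** Stated over any [numFieldType] so that it serves both for real functions and for functions of a
    complex variable. *)
Lemma is_derive_epsP (K : numFieldType) (f : K -> K) (z l : K) :
  is_derive z 1 f l <-> forall e : K, 0 < e -> exists2 d : K, 0 < d &
    forall w, `|w - z| < d -> `|f w - f z - l * (w - z)| <= e * `|w - z|.
Proof.
split=> [df e e0|H].
- have : h^-1 *: ((f \o shift z) (h *: 1) - f z) @[h --> 0^'] --> l.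
    rewrite -(@derive_val _ _ _ _ _ _ _ df).
    exact: ex_derive.
  move=> /cvgrPdist_le /(_ e e0) /nbhs_ballP[d /= d0 H].
  exists d => // w wd; have [->|wz] := eqVneq w z.
    by rewrite !subrr mulr0 subrr normr0 mulr0.
  have wz0 : w - z != 0 by rewrite subr_eq0.
  have := H (w - z); rewrite -ball_normE /ball_ /= sub0r normrN => /(_ wd wz0).
  rewrite [_%:A]mulr1 subrK => h.
  have -> : f w - f z - l * (w - z) = - (l - (w - z)^-1 * (f w - f z)) * (w - z).
    by field.
  by rewrite normrM normrN ler_wpM2r.
- have cv : h^-1 *: ((f \o shift z) (h *: 1) - f z) @[h --> 0^'] --> l.
    apply/cvgrPdist_le => e e0; have [d d0 Hd] := H e e0.
    apply/nbhs_ballP; exists d => //= h; rewrite -ball_normE /ball_ /= sub0r normrN => hd h0.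
    have := Hd (h + z); rewrite addrK => /(_ hd).
    rewrite [_%:A]mulr1 => Hh.
    have -> : l - h^-1 *: (f (h + z) - f z) = l - h^-1 * (f (h + z) - f z) by [].
    have -> : l - h^-1 * (f (h + z) - f z) = - (f (h + z) - f z - l * h) / h by field.
    by rewrite normrM normrN normfV ler_pdivrMr ?normr_gt0.
  split; first by apply/cvg_ex; exists l.
  exact: cvg_lim cv.
Qed.

Definition pderiv (p : R -> C) (t : R) (v : C) := forall e, 0 < e ->
  exists2 d, 0 < d & forall s, `|s - t| < d ->
    normc (p s - p t - v * (s - t)%:C) <= e * `|s - t|.

Lemma pderiv_Re p t v : pderiv p t v -> is_derive t 1 (fun s => Re (p s)) (Re v).
Proof.
move=> dp; apply/is_derive_epsP => e e0; have [d d0 H] := dp e e0.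
exists d => // s /H; apply: le_trans; apply: le_trans (ler_normRe _).
by rewrite !ReB ReMl.
Qed.

Lemma pderiv_Im p t v : pderiv p t v -> is_derive t 1 (fun s => Im (p s)) (Im v).
Proof.
move=> dp; apply/is_derive_epsP => e e0; have [d d0 H] := dp e e0.
exists d => // s /H; apply: le_trans; apply: le_trans (ler_normIm _).
by rewrite !ImB ImMl.
Qed.

Lemma pderiv_ReIm (f g : R -> R) (t a b : R) :
  is_derive t 1 f a -> is_derive t 1 g b ->
  pderiv (fun s => (f s) +i* (g s)) t (a +i* b).
Proof.
move=> /is_derive_epsP df /is_derive_epsP dg e e0.
have e20 : 0 < e / 2 by rewrite divr_gt0.
have [d1 d10 H1] := df _ e20; have [d2 d20 H2] := dg _ e20.
exists (Num.min d1 d2); first by rewrite lt_min d10.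
move=> s; rewrite lt_min => /andP[/H1 h1 /H2 h2].
apply: le_trans (ler_normcReIm _) _.
rewrite [e in leRHS]splitr mulrDl lerD //.
  by apply: le_trans h1; rewrite /= mulr0 subr0.
by apply: le_trans h2; rewrite /= mulr0 add0r.
Qed.

Lemma cderiv_pderiv (f : C -> C) (p : R -> C) t v l :
  cderiv f (p t) l -> pderiv p t v -> pderiv (fun s => f (p s)) t (l * v).
Proof.
move=> df dp e e0.
pose B := normc v + 1.
have B0 : 0 < B by rewrite ltr_wpDl ?normc_ge0.
pose e1 := e / (2 * B); have e10 : 0 < e1 by rewrite divr_gt0 // mulr_gt0.
have [d1 d10 H1] := df _ e10.
pose L := normc l + 1; have L0 : 0 < L by rewrite ltr_wpDl ?normc_ge0.
pose e2 := Num.min 1 (e / (2 * L)).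
have e20 : 0 < e2 by rewrite lt_min ltr01 divr_gt0 // mulr_gt0.
have [d2 d20 H2] := dp _ e20.
exists (Num.min d2 (d1 / B)); first by rewrite lt_min d20 divr_gt0.
move=> s; rewrite lt_min => /andP[/H2 h2 sd].
have ps : normc (p s - p t) <= B * `|s - t|.
  rewrite -(subrK (v * (s - t)%:C) (p s - p t)).
  apply: le_trans (ler_normcD _ _) _; rewrite normcM normcr /B mulrDl mul1r addrC lerD //.
  apply: le_trans h2 _; rewrite -[leRHS]mul1r ler_wpM2r //.
  by rewrite ge_min lexx.
have pd : normc (p s - p t) < d1.
  by apply: le_lt_trans ps _; rewrite mulrC -ltr_pdivlMr.
have -> : f (p s) - f (p t) - l * v * (s - t)%:C =
  (f (p s) - f (p t) - l * (p s - p t)) + l * (p s - p t - v * (s - t)%:C) by ring.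
apply: le_trans (ler_normcD _ _) _; rewrite [e in leRHS]splitr mulrDl lerD //.
  apply: le_trans (H1 _ pd) _; apply: le_trans (ler_wpM2l (ltW e10) ps) _.
  by rewrite mulrA ler_wpM2r // /e1 invfM mulrA divfK ?gt_eqF.
rewrite normcM; apply: le_trans (ler_wpM2l (normc_ge0 _) h2) _.
rewrite mulrA ler_wpM2r //.
apply: le_trans (ler_wpM2r (ltW e20) (_ : normc l <= L)) _; first by rewrite lerDl.
apply: (@le_trans _ _ (L * (e / (2 * L)))).
  by rewrite ler_pM2l // ge_min lexx orbT.
by rewrite invfM [e * _]mulrA mulrCA divff ?mulr1 // gt_eqF.
Qed.

Lemma is_derive_cont (g : R -> R) (t a : R) : is_derive t 1 g a -> {for t, continuous g}.
Proof. by move=> dg; apply: differentiable_continuous; apply/derivable1_diffP; exact: ex_derive. Qed.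

Lemma path_MVT (p v : R -> C) (a b : R) : a < b ->
  (forall t, a <= t <= b -> pderiv p t (v t)) ->
  exists2 c, a < c < b & Re (p b) - Re (p a) = Re (v c) * (b - a).
Proof.
move=> ab dp.
have dR (t : R) : a <= t <= b -> is_derive t 1 (fun s => Re (p s)) (Re (v t)).
  by move=> /dp; exact: pderiv_Re.
have [||c] := @MVT _ (fun s => Re (p s)) (fun s => Re (v s)) _ _ ab.
- by move=> t; rewrite in_itv /= => /andP[/ltW ? /ltW ?]; apply: dR; apply/andP.
- apply: continuous_in_subspaceT => t; rewrite inE /= in_itv /= => tab.
  exact: is_derive_cont (dR _ tab).
by rewrite in_itv /=; exists c.
Qed.

(** The mean value theorem fails for complex values but holds for real parts. Multiplying the path
    by the phase that makes [p b - p a] real and nonnegative reduces the modulus to a real part. *)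
Lemma path_lip (p v : R -> C) (K a b : R) : a <= b ->
  (forall t, a <= t <= b -> pderiv p t (v t)) ->
  (forall t, a <= t <= b -> normc (v t) <= K) ->
  normc (p b - p a) <= K * (b - a).
Proof.
rewrite le_eqVlt => /predU1P[<- _ _|ab dp vK]; first by rewrite !subrr mulr0 normc0.
have [u u1 uE] := phase_exists (p b - p a).
have du t : a <= t <= b -> pderiv (fun s => u * p s) t (u * v t).
  move=> /dp; apply: cderiv_pderiv.
  by have := cderivZ u (@cderiv_id R (p t)); rewrite mulr1.
have [c /andP[ac cb] cE] := path_MVT ab du.
have -> : normc (p b - p a) = Re (u * p b) - Re (u * p a).
  by rewrite -ReB -mulrBr uE.
rewrite cE ler_wpM2r ?subr_ge0 ?(ltW ab) //.
apply: le_trans (ler_Re _) _; rewrite normcM u1 mul1r vK //.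
by rewrite !ltW.
Qed.

(** The fundamental theorem of calculus gives a primitive on each segment [-n-1, n+1]. Normalised to
    vanish at 0, these agree where both are defined, having the same derivative, and so glue to a
    primitive on the line. *)
Lemma antiderivative_exists (g : R -> R) : continuous g ->
  exists G : R -> R, forall t : R, is_derive t 1 G (g t).
Proof.
move=> cg.
have loc (n : nat) : exists G : R -> R, G 0 = 0 /\
    forall t : R, `|t| < n.+1%:R -> is_derive t 1 G (g t).
  pose a : R := - n.+1%:R; pose b : R := n.+1%:R.
  pose F x := \int[lebesgue_measure]_(t in `[a, x]) g t.
  have ig : lebesgue_measure.-integrable `[a, b] (EFin \o g).
    apply: continuous_compact_integrable; first exact: segment_compact.
    by apply: continuous_subspaceT => x; exact: cg.
  have dF (t : R) : `|t| < n.+1%:R -> is_derive t 1 F (g t).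
    rewrite ltr_norml => /andP[at_ tb].
    have [dt <-] := continuous_FTC1_closed tb ig at_ (cg t).
    by apply: (DeriveDef dt); rewrite derive1E.
  exists (fun x => F x - F 0); split=> [|t tn]; first by rewrite subrr.
  have := is_deriveB (dF t tn) (is_derive_cst (F 0) t 1).
  by rewrite subr0.
have [G GP] := choice loc.
have GE n m t : `|t| < n.+1%:R -> `|t| < m.+1%:R -> G n t = G m t.
  have main (k : nat) (a b : R) : a <= b ->
      (forall x : R, a <= x <= b -> is_derive x 1 (G n \- G m) 0) ->
      (G n \- G m) b = (G n \- G m) a.
    move=> ab dG.
    have [||c _] := @MVT_segment _ (G n \- G m) (fun=> 0) a b ab.
    - by move=> x; rewrite in_itv /= => /andP[/ltW ? /ltW ?]; apply: dG; apply/andP.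
    - apply: continuous_in_subspaceT => x; rewrite inE /= in_itv /= => xab.
      exact: is_derive_cont (dG _ xab).
    by rewrite mul0r => /eqP; rewrite subr_eq0 => /eqP.
  move=> tn tm.
  have d0 (x : R) : `|x| <= `|t| -> is_derive x 1 (G n \- G m) 0.
    move=> xt.
    have := is_deriveB ((GP n).2 x (le_lt_trans xt tn)) ((GP m).2 x (le_lt_trans xt tm)).
    by rewrite subrr.
  have z0 : (G n \- G m) 0 = 0 by rewrite /= (GP n).1 (GP m).1 subrr.
  apply/eqP; rewrite -subr_eq0 -/((G n \- G m) t) -[X in _ == X]z0; apply/eqP.
  have [t0|/ltW t0] := leP 0 t.
    apply: (main 0%N) => // x /andP[x0 xt]; apply: d0.
    by rewrite !ger0_norm // (le_trans x0).
  apply/esym; apply: (main 0%N) => // x /andP[tx x0]; apply: d0.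
  by rewrite !ler0_norm // lerN2.
(* The index [(N x).+1] is one larger than [x] requires; this margin lets the single primitive
   [G (N t).+1] serve on the unit ball around [t]. *)
pose N (x : R) := Num.truncn `|x|.
exists (fun x => G (N x).+1 x) => t.
have tN : `|t| < (N t).+1%:R by apply: truncnS_gt.
have dG : is_derive t 1 (G (N t).+1) (g t).
  by apply: (GP _).2; apply: lt_trans tN _; rewrite ltr_nat.
apply: (near_eq_is_derive _ dG).
apply/nbhs_ballP; exists 1 => //= x; rewrite -ball_normE /ball_ /= distrC => xt.
apply: GE; last by apply: lt_trans (truncnS_gt _) _; rewrite ltr_nat.
have -> : x = t + (x - t) by rewrite addrC subrK.
apply: le_lt_trans (ler_normD _ _) _.
by rewrite -[_.+2%:R]natr1 ltrD.
Qed.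

End RealPaths.

(** * Goursat's theorem and the maximum principle *)

Section Goursat.
Variable R : realType.
Local Notation C := R[i].
Implicit Types (f g Q : C -> C) (z w l : C) (p : R -> C).

Definition cprim p : R -> C :=
  if pselect (exists P : R -> C, forall t, pderiv P t (p t)) is left H
  then sval (cid H) else fun=> 0.

Definition cint p (a b : R) : C := cprim p b - cprim p a.

(** The counterclockwise boundary integral. Each side contributes a difference of values of a
    primitive, so additivity and reversal of orientation are ring identities and need no order on
    the corners. *)
Definition rectint f (x1 x2 y1 y2 : R) : C :=
  cint (fun t => f (t +i* y1)) x1 x2 - cint (fun t => f (t +i* y2)) x1 x2
  + 'i * cint (fun t => f (x2 +i* t)) y1 y2 - 'i * cint (fun t => f (x1 +i* t)) y1 y2.

Lemma cprimP p : (forall t e, 0 < e -> exists2 d, 0 < d &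
    forall s, `|s - t| < d -> normc (p s - p t) < e) ->
  forall t, pderiv (cprim p) t (p t).
Proof.
move=> cp.
have cRe : continuous (fun t => Re (p t)).
  move=> t; apply/cvgrPdist_le => e e0; have [d d0 H] := cp t e e0.
  apply/nbhs_ballP; exists d => //= s; rewrite /ball_ /= distrC => /H h.
  by rewrite -ReB (le_trans (ler_normRe _)) // normcB ltW.
have cIm : continuous (fun t => Im (p t)).
  move=> t; apply/cvgrPdist_le => e e0; have [d d0 H] := cp t e e0.
  apply/nbhs_ballP; exists d => //= s; rewrite /ball_ /= distrC => /H h.
  by rewrite -ImB (le_trans (ler_normIm _)) // normcB ltW.
have [F FP] := antiderivative_exists cRe.
have [G GP] := antiderivative_exists cIm.
rewrite /cprim; case: pselect => [H|[]]; first by case: cid.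
exists (fun s => (F s) +i* (G s)) => t.
by have := pderiv_ReIm (FP t) (GP t); case: (p t).
Qed.

Lemma cint_add p a b c : cint p a b + cint p b c = cint p a c.
Proof. by rewrite /cint addrC addrA subrK. Qed.

Lemma pderivB (p q : R -> C) t v w :
  pderiv p t v -> pderiv q t w -> pderiv (fun s => p s - q s) t (v - w).
Proof.
move=> dp dq e e0; have e20 : 0 < e / 2 by rewrite divr_gt0.
have [d1 d10 H1] := dp _ e20; have [d2 d20 H2] := dq _ e20.
exists (Num.min d1 d2); first by rewrite lt_min d10.
move=> s; rewrite lt_min => /andP[/H1 h1 /H2 h2].
have -> : p s - q s - (p t - q t) - (v - w) * (s - t)%:C =
  (p s - p t - v * (s - t)%:C) - (q s - q t - w * (s - t)%:C) by ring.
by rewrite (le_trans (ler_normcB _ _)) // [e in leRHS]splitr mulrDl lerD.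
Qed.

Lemma pderiv_hor (y t : R) : pderiv (fun s => s +i* y) t 1.
Proof.
move=> e e0; exists 1 => // s _.
have -> : s +i* y - t +i* y - 1 * (s - t)%:C = 0 :> C.
  by rewrite mul1r; apply: complexP; rewrite /= ?subrr ?subr0 ?oppr0 ?addr0 ?subrr.
by rewrite normc0 mulr_ge0 // ltW.
Qed.

Lemma pderiv_ver (x t : R) : pderiv (fun s => x +i* s) t 'i.
Proof.
move=> e e0; exists 1 => // s _.
have -> : x +i* s - x +i* t - 'i * (s - t)%:C = 0 :> C.
  by apply: complexP; rewrite /= ?mul0r ?mul1r ?mulr0 ?subr0 ?addr0 ?subrr ?oppr0 ?addr0 // add0r subrr.
by rewrite normc0 mulr_ge0 // ltW.
Qed.

Lemma normc_i : normc ('i : C) = 1.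
Proof. by rewrite /= expr0n expr1n add0r sqrtr1. Qed.

Section Rect.
Variables (f Q A : C -> C).
Hypothesis cf : forall z, ccont f z.
Hypothesis dQ : forall z, cderiv Q z (A z).

Lemma cprim_hor y t : pderiv (cprim (fun t => f (t +i* y))) t (f (t +i* y)).
Proof.
apply: (@cprimP (fun t => f (t +i* y))) => {}t e e0.
have [d d0 H] := cf (t +i* y) e0; exists d => // s sd; apply: H.
have -> : s +i* y - t +i* y = (s - t)%:C :> C by apply: complexP; rewrite //= subrr.
by rewrite normcr.
Qed.

Lemma cprim_ver x t : pderiv (cprim (fun t => f (x +i* t))) t (f (x +i* t)).
Proof.
apply: (@cprimP (fun t => f (x +i* t))) => {}t e e0.
have [d d0 H] := cf (x +i* t) e0; exists d => // s sd; apply: H.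
have -> : x +i* s - x +i* t = 'i * (s - t)%:C :> C.
  by apply: complexP; rewrite /= ?subrr ?mul0r ?mulr0 ?mul1r ?addr0 ?add0r ?oppr0 ?subr0.
by rewrite normcM normcr normc_i mul1r.
Qed.

Lemma cint_hor_approx y a b K : a <= b ->
  (forall t, a <= t <= b -> normc (f (t +i* y) - A (t +i* y)) <= K) ->
  normc (cint (fun t => f (t +i* y)) a b - (Q (b +i* y) - Q (a +i* y))) <= K * (b - a).
Proof.
move=> ab fK; rewrite /cint.
set P := cprim _.
have := @path_lip _ (fun t => P t - Q (t +i* y)) (fun t => f (t +i* y) - A (t +i* y))
  K a b ab.
have -> : P b - P a - (Q (b +i* y) - Q (a +i* y)) =
  P b - Q (b +i* y) - (P a - Q (a +i* y)) by ring.
apply => // t _; apply: pderivB; first exact: cprim_hor.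
by have := cderiv_pderiv (dQ (t +i* y)) (@pderiv_hor y t); rewrite mulr1.
Qed.

Lemma cint_ver_approx x a b K : a <= b ->
  (forall t, a <= t <= b -> normc (f (x +i* t) - A (x +i* t)) <= K) ->
  normc ('i * cint (fun t => f (x +i* t)) a b - (Q (x +i* b) - Q (x +i* a))) <= K * (b - a).
Proof.
move=> ab fK; rewrite /cint.
set P := cprim _.
have := @path_lip _ (fun t => 'i * P t - Q (x +i* t))
  (fun t => 'i * (f (x +i* t) - A (x +i* t))) K a b ab.
have -> : 'i * (P b - P a) - (Q (x +i* b) - Q (x +i* a)) =
  'i * P b - Q (x +i* b) - ('i * P a - Q (x +i* a)) by ring.
apply => [t _|t tab]; last by rewrite normcM normc_i mul1r fK.
rewrite mulrBr; apply: pderivB.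
  have := cderivZ 'i (@cderiv_id R (P t)); rewrite mulr1 => di.
  exact: (cderiv_pderiv di (cprim_ver x t)).
by have := cderiv_pderiv (dQ (x +i* t)) (@pderiv_ver x t); rewrite mulrC.
Qed.

(** The increments of the primitive [Q] telescope around the boundary, so only [f - A] contributes:
    at most [K] times the perimeter. *)
Lemma rectint_approx x1 x2 y1 y2 K : x1 <= x2 -> y1 <= y2 ->
  (forall x y, x1 <= x <= x2 -> y1 <= y <= y2 ->
     normc (f (x +i* y) - A (x +i* y)) <= K) ->
  normc (rectint f x1 x2 y1 y2) <= 2 * K * ((x2 - x1) + (y2 - y1)).
Proof.
move=> x12 y12 fK.
have h1 : normc _ <= _ := @cint_hor_approx y1 x1 x2 K x12 (fun t tx => fK _ _ tx _).
have h2 : normc _ <= _ := @cint_hor_approx y2 x1 x2 K x12 (fun t tx => fK _ _ tx _).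
have h3 : normc _ <= _ := @cint_ver_approx x1 y1 y2 K y12 (fun t tx => fK _ _ _ tx).
have h4 : normc _ <= _ := @cint_ver_approx x2 y1 y2 K y12 (fun t tx => fK _ _ _ tx).
move: h1 h2 h3 h4; rewrite !lexx !x12 !y12 => /(_ isT) h1 /(_ isT) h2 /(_ isT) h3 /(_ isT) h4.
rewrite /rectint.
set a := cint _ _ _ in h1 *; set b := cint _ _ _ in h2 *.
set c := 'i * cint (fun t => f (x1 +i* t)) y1 y2 in h3 *.
set d := 'i * cint (fun t => f (x2 +i* t)) y1 y2 in h4 *.
have -> : a - b + d - c = (a - (Q (x2 +i* y1) - Q (x1 +i* y1)))
   - (b - (Q (x2 +i* y2) - Q (x1 +i* y2)))
   + (d - (Q (x2 +i* y2) - Q (x2 +i* y1)))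
   - (c - (Q (x1 +i* y2) - Q (x1 +i* y1))) by ring.
apply: le_trans (ler_normcB _ _) _.
apply: le_trans (lerD (ler_normcD _ _) (lexx _)) _.
apply: le_trans (lerD (lerD (ler_normcB _ _) (lexx _)) (lexx _)) _.
lra.
Qed.

End Rect.

Lemma rectint_addx f x1 x2 x3 y1 y2 :
  rectint f x1 x2 y1 y2 + rectint f x2 x3 y1 y2 = rectint f x1 x3 y1 y2.
Proof. by rewrite /rectint -!(cint_add _ x1 x2 x3); ring. Qed.

Lemma rectint_addy f x1 x2 y1 y2 y3 :
  rectint f x1 x2 y1 y2 + rectint f x1 x2 y2 y3 = rectint f x1 x2 y1 y3.
Proof. by rewrite /rectint -!(cint_add _ y1 y2 y3); ring. Qed.

Lemma rectintxx f x y1 y2 : rectint f x x y1 y2 = 0.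
Proof. by rewrite /rectint /cint; ring. Qed.

Lemma rectintyy f x1 x2 y : rectint f x1 x2 y y = 0.
Proof. by rewrite /rectint /cint; ring. Qed.

End Goursat.

Section GoursatTheorem.
Variable R : realType.
Local Notation C := R[i].
Implicit Types (f g Q : C -> C) (z w l : C).

Section Bisection.
Variables (f : C -> C) (x0 y0 w h K : R).
Hypotheses (w0 : 0 <= w) (h0 : 0 <= h).

Let W n := w / 2 ^+ n.
Let H n := h / 2 ^+ n.
Let I n (q : R * R) := rectint f q.1 (q.1 + W n) q.2 (q.2 + H n).
Let bad n q := K * (W n + H n) ^+ 2 < normc (I n q).

Let W_S n : W n = W n.+1 + W n.+1.
Proof. by rewrite /W exprS; field; rewrite expf_neq0 // pnatr_eq0. Qed.
Let H_S n : H n = H n.+1 + H n.+1.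
Proof. by rewrite /H exprS; field; rewrite expf_neq0 // pnatr_eq0. Qed.
Let W_ge0 n : 0 <= W n. Proof. by rewrite divr_ge0 // exprn_ge0. Qed.
Let H_ge0 n : 0 <= H n. Proof. by rewrite divr_ge0 // exprn_ge0. Qed.

(** Halving both sides divides the square of [W n + H n] by 4, while the integral is the sum over
    the four quarters; if all four satisfied the bound, so would the whole. *)
Let bad_quarter n q : bad n q -> exists q',
  [/\ bad n.+1 q', q.1 <= q'.1, q'.1 + W n.+1 <= q.1 + W n, q.2 <= q'.2
    & q'.2 + H n.+1 <= q.2 + H n].
Proof.
case: q => x y; rewrite /bad => badq /=.
have W0 := W_ge0 n.+1; have H0 := H_ge0 n.+1.
have split4 : I n (x, y) = I n.+1 (x, y) + I n.+1 (x + W n.+1, y)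
    + (I n.+1 (x, y + H n.+1) + I n.+1 (x + W n.+1, y + H n.+1)).
  have ex : x + W n = x + W n.+1 + W n.+1 by rewrite -addrA -W_S.
  have ey : y + H n = y + H n.+1 + H n.+1 by rewrite -addrA -H_S.
  by rewrite /I /= ex ey rectint_addx rectint_addx rectint_addy.
apply: contrapT => nex.
have good q' : x <= q'.1 -> q'.1 + W n.+1 <= x + W n -> y <= q'.2 ->
    q'.2 + H n.+1 <= y + H n -> normc (I n.+1 q') <= K * (W n.+1 + H n.+1) ^+ 2.
  by move=> *; rewrite leNgt; apply/negP => b; apply: nex; exists q'.
have g1 := good (x, y); have g2 := good (x + W n.+1, y).
have g3 := good (x, y + H n.+1); have g4 := good (x + W n.+1, y + H n.+1).
move: g1 g2 g3 g4; rewrite /= (W_S n) (H_S n) => g1 g2 g3 g4.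
have {}g1 : normc (I n.+1 (x, y)) <= K * (W n.+1 + H n.+1) ^+ 2 by apply: g1; rewrite -?addrA ?lerD2l ?lerDl ?lexx.
have {}g2 : normc (I n.+1 (x + W n.+1, y)) <= K * (W n.+1 + H n.+1) ^+ 2 by apply: g2; rewrite -?addrA ?lerD2l ?lerDl ?lexx.
have {}g3 : normc (I n.+1 (x, y + H n.+1)) <= K * (W n.+1 + H n.+1) ^+ 2 by apply: g3; rewrite -?addrA ?lerD2l ?lerDl ?lexx.
have {}g4 : normc (I n.+1 (x + W n.+1, y + H n.+1)) <= K * (W n.+1 + H n.+1) ^+ 2.
  by apply: g4; rewrite -?addrA ?lerD2l ?lerDl ?lexx.
move: badq; apply/negP; rewrite -leNgt split4.
apply: le_trans (ler_normcD _ _) _.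
apply: le_trans (lerD (ler_normcD _ _) (ler_normcD _ _)) _.
apply: le_trans (lerD (lerD g1 g2) (lerD g3 g4)) _.
by rewrite (W_S n) (H_S n) le_eqVlt; apply/orP; left; apply/eqP; ring.
Qed.

Lemma goursat_bisection : K * (w + h) ^+ 2 < normc (rectint f x0 (x0 + w) y0 (y0 + h)) ->
  exists x y, [/\ x0 <= x <= x0 + w, y0 <= y <= y0 + h & forall d, 0 < d ->
    exists x1 x2 y1 y2, [/\ x1 <= x <= x2, y1 <= y <= y2, x2 - x1 + (y2 - y1) < d &
     K * (x2 - x1 + (y2 - y1)) ^+ 2 < normc (rectint f x1 x2 y1 y2)]].
Proof.
move=> bad0.
(* A state carries its level, its lower left corner and the proof that the rectangle is bad, so that
   dependent choice yields the nested sequence. *)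
pose T := {s : nat * (R * R) | bad s.1 s.2}.
pose next (s s' : T) := [/\ (sval s').1 = (sval s).1.+1,
   (sval s).2.1 <= (sval s').2.1,
   (sval s').2.1 + W (sval s').1 <= (sval s).2.1 + W (sval s).1,
   (sval s).2.2 <= (sval s').2.2
 & (sval s').2.2 + H (sval s').1 <= (sval s).2.2 + H (sval s).1].
have nextP (s : T) : exists s', next s s'.
  case: s => -[n q] /= b; have [q' [b' ? ? ? ?]] := bad_quarter b.
  by exists (exist (fun s : nat * (R * R) => bad s.1 s.2) (n.+1, q') b').
have b0 : bad 0 (x0, y0) by rewrite /bad /I /W /H /= expr0 !divr1.
have [F [F0 FS]] := dependent_choice (fun s => cid (nextP s))
  (exist (fun s : nat * (R * R) => bad s.1 s.2) (0%N, (x0, y0)) b0).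
have Fn n : (sval (F n)).1 = n.
  by elim: n => [|n IH]; [rewrite F0|case: (FS n) => ->; rewrite IH].
pose X n := (sval (F n)).2.1; pose Y n := (sval (F n)).2.2.
have badn n : bad n (X n, Y n).
  by have := svalP (F n); rewrite Fn /X /Y; case: (sval (F n)).2.
have XS n : X n <= X n.+1 /\ X n.+1 + W n.+1 <= X n + W n.
  by case: (FS n) => _; rewrite !Fn.
have YS n : Y n <= Y n.+1 /\ Y n.+1 + H n.+1 <= Y n + H n.
  by case: (FS n) => _; rewrite !Fn.
have nest (u s : nat -> R) : (forall n, 0 <= s n) ->
    (forall n, u n <= u n.+1 /\ u n.+1 + s n.+1 <= u n + s n) ->
    exists a, forall n, u n <= a <= u n + s n.
  move=> s0 us.
  have mono n k : u n <= u (n + k)%N /\ u (n + k)%N + s (n + k)%N <= u n + s n.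
    elim: k => [|k [IH1 IH2]]; first by rewrite addn0.
    rewrite addnS; have [h1 h2] := us (n + k)%N.
    by split; [exact: le_trans h1|exact: le_trans IH2].
  have ub n m : u m <= u n + s n.
    case: (leqP m n) => [/subnKC <-|/ltnW /subnKC <-].
      by have [h1 h2] := mono m (n - m)%N; rewrite (le_trans h1) // lerDl.
    by have [h1 h2] := mono n (m - n)%N; rewrite (le_trans _ h2) // lerDl.
  exists (sup (range u)) => n; apply/andP; split.
    apply: ub_le_sup; last by exists n.
    by exists (u 0%N + s 0%N) => _ [m _ <-].
  apply: ge_sup; first by exists (u 0%N), 0%N.
  by move=> _ [m _ <-].
have [x xP] := nest X W W_ge0 XS; have [y yP] := nest Y H H_ge0 YS.
exists x, y; split.
- by have := xP 0%N; rewrite /X F0 /= /W expr0 divr1.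
- by have := yP 0%N; rewrite /Y F0 /= /H expr0 divr1.
move=> d d0.
have [n nP] : exists n, W n + H n < d.
  pose n := Num.truncn ((w + h) / d); exists n.+1.
  have wh0 : 0 <= (w + h) / d by rewrite divr_ge0 ?addr_ge0 // ltW.
  rewrite /W /H -mulrDl ltr_pdivrMr ?exprn_gt0 // mulrC -ltr_pdivrMr //.
  apply: lt_trans (truncnS_gt _) _.
  by rewrite -natrX ltr_nat ltn_expl.
have sX : X n + W n - X n = W n by rewrite addrC addKr.
have sY : Y n + H n - Y n = H n by rewrite addrC addKr.
exists (X n), (X n + W n), (Y n), (Y n + H n); split => //; first by rewrite sX sY.
by rewrite sX sY; have := badn n.
Qed.

End Bisection.

Lemma goursat_rect f x1 x2 y1 y2 : (forall z, ccont f z) ->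
  x1 <= x2 -> y1 <= y2 ->
  (forall x y, x1 <= x <= x2 -> y1 <= y <= y2 -> exists l, cderiv f (x +i* y) l) ->
  rectint f x1 x2 y1 y2 = 0.
Proof.
move=> cf x12 y12 df; apply/eqP; rewrite -normc_eq0 eq_le normc_ge0 andbT leNgt.
apply/negP => I0.
pose w := x2 - x1; pose h := y2 - y1.
have w0 : 0 <= w by rewrite subr_ge0.
have h0 : 0 <= h by rewrite subr_ge0.
(* The summand 1 keeps the denominator positive for a degenerate rectangle, and the factor 2 makes
   the starting rectangle strictly bad. *)
pose K := normc (rectint f x1 x2 y1 y2) / (2 * ((w + h) ^+ 2 + 1)).
have ex : x1 + w = x2 by rewrite addrC subrK.
have ey : y1 + h = y2 by rewrite addrC subrK.
have q0 : 0 < (w + h) ^+ 2 + 1 by rewrite ltr_wpDl // sqr_ge0.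
have K0 : 0 < K by rewrite divr_gt0 // mulr_gt0.
have badK : K * (w + h) ^+ 2 < normc (rectint f x1 (x1 + w) y1 (y1 + h)).
  rewrite ex ey /K mulrAC ltr_pdivrMr ?mulr_gt0 // ltr_pM2l //.
  by have := sqr_ge0 (w + h); lra.
have [x [y [xP yP H]]] := goursat_bisection w0 h0 badK.
rewrite ex in xP; rewrite ey in yP.
have [l dl] := df _ _ xP yP.
have K20 : 0 < K / 2 by rewrite divr_gt0.
have [d d0 Hd] := dl _ K20.
have [a [b [c [e [xab yce de]]]]] := H d d0.
apply/negP; rewrite -leNgt.
pose z := x +i* y : C.
pose s := b - a + (e - c).
have s0 : 0 <= s.
  by move/andP: xab => [? ?]; move/andP: yce => [? ?]; rewrite /s; lra.
(* The first-order expansion of [f] at [z] has a quadratic primitive. The remainder is at most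
   [K / 2 * s] on a rectangle with sum of sides [s], so the integral is at most [K * s ^+ 2],
   against badness. *)
have := @rectint_approx _ f (fun w => f z * w + (l / 2%:R) * (w - z) ^+ 2)
  (fun w => f z + l * (w - z)) cf _ a b c e (K / 2 * s).
have -> : 2 * (K / 2 * s) * (b - a + (e - c)) = K * (b - a + (e - c)) ^+ 2.
  by rewrite /s; field.
apply.
- move=> w'; have d1 := cderivZ (f z) (@cderiv_id R w').
  have d2 := cderivB (@cderiv_id R w') (@cderiv_cst R z w').
  have d3 := cderivZ (l / 2%:R) (cderivM d2 d2).
  have := cderivD d1 d3.
  have -> : f z * 1 + l / 2%:R * ((1 - 0) * (w' - z) + (w' - z) * (1 - 0)) =
     f z + l * (w' - z) by field.
  by [].
- by move/andP: xab => [? ?]; lra.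
- by move/andP: yce => [? ?]; lra.
- move=> u v uab vce.
  have uz : normc (u +i* v - z) <= s.
    apply: le_trans (ler_normcReIm _) _; rewrite /s lerD //= ler_norml.
      by move/andP: xab => [? ?]; move/andP: uab => [? ?]; lra.
    by move/andP: yce => [? ?]; move/andP: vce => [? ?]; lra.
  rewrite opprD addrA; apply: le_trans (Hd _ _) _; first exact: le_lt_trans uz _.
  by rewrite ler_pM2l.
Qed.

(** A neighbourhood of [p] inside [a, b]. By the last two conclusions the leftover pieces [a, l] and
    [r, b] contain [p] only if they are degenerate. *)
Lemma clamp_interval (a b p t : R) : a <= p -> p <= b -> 0 < t -> exists l r : R,
  [/\ a <= l, l <= p, p <= r & r <= b] /\
  [/\ p - t <= l, r <= p + t, p <= l -> a = l & r <= p -> r = b].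
Proof.
move=> ap pb t0; exists (Num.max a (p - t)), (Num.min b (p + t)).
have pt1 : p - t < p by rewrite ltrBlDr ltrDl.
have pt2 : p < p + t by rewrite ltrDl.
split; split; rewrite ?le_max ?ge_max ?le_min ?ge_min ?lexx ?orbT ?ap ?pb ?(ltW pt1) ?(ltW pt2) //.
- rewrite [p <= p - t]leNgt pt1 orbF => pa.
  by apply/esym/max_l; exact: le_trans (ltW pt1) pa.
- rewrite [p + t <= p]leNgt pt2 orbF => bp.
  by apply: min_l; exact: le_trans bp (ltW pt2).
Qed.

(* The exceptional points are cut out by squares of vanishing size. *)
Lemma goursat (S : seq C) f x1 x2 y1 y2 : (forall z, ccont f z) ->
  x1 <= x2 -> y1 <= y2 ->
  (forall x y, x1 <= x <= x2 -> y1 <= y <= y2 -> x +i* y \notin S ->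
     exists l, cderiv f (x +i* y) l) ->
  rectint f x1 x2 y1 y2 = 0.
Proof.
move=> cf; elim: S x1 x2 y1 y2 => [|p S IH] x1 x2 y1 y2 x12 y12 df.
  by apply: goursat_rect => // x y xP yP; exact: df.
have avoid a1 a2 b1 b2 : x1 <= a1 -> a1 <= a2 -> a2 <= x2 -> y1 <= b1 -> b1 <= b2 ->
    b2 <= y2 -> (a1 <= Re p <= a2 -> b1 <= Im p <= b2 -> a1 = a2 \/ b1 = b2) ->
    rectint f a1 a2 b1 b2 = 0.
  move=> h1 a12 h2 h3 b12 h4 np.
  have [pin|pout] := pselect (a1 <= Re p <= a2 /\ b1 <= Im p <= b2).
    by have [<-|<-] := np pin.1 pin.2; rewrite ?rectintxx ?rectintyy.
  apply: IH => // x y /andP[xa xb] /andP[ya yb] xyS; apply: df.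
  - by rewrite (le_trans h1) // (le_trans xb).
  - by rewrite (le_trans h3) // (le_trans yb).
  - rewrite inE negb_or xyS andbT; apply: contra_notN pout => /eqP <- /=.
    by rewrite xa xb ya yb.
have [pin|pout] := boolP ((x1 <= Re p <= x2) && (y1 <= Im p <= y2)); last first.
  apply: avoid => // h1 h2; by rewrite h1 h2 in pout.
case/andP: pin => /andP[px1 px2] /andP[py1 py2].
apply/eqP; rewrite -normc_eq0 eq_le normc_ge0 andbT; apply/ler_addgt0Pr => e e0.
rewrite add0r.
have [d d0 Hd] := cf p 1 ltr01.
pose K := normc (f p) + 1; have K0 : 0 < K by rewrite ltr_wpDl // normc_ge0.
(* The cut-out piece lies within [2 * t < d] of [p], where [normc (f _)] is at most [K]; its sides
   add up to at most [4 * t], so its integral is at most [8 * K * t <= e]. *)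
pose t := Num.min (d / 3%:R) (e / (8%:R * K)).
have t0 : 0 < t by rewrite lt_min !divr_gt0 // mulr_gt0.
have td : t <= d / 3%:R by rewrite ge_min lexx.
have te : t * (8%:R * K) <= e by rewrite -ler_pdivlMr ?mulr_gt0 // ge_min lexx orbT.
have [xl [xr [[xl1 xl3 xr3 xr1] [xl2 xr2 xl4 xr4]]]] := clamp_interval px1 px2 t0.
have [yl [yr [[yl1 yl3 yr3 yr1] [yl2 yr2 yl4 yr4]]]] := clamp_interval py1 py2 t0.
have xlr := le_trans xl3 xr3; have ylr := le_trans yl3 yr3.
have xl_2 := le_trans xlr xr1; have yl_2 := le_trans ylr yr1.
have x1r := le_trans xl1 xlr; have y1r := le_trans yl1 ylr.
rewrite -(rectint_addx f x1 xl) (@avoid x1 xl y1 y2) //; last first.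
  by move=> /andP[_ /xl4 h] _; left.
rewrite add0r -(rectint_addx f xl xr) addrC (@avoid xr x2 y1 y2) //; last first.
  by move=> /andP[/xr4 h _] _; left.
rewrite add0r -(rectint_addy f xl xr y1 yl) (@avoid xl xr y1 yl) //; last first.
  by move=> _ /andP[_ /yl4 h]; right.
rewrite add0r -(rectint_addy f xl xr yl yr) addrC (@avoid xl xr yr y2) //; last first.
  by move=> _ /andP[/yr4 h _]; right.
rewrite add0r.
apply: le_trans (_ : 2 * K * (xr - xl + (yr - yl)) <= _); last first.
  apply: le_trans te; have -> : t * (8%:R * K) = 2 * K * (4%:R * t) by ring.
  rewrite ler_wpM2l ?mulr_ge0 ?(ltW K0) //.
  by clear -xl2 xr2 yl2 yr2; lra.
apply: (@rectint_approx _ f (fun=> 0) (fun=> 0)) => // [z|]; first exact: cderiv_cst.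
move=> x y /andP[hx1 hx2] /andP[hy1 hy2]; rewrite subr0.
rewrite -(subrK (f p) (f _)) (le_trans (ler_normcD _ _)) // addrC lerD2l ltW // Hd //.
apply: le_lt_trans (ler_normcReIm _) _; rewrite ReB ImB /=.
have ux : `|x - Re p| <= t by clear -hx1 hx2 xl2 xr2; rewrite ler_norml; lra.
have uy : `|y - Im p| <= t by clear -hy1 hy2 yl2 yr2; rewrite ler_norml; lra.
by clear -ux uy td d0; lra.
Qed.

End GoursatTheorem.

Section DiscPrimitive.
Variable R : realType.
Local Notation C := R[i].
Implicit Types (f g : C -> C) (z w l c : C) (S : seq C) (r rho : R).

Lemma ccont_comp f g z : ccont g z -> ccont f (g z) -> ccont (fun w => f (g w)) z.
Proof.
move=> cg cf e e0; have [d d0 Hf] := cf e e0; have [d' d'0 Hg] := cg d d0.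
by exists d' => // w /Hg /Hf.
Qed.

Lemma cint_approx f z (h : R -> C) a b K e : (forall t, pderiv (cprim (fun t => f (h t))) t (f (h t))) ->
  `|b - a| <= K -> (forall t, `|t - a| <= `|b - a| -> normc (f (h t) - f z) <= e) ->
  normc (cint (fun t => f (h t)) a b - f z * (b - a)%:C) <= e * `|b - a|.
Proof.
move=> dP bK fe.
have main (u v : R) : u <= v -> (forall t, u <= t <= v -> normc (f (h t) - f z) <= e) ->
    normc (cint (fun t => f (h t)) u v - f z * (v - u)%:C) <= e * (v - u).
  move=> uv H; have := @path_lip _ (fun t => cprim (fun t => f (h t)) t - f z * (t)%:C)
    (fun t => f (h t) - f z) e u v uv.
  rewrite /cint; set P := cprim _.
  have -> : P v - f z * v%:C - (P u - f z * u%:C) = P v - P u - f z * (v - u)%:C.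
    by rewrite rmorphB; ring.
  apply => // t _; apply: pderivB; first exact: dP.
  move=> e' e'0; exists 1 => // s _.
  by rewrite -mulrBr -rmorphB subrr normc0 mulr_ge0 // ltW.
case: (leP a b) => ab.
  rewrite ger0_norm ?subr_ge0 //; apply: main => // t /andP[ta tb].
  by apply: fe; rewrite !ger0_norm ?subr_ge0 // lerD2r.
rewrite ltr0_norm ?subr_lt0 // opprB.
have -> : cint (fun t => f (h t)) a b - f z * (b - a)%:C =
   - (cint (fun t => f (h t)) b a - f z * (a - b)%:C).
  by rewrite /cint !rmorphB; ring.
rewrite normcN; apply: main; first exact: ltW.
move=> t /andP[ta tb]; apply: fe.
by rewrite ler0_norm ?subr_le0 // ler0_norm ?subr_le0 ?(ltW ab) //; lra.
Qed.

(** [F] integrates along the real axis and then vertically. Goursat's theorem on the rectangle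
    between the axis and height [y] turns an increment of [F] into an integral along a short broken
    line from the first point to the second, on which [f] is nearly constant. *)
Lemma primitive_at0 S f r : (forall z, ccont f z) ->
  (forall z, normc z < r -> z \notin S -> exists l, cderiv f z l) ->
  exists F, forall z, normc z < r -> cderiv F z (f z).
Proof.
move=> cf df.
pose F z := cint (fun t => f (t +i* 0)) 0 (Re z) + 'i * cint (fun t => f (Re z +i* t)) 0 (Im z).
exists F => -[x y] zr.
have rect0 x' : normc ((x' - x)%:C) < r - normc (x +i* y) ->
    rectint f x x' 0 y = 0.
  move=> hx.
  have main x1 x2 y1 y2 : x1 <= x2 -> y1 <= y2 ->
     (forall u v, x1 <= u <= x2 -> y1 <= v <= y2 -> `|u - x| <= `|x' - x| /\ `|v| <= `|y|) ->
     rectint f x1 x2 y1 y2 = 0.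
    move=> x12 y12 H; apply: (goursat (S := S)) => // u v uP vP uvS.
    apply: df => //; have [h1 h2] := H _ _ uP vP.
    apply: (@le_lt_trans _ _ (normc (u +i* y))).
      rewrite -(ler_pXn2r (n := 2)) ?nnegrE ?normc_ge0 // !sqr_normcE /= lerD2l.
      by rewrite -[v ^+ 2]real_normK ?num_real // -[y ^+ 2]real_normK ?num_real // ler_pXn2r ?nnegrE.
    have -> : u +i* y = x +i* y + (u - x)%:C :> C.
      by apply: complexP; rewrite /= ?addr0 // addrC subrK.
    apply: le_lt_trans (ler_normcD _ _) _; rewrite addrC -ltrBrDr.
    by apply: le_lt_trans hx; rewrite !normcr.
  have flipx x1 x2 y1 y2 : rectint f x2 x1 y1 y2 = - rectint f x1 x2 y1 y2.
    by rewrite /rectint /cint; ring.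
  have flipy x1 x2 y1 y2 : rectint f x1 x2 y2 y1 = - rectint f x1 x2 y1 y2.
    by rewrite /rectint /cint; ring.
  case: (leP x x') => [xx|/ltW xx]; case: (leP 0 y) => [yy|/ltW yy].
  - apply: main => // u v /andP[u1 u2] /andP[v1 v2].
    by split; rewrite !ger0_norm; lra.
  - rewrite flipy main ?oppr0 // => u v /andP[u1 u2] /andP[v1 v2].
    by split; [rewrite !ger0_norm|rewrite !ler0_norm]; lra.
  - rewrite flipx main ?oppr0 // => u v /andP[u1 u2] /andP[v1 v2].
    by split; [rewrite !ler0_norm|rewrite !ger0_norm]; lra.
  - rewrite flipx flipy main ?oppr0 // => u v /andP[u1 u2] /andP[v1 v2].
    by split; rewrite !ler0_norm; lra.
move=> e e0; have e20 : 0 < e / 2 by rewrite divr_gt0.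
have [d d0 Hd] := cf (x +i* y) _ e20.
exists (Num.min (d / 2) (r - normc (x +i* y))).
  by rewrite lt_min divr_gt0 ?subr_gt0.
case=> x' y'; rewrite lt_min => /andP[wd wr].
have ax : `|x' - x| <= normc (x' +i* y' - (x +i* y)) := ler_normRe (x' +i* y' - (x +i* y)).
have ay : `|y' - y| <= normc (x' +i* y' - (x +i* y)) := ler_normIm (x' +i* y' - (x +i* y)).
have R0 : rectint f x x' 0 y = 0.
  by apply: rect0; apply: le_lt_trans wr; rewrite normcr.
have E : F (x' +i* y') - F (x +i* y) =
    cint (fun t => f (t +i* y)) x x' + 'i * cint (fun t => f (x' +i* t)) y y'.
  apply: (@addIr _ (- rectint f x x' 0 y)); rewrite {2}R0 oppr0 addr0.
  rewrite /F /rectint /= -(cint_add _ 0 x x') -(cint_add (fun t => f (x' +i* t)) 0 y y').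
  by ring.
rewrite E.
have zE : x' +i* y' - (x +i* y) = (x' - x)%:C + 'i * (y' - y)%:C :> C.
  by apply: complexP; rewrite /= ?mul0r ?mulr0 ?mul1r ?subr0 ?addr0 ?add0r.
rewrite [X in f _ * X]zE.
have -> (A B D1 D2 fz : C) : A + 'i * B - fz * (D1 + 'i * D2) = (A - fz * D1) + 'i * (B - fz * D2) by ring.
rewrite (splitr e) mulrDl; apply: le_trans (ler_normcD _ _) _; apply: lerD.
  apply: le_trans (_ : e / 2 * `|x' - x| <= _); last by rewrite ler_pM2l.
  apply: (@cint_approx f (x +i* y) (fun t => t +i* y)) => //.
    by move=> t; exact: cprim_hor.
  move=> t tx; apply/ltW/Hd.
  have -> : t +i* y - (x +i* y) = (t - x)%:C :> C by apply: complexP; rewrite //= subrr.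
  by rewrite normcr; apply: le_lt_trans tx _; apply: le_lt_trans ax _; apply: lt_trans wd _; lra.
rewrite normcM normc_i mul1r.
apply: le_trans (_ : e / 2 * `|y' - y| <= _); last by rewrite ler_pM2l.
apply: (@cint_approx f (x +i* y) (fun t => x' +i* t)) => //.
  by move=> t; exact: cprim_ver.
move=> t ty; apply/ltW/Hd.
apply: le_lt_trans (ler_normcReIm _) _; rewrite /=.
move: wd ax ay ty; move: (normc _) => n; lra.
Qed.

(** The integrals along whole lines in [primitive_at0] ask for continuity on the plane. Composing
    with the radial retraction onto the closed disc of radius [rho] provides it without changing [f]
    in that disc. *)
Lemma primitive S f c r rho : 0 < rho -> rho < r ->
  (forall z, normc (z - c) < r -> ccont f z) ->
  (forall z, normc (z - c) < r -> z \notin S -> exists l, cderiv f z l) ->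
  exists F, forall z, normc (z - c) < rho -> cderiv F z (f z).
Proof.
move=> rho0 rhor cf df.
pose k z := Num.max rho (normc z).
have k0 z : 0 < k z by rewrite lt_max rho0.
pose ret z : C := rho%:C * ((k z)%:C)^-1 * z.
have ret_id z : normc z <= rho -> ret z = z.
  move=> zr; rewrite /ret /k max_l // divff ?mul1r //.
  by rewrite -normc_gt0 ger0_normcr // ltW.
have ret_le z : normc (ret z) <= rho.
  rewrite /ret !normcM normcV !ger0_normcr ?(ltW rho0) ?(ltW (k0 _)) //.
  rewrite -mulrA ger_pMr // mulrC ler_pdivrMr ?k0 // mul1r.
  by rewrite le_max lexx orbT.
have cret z : ccont ret z.
  apply: ccontM; last exact: ccont_id.
  apply: ccontM; first exact: ccont_cst.
  apply: ccontV; last by rewrite -normc_gt0 ger0_normcr // ltW.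
  move=> e e0; exists e => // w; apply: le_lt_trans.
  rewrite -rmorphB normcr /k ler_norml.
  have h1 := lerB_normc w z; have h2 := lerB_normc z w; rewrite normcB in h2.
  have h3 := normc_ge0 (w - z).
  case: (leP rho (normc w)) => hw; case: (leP rho (normc z)) => hz; apply/andP; split; lra.
pose g z := f (c + ret z).
have cg z : ccont g z.
  apply: (@ccont_comp (fun z => f (c + z)) ret) => //; apply: ccont_shift; apply: cf.
  by rewrite addrC addKr (le_lt_trans (ret_le z)).
have gE z : normc z < rho -> g z = f (c + z) by move=> /ltW h; rewrite /g ret_id.
have [G GP] : exists G, forall z, normc z < rho -> cderiv G z (g z).
  apply: (@primitive_at0 [seq s - c | s <- S]) => // z zr zS.
  have [||l dl] := df (c + z).
  - by rewrite addrC addKr (lt_trans zr).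
  - apply: contra zS => zS; apply/mapP; exists (c + z) => //.
    by rewrite addrC addKr.
  exists l; have r0 : 0 < rho - normc z by rewrite subr_gt0.
  apply: (cderiv_eq_near r0 _ (cderiv_shift dl)) => w wr.
  rewrite gE //; have := lerB_normc w z; lra.
exists (fun z => G (z - c)) => z zr.
have := GP _ zr; rewrite gE // [c + _]addrC subrK [z - c]addrC => dG.
apply: (cderiv_eq_near (f := fun w => G (- c + w)) ltr01); first by move=> w _; rewrite addrC.
exact: cderiv_shift.
Qed.

Definition circ (r t : R) : C := (r * cos t) +i* (r * sin t).

Lemma normc_circ r t : 0 <= r -> normc (circ r t) = r.
Proof.
move=> r0; apply/eqP; rewrite -(eqrXn2 (n := 2)) ?normc_ge0 // sqr_normcE /=.
by rewrite !exprMn -mulrDr cos2Dsin2 mulr1.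
Qed.

Lemma pderiv_circ r t : pderiv (circ r) t ('i * circ r t).
Proof.
have -> : 'i * circ r t = (r * - sin t) +i* (r * cos t).
  by apply: complexP; rewrite /= ?mul0r ?mul1r ?mulrN ?sub0r ?add0r.
exact: pderiv_ReIm.
Qed.

Lemma conjc_normc z : ((normc z) ^+ 2)%:C = z * conjc z.
Proof.
by rewrite sqr_normcE; case: z => a b; apply: complexP; rewrite /=; ring.
Qed.

(* Rolle's theorem applied to the real part of a primitive of the Poisson-type
   integrand: zeta * G zeta is a positive multiple of f zeta - f z0 on the circle. *)
Lemma max_principle0 S f r rr z0 : 0 < r -> r < rr -> normc z0 < r -> z0 \notin S ->
  (forall z, normc z < rr -> ccont f z) ->
  (forall z, normc z < rr -> z \notin S -> exists l, cderiv f z l) ->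
  exists2 t, 0 <= t <= 2 * pi & normc (f z0) <= normc (f (circ r t)).
Proof.
move=> r0 rrr z0r z0S cf df.
have n0 := normc_ge0 z0.
(* Chosen so that [r < r1] and [r1 * normc z0 < r ^+ 2]: the denominator in [G] below then has no
   zero in the disc of radius [r1]. *)
pose r1 := Num.min rr (2 * r ^+ 2 / (r + normc z0)).
have s0 : 0 < r + normc z0 by rewrite ltr_wpDr.
have rr1 : r < r1 by rewrite lt_min rrr ltr_pdivlMr //; nra.
have r1z : r1 * normc z0 < r ^+ 2.
  apply: (@le_lt_trans _ _ (2 * r ^+ 2 / (r + normc z0) * normc z0)).
    by rewrite ler_wpM2r // ge_min lexx orbT.
  rewrite mulrAC ltr_pdivrMr // mulrAC mulrC ltr_pM2l ?exprn_gt0 //; lra.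
have r1rr : r1 <= rr by rewrite ge_min lexx.
have den z : normc z < r1 -> (r ^+ 2)%:C - conjc z0 * z != 0.
  move=> zr; rewrite subr_eq0; apply: contraTneq r1z => /(congr1 (@normc R)).
  have nJ : normc (conjc z0) = normc z0 by case: (z0) => a b; rewrite /= sqrrN.
  rewrite normcM nJ ger0_normcr ?sqr_ge0 // => ->; rewrite -leNgt mulrC.
  by rewrite ler_wpM2r // ltW.
have z0rr : normc z0 < rr by lra.
have [l dl] := df _ z0rr z0S.
have /cderivP[s [cs sl sE]] := dl.
pose g z := if z == z0 then l else (f z - f z0) / (z - z0).
have gs z : g z = s z.
  rewrite /g; case: eqVneq => [->//|zz0].
  rewrite sE; field; by rewrite subr_eq0.
have dsub z : cderiv (fun w => w - z0) z 1.
  by have := cderivB (@cderiv_id R z) (@cderiv_cst R z0 z); rewrite subr0.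
have cfz z : normc z < rr -> ccont (fun w => f w - f z0) z.
  by move=> /cf cz; apply: ccontD => //; exact: ccont_cst.
have cg z : normc z < rr -> ccont g z.
  move=> zr; have [->|zz0] := eqVneq z z0.
    by apply: (ccont_eq_near ltr01 _ cs) => w _; rewrite gs.
  have d0 : 0 < normc (z - z0) by rewrite normc_gt0 subr_eq0.
  apply: (@ccont_eq_near _ (fun w => (f w - f z0) / (w - z0)) _ _ _ d0).
    move=> w wz; rewrite /g; case: eqVneq wz => // ->.
    by rewrite normcB ltxx.
  apply: ccontM; first exact: cfz.
  by apply: ccontV; [exact: cderiv_ccont (dsub z)|rewrite subr_eq0].
have dg z : normc z < rr -> z \notin z0 :: S -> exists l, cderiv g z l.
  move=> zr; rewrite inE negb_or => /andP[zz0 zS].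
  have [m dm] := df _ zr zS.
  have d0 : 0 < normc (z - z0) by rewrite normc_gt0 subr_eq0.
  eexists; apply: (@cderiv_eq_near _ (fun w => (f w - f z0) / (w - z0)) _ _ _ _ d0).
    move=> w wz; rewrite /g; case: eqVneq wz => // ->.
    by rewrite normcB ltxx.
  apply: cderiv_div (dsub z) _; last by rewrite subr_eq0.
  exact: cderivB dm (cderiv_cst _ _).
(* On the circle [r ^+ 2] is z times its conjugate, so z * G z equals f z - f z0 times z / (z - z0)
   + conj z0 / (conj z - conj z0). This factor is the Poisson kernel (r^2 - |z0|^2) / |z - z0|^2,
   which is real and positive. *)
pose G z := g z + conjc z0 * (f z - f z0) / ((r ^+ 2)%:C - conjc z0 * z).
have dden z : cderiv (fun w => (r ^+ 2)%:C - conjc z0 * w) z (0 - conjc z0 * 1).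
  exact: cderivB (cderiv_cst _ _) (cderivZ _ (cderiv_id _)).
have cG z : normc (z - 0) < r1 -> ccont G z.
  rewrite subr0 => zr; have zrr : normc z < rr by apply: lt_le_trans zr _.
  apply: ccontD; first exact: cg.
  apply: ccontM; first by apply: ccontM; [exact: ccont_cst|exact: cfz].
  by apply: ccontV; [exact: cderiv_ccont (dden z)|exact: den].
have dG z : normc (z - 0) < r1 -> z \notin z0 :: S -> exists l, cderiv G z l.
  rewrite subr0 => zr zS; have zrr : normc z < rr by apply: lt_le_trans zr _.
  have [m dm] := dg _ zrr zS.
  move: zS; rewrite inE negb_or => /andP[_ zS]; have [k dk] := df _ zrr zS.
  eexists; apply: cderivD dm _; apply: cderiv_div (dden z) (den _ zr).
  exact: cderivZ (cderivB dk (cderiv_cst _ _)).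
pose rho := (r + r1) / 2.
have [rho1 rho2] : r < rho /\ rho < r1 by rewrite /rho; lra.
have [F FP] := primitive (lt_trans r0 rho1) rho2 cG dG.
have [u u1 uE] := phase_exists (f z0).
(* The factor [- 'i] cancels the one from the derivative of [circ r], and [u] turns [f z0] to its
   modulus. A zero of the real part of this derivative is a point where [Re (u * f ze)] equals
   [normc (f z0)]. *)
have dp t : pderiv (fun t => - 'i * u * F (circ r t)) t (u * (G (circ r t) * circ r t)).
  have zr : normc (circ r t - 0) < rho by rewrite subr0 normc_circ // ltW.
  have := cderiv_pderiv (cderivZ (- 'i * u) (FP _ zr)) (@pderiv_circ r t).
  have i2 : 'i * 'i = -1 :> C by apply: complexP; rewrite /=; ring.
  have -> : - 'i * u * G (circ r t) * ('i * circ r t) = - ('i * 'i) * (u * (G (circ r t) * circ r t)) by ring.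
  by rewrite i2 opprK mul1r.
have pi20 : 0 < 2 * pi :> R by rewrite mulr_gt0 // pi_gt0.
have [t /andP[/ltW t0 /ltW t1]] := path_MVT pi20 (fun t _ => dp t).
have -> : circ r (2 * pi) = circ r 0.
  by rewrite /circ mulr_natl cos2pi sin2pi cos0 sin0.
rewrite subrr subr0 => /esym/eqP; rewrite mulf_eq0 (gt_eqF pi20) orbF => /eqP H.
exists t; first exact/andP; set ze := circ r t in H *.
have nze : normc ze = r by rewrite normc_circ // ltW.
have zz0 : ze - z0 != 0.
  by rewrite subr_eq0; apply: contraTneq z0r => <-; rewrite nze ltxx.
have ze0 : ze != 0 by rewrite -normc_gt0 nze.
pose P := (r ^+ 2 - normc z0 ^+ 2) / normc (ze - z0) ^+ 2.
have P0 : 0 < P.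
  rewrite divr_gt0 ?exprn_gt0 ?normc_gt0 // subr_gt0 ltr_pXn2r ?nnegrE //.
  exact: ltW.
have GE : G ze * ze = P%:C * (f ze - f z0).
  rewrite /G /g (negbTE (_ : ze != z0)); last by rewrite -subr_eq0.
  have zz0' : conjc ze - conjc z0 != 0 by rewrite -rmorphB conjc_eq0.
  have PE : P%:C = (ze * conjc ze - z0 * conjc z0) / ((ze - z0) * (conjc ze - conjc z0)).
    apply: (mulIf (mulf_neq0 zz0 zz0')); rewrite divfK ?mulf_neq0 //.
    rewrite -!conjc_normc nze -[conjc ze - _]rmorphB -conjc_normc.
    rewrite -(rmorphM (real_complex R)) -(rmorphB (real_complex R)) /P divfK //.
    by rewrite expf_neq0 // gt_eqF // normc_gt0.
  rewrite PE -nze conjc_normc; field.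
  by apply/and3P; split; [|by []|rewrite mulrC -mulrBl mulf_neq0].
move: H; rewrite GE mulrCA ReMr => /eqP; rewrite mulf_eq0 (gt_eqF P0) /=.
rewrite mulrBr uE ReB subr_eq0 => /eqP /= <-.
by apply: le_trans (ler_Re _) _; rewrite normcM u1 mul1r.
Qed.

End DiscPrimitive.

(** * Regularity of holomorphic functions *)

Section Regularity.
Variable R : realType.
Local Notation C := R[i].
Implicit Types (f g : C -> C) (z w l c : C) (S : seq C) (r rho : R).

Definition cdiffable f z := exists l, cderiv f z l.

Lemma cdiffable_ccont f z : cdiffable f z -> ccont f z.
Proof. by case=> l /cderiv_ccont. Qed.

Lemma seq_avoid S z (d : R) : 0 < d -> exists2 w, w \notin S & normc (w - z) < d.
Proof.
move=> d0; apply: contrapT => nex.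
pose p (n : nat) : C := z + (d / n.+2%:R)%:C.
have pS n : p n \in S.
  apply: contrapT => /negP pn; apply: nex; exists (p n) => //.
  rewrite /p addrC addKr ger0_normcr ?divr_ge0 ?(ltW d0) //.
  by rewrite ltr_pdivrMr // ltr_pMr // ltr1n.
have pi_ : injective p.
  move=> m n /addrI /(@complexI R) /(mulfI (lt0r_neq0 d0)) /invr_inj /eqP.
  by rewrite eqr_nat => /eqP [].
have := @uniq_leq_size _ [seq p i | i <- iota 0 (size S).+1] S.
rewrite map_inj_uniq // iota_uniq size_map size_iota ltnn => H.
suff : false by []; apply: H => // _ /mapP[i _ ->]; exact: pS.
Qed.

Lemma circ_bounded f c r : (forall t, ccont f (c + circ r t)) ->
  exists M, forall t, 0 <= t <= 2 * pi -> normc (f (c + circ r t)) <= M.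
Proof.
move=> cf.
have pi20 : 0 <= 2 * pi :> R by rewrite mulr_ge0 // pi_ge0.
have cn : continuous (fun t => normc (f (c + circ r t))).
  move=> t; apply/cvgrPdist_le => e e0; have [d d0 H] := cf t e e0.
  have e1 : 0 < 1 :> R by [].
  have [d' d'0 H'] := @pderiv_circ R r t 1 ltr01.
  pose K := normc ('i * circ r t) + 1.
  have K0 : 0 < K by rewrite ltr_wpDl // normc_ge0.
  apply/nbhs_ballP; exists (Num.min d' (d / K)) => /=.
    by rewrite lt_min d'0 divr_gt0.
  move=> s; rewrite /ball_ /= distrC lt_min => /andP[sd' sd].
  have h : normc (f (c + circ r s) - f (c + circ r t)) < e.
    apply: H; rewrite opprD addrACA subrr add0r.
    rewrite -(subrK ('i * circ r t * (s - t)%:C) (circ r s - circ r t)).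
    apply: le_lt_trans (ler_normcD _ _) _.
    rewrite normcM normcr; have := H' _ sd'; rewrite mul1r => h.
    apply: le_lt_trans (lerD h (lexx _)) _.
    rewrite -[X in X + _]mul1r -mulrDl [1 + _]addrC -/K mulrC -ltr_pdivlMr //.
  rewrite ler_norml; have h1 := lerB_normc (f (c + circ r s)) (f (c + circ r t)).
  have h2 := lerB_normc (f (c + circ r t)) (f (c + circ r s)).
  rewrite normcB in h2; lra.
have [t0 _ tmax] := EVT_max pi20 (continuous_subspaceT cn).
by exists (normc (f (c + circ r t0))) => t tt; apply: tmax; rewrite in_itv.
Qed.

(** [max_principle0] applies off [S]; a point of [S] is a limit of such points and inherits the
    bound by continuity. *)
Lemma max_principle S f c r rr M z0 : 0 < r -> r < rr -> normc (z0 - c) < r ->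
  (forall z, normc (z - c) < rr -> ccont f z) ->
  (forall z, normc (z - c) < rr -> z \notin S -> cdiffable f z) ->
  (forall t, 0 <= t <= 2 * pi -> normc (f (c + circ r t)) <= M) ->
  normc (f z0) <= M.
Proof.
move=> r0 rrr z0r cf df fM.
have main w : normc (w - c) < r -> w \notin S -> normc (f w) <= M.
  move=> wr wS.
  have [|||t tt] := @max_principle0 R [seq s - c | s <- S] (fun w => f (c + w)) r rr (w - c) r0 rrr wr.
  - by apply: contra wS => /mapP[s sS /addIr ->].
  - by move=> z zr; apply: ccont_shift; apply: cf; rewrite addrC addKr.
  - move=> z zr zS; have [||l dl] := df (c + z).
    + by rewrite addrC addKr.
    + by apply: contra zS => zS; apply/mapP; exists (c + z) => //; rewrite addrC addKr.
    + by exists l; exact: cderiv_shift.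
  - by rewrite [c + (w - c)]addrC subrK => /le_trans; apply; exact: fM.
have cz0 : ccont f z0 by apply: cf; exact: lt_trans rrr.
rewrite leNgt; apply/negP => Mf.
have [d d0 Hd] := cz0 (normc (f z0) - M) (ltac:(by rewrite subr_gt0)).
have m0 : 0 < Num.min d (r - normc (z0 - c)) by rewrite lt_min d0 subr_gt0.
have [w wS] := seq_avoid S z0 m0; rewrite lt_min => /andP[/Hd h wr].
have := main w; rewrite wS => /(_ _ isT) H.
have {H} h1 : normc (f w) <= M.
  apply: H; rewrite -(subrK z0 w) -addrA; apply: le_lt_trans (ler_normcD _ _) _.
  by rewrite -ltrBrDr.
have := lerB_normc (f z0) (f w); rewrite normcB; lra.
Qed.

(** The substitute for Cauchy's estimates: on the circle of radius [r] the numerator is at most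
    [2 * K] and the denominator at least [r - rho]. The quotient is continuous at [p] but not yet
    known to be differentiable there, so [p] joins the exceptional list. *)
Lemma divided_difference S g c r rho rr K p : 0 < rho -> rho < r -> r < rr ->
  (forall z, normc (z - c) < rr -> ccont g z) ->
  (forall z, normc (z - c) < rr -> z \notin S -> cdiffable g z) ->
  (forall t, 0 <= t <= 2 * pi -> normc (g (c + circ r t)) <= K) ->
  normc (p - c) < rho -> p \notin S ->
  exists h, [/\ forall z, normc (z - c) < rr -> ccont h z,
    forall z, normc (z - c) < rr -> z \notin p :: S -> cdiffable h z,
    forall z, g z - g p = (z - p) * h z,
    cderiv g p (h p)
  & forall t, 0 <= t <= 2 * pi -> normc (h (c + circ r t)) <= 2 * K / (r - rho)].
Proof.
move=> rho0 rhor rrr cg dg gK pr pS.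
have r0 : 0 < r by lra.
have prr : normc (p - c) < rr by lra.
have [l dl] := dg _ prr pS.
have /cderivP[s [cs sl sE]] := dl.
exists s; split => //.
- move=> z zr; have [->//|zp] := eqVneq z p.
  have d0 : 0 < normc (z - p) by rewrite normc_gt0 subr_eq0.
  apply: (@ccont_eq_near _ (fun w => (g w - g p) / (w - p)) _ _ _ d0).
    move=> w wz; rewrite (sE w); have [wp|wp] := eqVneq w p.
      by rewrite wp normcB ltxx in wz.
    by rewrite addrC addKr mulfK // subr_eq0.
  apply: ccontM; first by apply: ccontD; [exact: cg|exact: ccont_cst].
  apply: ccontV; last by rewrite subr_eq0.
  by apply: ccontD; [exact: ccont_id|exact: ccont_cst].
- move=> z zr; rewrite inE negb_or => /andP[zp zS].
  have [m dm] := dg _ zr zS.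
  have d0 : 0 < normc (z - p) by rewrite normc_gt0 subr_eq0.
  eexists; apply: (@cderiv_eq_near _ (fun w => (g w - g p) / (w - p)) _ _ _ _ d0).
    move=> w wz; rewrite (sE w); have [wp|wp] := eqVneq w p.
      by rewrite wp normcB ltxx in wz.
    by rewrite addrC addKr mulfK // subr_eq0.
  apply: cderiv_div; last by rewrite subr_eq0.
    exact: cderivB dm (cderiv_cst _ _).
  exact: cderivB (@cderiv_id _ _) (cderiv_cst _ _).
- by move=> z; rewrite (sE z) addrC addKr mulrC.
- by rewrite sl.
- move=> t tt.
  have gp : normc (g p) <= K.
    by apply: (max_principle (S := S) r0 rrr _ cg dg gK); exact: lt_trans pr _.
  have d1 : r - rho <= normc (c + circ r t - p).
    have -> : c + circ r t - p = circ r t - (p - c) by ring.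
    have := lerB_normc (circ r t) (p - c); rewrite normc_circ ?(ltW r0) //; lra.
  have d0 : 0 < normc (c + circ r t - p) by lra.
  have -> : s (c + circ r t) = (g (c + circ r t) - g p) / (c + circ r t - p).
    by rewrite (sE (c + _)) [g p + _]addrC addrK mulfK // -normc_gt0.
  rewrite normcM normcV ler_pdivrMr // mulrAC ler_pdivlMr ?subr_gt0 //.
  have := ler_normcB (g (c + circ r t)) (g p); have := gK t tt.
  have := normc_ge0 (g (c + circ r t) - g p).
  have rr0 : 0 <= r - rho by lra.
  move: (normc (g _ - _)) (normc (g _)) (normc (g p)) gp d1 => A B D gp d1 A0 BK AB.
  apply: ler_pM => //; lra.
Qed.

(** Completeness in the form of a limit along a set where [s] may tend to 0: the supremum of
    [u a - s a] lies below every [u a + s a]. *)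
Lemma approx_value (T : Type) (t0 : T) (u : T -> R) (s : T -> R) :
  (forall a b, u a - u b <= s a + s b) -> exists L, forall a, `|u a - L| <= s a.
Proof.
move=> us; pose E := range (fun a => u a - s a).
have ubE a : ubound E (u a + s a).
  by move=> _ [b _ <-]; have := us b a; lra.
exists (sup E) => a.
have h1 : u a - s a <= sup E.
  by apply: ub_le_sup; [exists (u a + s a)|exists a].
have h2 : sup E <= u a + s a.
  by apply: ge_sup => //; exists (u a - s a), a.
by rewrite ler_norml; lra.
Qed.

(** Three successive divided differences have a common bound [K], whatever the nodes in the disc.
    Hence the second difference [T] at [w] is Cauchy as its argument tends to [w], and [L] is its
    limit. The constant is uniform in [w], which the comparison of expansions at two centres
    requires; real and imaginary parts each cost [K], whence [2 * K]. *)
Lemma taylor2 f c rho r rr : 0 < rho -> rho < r -> r < rr ->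
  (forall z, normc (z - c) < rr -> cdiffable f z) ->
  exists2 K, 0 < K & forall w l, normc (w - c) < rho -> cderiv f w l ->
    exists L, forall z, normc (z - c) < rho ->
      normc (f z - f w - l * (z - w) - L * (z - w) ^+ 2) <= K * normc (z - w) ^+ 3.
Proof.
move=> rho0 rhor rrr df.
have cf z : normc (z - c) < rr -> ccont f z by move=> /df /cdiffable_ccont.
have [M HM] : exists M, forall t, 0 <= t <= 2 * pi -> normc (f (c + circ r t)) <= M.
  apply: circ_bounded => t; apply: cf; rewrite addrC addKr normc_circ //; lra.
pose q := 2 / (r - rho).
have q0 : 0 < q by rewrite divr_gt0 // subr_gt0.
pose M1 := Num.max M 1.
have M10 : 0 < M1 by rewrite lt_max ltr01 orbT.
have M1M t : 0 <= t <= 2 * pi -> normc (f (c + circ r t)) <= M1.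
  by move=> /HM h; rewrite le_max h.
pose K := q * (q * (q * M1)).
have K0 : 0 < K by rewrite mulr_gt0 // mulr_gt0 // mulr_gt0.
exists (2 * K); first by rewrite mulr_gt0.
move=> w l wr dl.
have qE x : 2 * x / (r - rho) = q * x by rewrite /q mulrAC.
have df0 z : normc (z - c) < rr -> z \notin [::] -> cdiffable f z by move=> /df.
have [g1 [cg1 dg1 g1E dg1w g1K]] := divided_difference rho0 rhor rrr cf df0 M1M wr isT.
have g1w : g1 w = l by exact: cderiv_uniq dg1w dl.
pose T z := (g1 z - g1 w) / (z - w).
have slopeC (x y u v : C) : (x - y) / (u - v) = (y - x) / (v - u).
  by rewrite -(opprB y x) -(opprB v u) invrN mulrNN.
(* [g1] is not known to be differentiable at [w], so a second difference cannot be taken there. It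
   is taken at [a] and evaluated at [w]; the symmetry [ga b = gb a] then links the values for two
   nodes. *)
have g2P a : normc (a - c) < rho -> a != w -> exists g2 : C -> C,
    [/\ T a = g2 w, forall b, normc (b - c) < rho -> b != w -> b != a ->
      normc (g2 b - g2 w) <= K * normc (b - w)
    & forall b, b != a -> g2 b = (g1 b - g1 a) / (b - a)].
  move=> ar aw.
  have aS : a \notin [:: w] by rewrite inE.
  have [g2 [cg2 dg2 g2E dg2w g2K]] := divided_difference rho0 rhor rrr cg1 dg1 g1K ar aS.
  have g2b b : b != a -> g2 b = (g1 b - g1 a) / (b - a).
    by move=> ba; rewrite g2E mulrC mulKf // subr_eq0.
  exists g2; split => //.
    by rewrite g2b 1?eq_sym // /T slopeC.
  move=> b br bw ba.
  have bS : b \notin [:: a; w] by rewrite !inE negb_or ba.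
  have [g3 [cg3 dg3 g3E _ g3K]] := divided_difference rho0 rhor rrr cg2 dg2 g2K br bS.
  rewrite -opprB normcN g3E normcM mulrC -[normc (w - b)]normcN opprB.
  apply: ler_wpM2r; first exact: normc_ge0.
  have -> : K = 2 * (2 * (2 * M1 / (r - rho)) / (r - rho)) / (r - rho) by rewrite !qE.
  by apply: (max_principle (S := [:: b; a; w]) _ rrr _ cg3 dg3 g3K); lra.
have Tlip a b : normc (a - c) < rho -> a != w -> normc (b - c) < rho -> b != w ->
    normc (T a - T b) <= K * (normc (a - w) + normc (b - w)).
  move=> ar aw br bw; have [->|ab] := eqVneq a b.
    by rewrite subrr normc0 mulr_ge0 ?addr_ge0 ?normc_ge0 // ltW.
  have [ga [gaw gaL gaE]] := g2P a ar aw; have [gb [gbw gbL gbE]] := g2P b br bw.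
  have ba : b != a by rewrite eq_sym.
  have E : ga b = gb a.
    by rewrite gaE // gbE // slopeC.
  have -> : T a - T b = (gb a - gb w) - (ga b - ga w) by rewrite gaw gbw E; ring.
  rewrite mulrDr; apply: le_trans (ler_normcB _ _) _.
  by rewrite lerD ?gaL ?gbL.
pose X := {a : C | (normc (a - c) < rho) && (a != w)}.
have [x0|nox] := pselect (inhabited X); last first.
  exists 0 => z zr; have [->|zw] := eqVneq z w.
    by rewrite !subrr !mulr0 expr0n mul0r !subr0 normc0 expr0n mulr0.
  by exfalso; apply: nox; split; exists z; rewrite zr.
case: x0 => x0.
have TX (a b : X) : normc (T (sval a) - T (sval b)) <=
    K * normc (sval a - w) + K * normc (sval b - w).
  by case: a b => a /andP[a1 a2] [b /andP[b1 b2]] /=; rewrite -mulrDr; exact: Tlip.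
have TXx (a b : X) : Re (T (sval a)) - Re (T (sval b)) <=
    K * normc (sval a - w) + K * normc (sval b - w).
  by apply: le_trans (TX a b); rewrite -ReB ler_Re.
have TXy (a b : X) : Im (T (sval a)) - Im (T (sval b)) <=
    K * normc (sval a - w) + K * normc (sval b - w).
  by apply: le_trans (TX a b); rewrite -ImB (le_trans (ler_norm _)) // ler_normIm.
have [Lx LxP] := approx_value x0 TXx.
have [Ly LyP] := approx_value x0 TXy.
exists (Lx +i* Ly) => z zr.
have [->|zw] := eqVneq z w.
  by rewrite !subrr !mulr0 expr0n mulr0 !subr0 normc0 expr0n mulr0.
have zX : (normc (z - c) < rho) && (z != w) by rewrite zr.
have hx := LxP (exist _ z zX); have hy := LyP (exist _ z zX); rewrite /= in hx hy.
have -> : f z - f w - l * (z - w) - (Lx +i* Ly) * (z - w) ^+ 2 =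
   (T z - (Lx +i* Ly)) * (z - w) ^+ 2.
  rewrite g1E -g1w /T; field; by rewrite subr_eq0.
rewrite normcM normcX [leRHS](_ : _ = 2 * K * normc (z - w) * normc (z - w) ^+ 2); last by ring.
rewrite ler_wpM2r ?exprn_ge0 ?normc_ge0 //.
by apply: le_trans (ler_normcReIm _) _; rewrite ReB ImB /=; lra.
Qed.

Definition cdiff f z : C := if pselect (cdiffable f z) is left H then sval (cid H) else 0.

Lemma cdiffP f z : cdiffable f z -> cderiv f z (cdiff f z).
Proof. by rewrite /cdiff; case: pselect => // H _; case: cid. Qed.

Lemma cdiffE f z l : cderiv f z l -> cdiff f z = l.
Proof. by move=> dl; apply: cderiv_uniq (dl); apply: cdiffP; exists l. Qed.

(* Comparing the expansions of f at w and at z = w + h in the points z + h and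
   z - h eliminates the second-order coefficient at z. *)
Lemma cdiff_cdiffable f c rr : (forall z, normc (z - c) < rr -> cdiffable f z) ->
  forall z, normc (z - c) < rr -> cdiffable (cdiff f) z.
Proof.
move=> df w wr.
pose n := normc (w - c); have n0 : 0 <= n := normc_ge0 _.
pose rho := (n + (n + rr) / 2) / 2; pose r := (n + rr) / 2.
have [rho0 [rhor [rrr nrho]]] : 0 < rho /\ rho < r /\ r < rr /\ n < rho.
  by rewrite /rho /r; move: wr; rewrite -/n; lra.
have [K K0 HK] := taylor2 rho0 rhor rrr df.
have dw := cdiffP (df _ wr).
have [L HL] := HK _ _ nrho dw.
exists (2%:R * L) => e e0.
(* The first bound keeps [w + h] and [w + 2 h] in the disc. The three remainders add up to (8 + 1 +
   1) [K] |h|^3, and division by 2 |h| leaves [5 * K] |h|^2. *)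
exists (Num.min ((rho - n) / 2) (e / (5%:R * K))).
  by rewrite lt_min !divr_gt0 ?subr_gt0 // mulr_gt0.
move=> z; rewrite lt_min => /andP[zd ze].
pose h := z - w; rewrite -/h in zd ze *.
have [h0|h0] := eqVneq h 0.
  have -> : z = w by apply/eqP; rewrite -subr_eq0 -/h h0.
  by rewrite subrr add0r h0 mulr0 oppr0 normc0 mulr0.
have nh : 0 < normc h by rewrite normc_gt0.
have zr : normc (z - c) < rho.
  have -> : z - c = h + (w - c) by rewrite /h; ring.
  by apply: le_lt_trans (ler_normcD _ _) _; rewrite -/n; lra.
have z2r : normc (w + 2%:R * h - c) < rho.
  have -> : w + 2%:R * h - c = h + h + (w - c) by ring.
  apply: le_lt_trans (ler_normcD _ _) _; rewrite -/n.
  by have := ler_normcD h h; lra.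
have dz := cdiffP (df _ (lt_trans zr (lt_trans rhor rrr))).
have [L' HL'] := HK _ _ zr dz.
have e1 := HL _ z2r; have e2 := HL' _ z2r; have e3 := HL' _ (nrho : normc (w - c) < rho).
have n2 : normc (w + 2%:R * h - w) = 2 * normc h.
  have -> : w + 2%:R * h - w = (2%:R : R)%:C * h by rewrite rmorph_nat; ring.
  by rewrite normcM ger0_normcr.
have n2z : normc (w + 2%:R * h - z) = normc h.
  by congr normc; rewrite /h; ring.
have nwz : normc (w - z) = normc h by rewrite normcB.
rewrite n2 in e1; rewrite n2z in e2; rewrite nwz in e3.
have E : (cdiff f z - cdiff f w - 2%:R * L * h) * (2%:R * h) =
   (f (w + 2%:R * h) - f w - cdiff f w * (w + 2%:R * h - w) - L * (w + 2%:R * h - w) ^+ 2)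
 - (f (w + 2%:R * h) - f z - cdiff f z * (w + 2%:R * h - z) - L' * (w + 2%:R * h - z) ^+ 2)
 + (f w - f z - cdiff f z * (w - z) - L' * (w - z) ^+ 2).
  rewrite /h; ring.
have bound : normc (cdiff f z - cdiff f w - 2%:R * L * h) * (2 * normc h) <= 10%:R * K * normc h ^+ 3.
  have -> : 2 * normc h = normc (2%:R * h).
    have -> : 2%:R * h = (2%:R : R)%:C * h by rewrite rmorph_nat.
    by rewrite normcM ger0_normcr.
  rewrite -normcM E; apply: le_trans (ler_normcD _ _) _.
  apply: le_trans (lerD (ler_normcB _ _) (lexx _)) _.
  apply: le_trans (lerD (lerD e1 e2) e3) _.
  by rewrite le_eqVlt; apply/orP; left; apply/eqP; ring.
move: bound; have -> : 10%:R * K * normc h ^+ 3 = 5%:R * K * normc h ^+ 2 * (2 * normc h) by ring.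
rewrite ler_pM2r ?mulr_gt0 // => bound; apply: le_trans bound _.
rewrite expr2 mulrA ler_wpM2r ?normc_ge0 //.
by rewrite mulrC -ler_pdivlMr ?mulr_gt0 // ltW.
Qed.

(** As in Morera's theorem, [f] has a primitive despite the exceptional points, and the derivative
    of a holomorphic function is holomorphic. *)
Lemma removable S f c rr : (forall z, normc (z - c) < rr -> ccont f z) ->
  (forall z, normc (z - c) < rr -> z \notin S -> cdiffable f z) ->
  forall z, normc (z - c) < rr -> cdiffable f z.
Proof.
move=> cf df z zr; pose rho := (normc (z - c) + rr) / 2.
have n0 := normc_ge0 (z - c).
have [rho0 [rhor zrho]] : 0 < rho /\ rho < rr /\ normc (z - c) < rho.
  by rewrite /rho; lra.
have [F FP] := primitive rho0 rhor cf df.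
have dF w : normc (w - c) < rho -> cdiffable F w by move=> /FP; exists (f w).
have [l dl] := cdiff_cdiffable dF zrho.
exists l; have d0 : 0 < rho - normc (z - c) by rewrite subr_gt0.
apply: (cderiv_eq_near d0 _ dl) => w wz; apply: cdiffE; apply: FP.
have -> : w - c = (w - z) + (z - c) by ring.
by apply: le_lt_trans (ler_normcD _ _) _; lra.
Qed.

End Regularity.

(** * Zeros of bounded holomorphic functions *)

Section HolomorphicLogarithm.
Variable R : realType.
Local Notation C := R[i].
Implicit Types (f g Q : C -> C) (z w l c : C) (S : seq C) (r rho : R).

Lemma normc_segment c z (t : R) : 0 <= t <= 1 -> normc (c + t%:C * (z - c) - c) <= normc (z - c).
Proof.
move=> /andP[t0 t1]; rewrite addrC addKr normcM ger0_normcr //.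
by rewrite ler_piMl ?normc_ge0.
Qed.

(** |Q|^2 exp (-2 Re L) has derivative 0 along the segment from [c] to [z]. Only the modulus is
    followed, so the real exponential is enough. *)
Lemma normc_expR_log Q L c z rr : (forall w, normc (w - c) < rr -> cdiffable Q w) ->
  (forall w, normc (w - c) < rr -> Q w != 0) ->
  (forall w, normc (w - c) < rr -> cderiv L w (cdiff Q w / Q w)) -> L c = 0 ->
  normc (z - c) < rr -> normc (Q z) = normc (Q c) * expR (Re (L z)).
Proof.
move=> dQ Q0 dL Lc zr.
pose p t : C := c + t%:C * (z - c).
have pr t : 0 <= t <= 1 -> normc (p t - c) < rr.
  by move=> t01; apply: le_lt_trans (normc_segment _ _ t01) zr.
have dp (t : R) : pderiv p t (z - c).
  move=> e e0; exists 1 => // s _.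
  have -> : p s - p t - (z - c) * (s - t)%:C = 0 by rewrite /p rmorphB; ring.
  by rewrite normc0 mulr_ge0 // ltW.
pose h := fun t => (Re (Q (p t)) * Re (Q (p t)) + Im (Q (p t)) * Im (Q (p t)))
  * expR (- 2 * Re (L (p t))).
have dh (t : R) : 0 <= t <= 1 -> is_derive t 1 h 0.
  move=> /pr ptr; have dQp := cderiv_pderiv (cdiffP (dQ _ ptr)) (dp t).
  have dLp := cderiv_pderiv (dL _ ptr) (dp t).
  have a := pderiv_Re dQp; have b := pderiv_Im dQp; have l := pderiv_Re dLp.
  have e := @is_derive1_comp R expR (fun s : R => - 2 * Re (L (p s))) t _ _
    (is_derive_expR _) (is_deriveZ (- 2) l).
  apply: is_derive_eq (is_deriveM (is_deriveD (is_deriveM a a) (is_deriveM b b)) e) _.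
  rewrite /= -!/(_ * _).
  set q := cdiff Q (p t); set q0 := Q (p t).
  have -> : q / q0 * (z - c) = (q * (z - c)) / q0 by rewrite mulrAC.
  have q0n : q0 != 0 by exact: Q0.
  set v := q * (z - c).
  have vE : v = (v / q0) * q0 by rewrite divfK.
  move: (v / q0) vE => m vE.
  have vR : Re v = Re m * Re q0 - Im m * Im q0 by rewrite vE ReM.
  have vI : Im v = Re m * Im q0 + Im m * Re q0 by rewrite vE ImM.
  rewrite vR vI /GRing.scale /= [(_ + _) t](_ : _ = Re q0 * Re q0 + Im q0 * Im q0) //; ring.
have [|||t _] := @MVT_segment _ h (fun=> 0) 0 1.
- by [].
- by move=> x; rewrite in_itv /= => /andP[/ltW ? /ltW ?]; apply: dh; apply/andP.
- apply: continuous_in_subspaceT => x; rewrite inE /= in_itv /= => xab.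
  exact: is_derive_cont (dh _ xab).
rewrite mul0r => /eqP; rewrite subr_eq0 => /eqP.
have p1 : p 1 = z by rewrite /p rmorph1 mul1r addrC subrK.
have p0 : p 0 = c by rewrite /p rmorph0 mul0r addr0.
rewrite /h p1 p0 Lc /= mulr0 expR0 mulr1 -!expr2 -!sqr_normcE => E.
apply/eqP; rewrite -(eqrXn2 (n := 2)) ?mulr_ge0 ?normc_ge0 ?expR_ge0 //.
rewrite exprMn -E -mulrA -expRM_natl -expRD -mulrDl.
by rewrite [- 2 + _]addrC subrr mul0r expR0 mulr1.
Qed.

Lemma logarithm_exists Q c rr rho : 0 < rho -> rho < rr ->
  (forall w, normc (w - c) < rr -> cdiffable Q w) ->
  (forall w, normc (w - c) < rr -> Q w != 0) ->
  exists L, [/\ L c = 0, forall w, normc (w - c) < rho -> cderiv L w (cdiff Q w / Q w)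
    & forall w, normc (w - c) < rho -> normc (Q w) = normc (Q c) * expR (Re (L w))].
Proof.
move=> rho0 rhor dQ Q0.
have dq z : normc (z - c) < rr -> cdiffable (fun w => cdiff Q w / Q w) z.
  move=> zr; have [l dl] := cdiff_cdiffable dQ zr.
  by eexists; apply: cderiv_div dl (cdiffP (dQ _ zr)) (Q0 _ zr).
have [F FP] : exists F, forall z, normc (z - c) < rho -> cderiv F z (cdiff Q z / Q z).
  apply: (@primitive _ [::] _ _ _ _ rho0 rhor) => z zr.
    exact: cdiffable_ccont (dq z zr).
  by move=> _; exact: dq.
have dL w : normc (w - c) < rho -> cderiv (fun w => F w - F c) w (cdiff Q w / Q w).
  by move=> wr; have := cderivB (FP _ wr) (cderiv_cst (F c) w); rewrite subr0.
exists (fun w => F w - F c); split => // [|w wr]; first by rewrite subrr.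
apply: (@normc_expR_log Q (fun w => F w - F c) c w rho) => //; last by rewrite subrr.
- by move=> u ur; apply: dQ; exact: lt_trans ur rhor.
- by move=> u ur; apply: Q0; exact: lt_trans ur rhor.
Qed.

Lemma bounded_lipschitz f c rr rho K : 0 < rho -> rho < rr ->
  (forall w, normc (w - c) < rr -> cdiffable f w) ->
  (forall w, normc (w - c) < rr -> normc (f w) <= K) ->
  forall w, normc (w - c) < rho -> normc (cdiff f w) <= 4 * K / (rr - rho) /\
  forall z, normc (z - c) < rho -> normc (f z - f w) <= 4 * K / (rr - rho) * normc (z - w).
Proof.
move=> rho0 rhor df fK w wr.
pose r := (rho + rr) / 2.
have [rr1 [rr2 r0]] : rho < r /\ r < rr /\ 0 < r by rewrite /r; lra.
have fKc t : 0 <= t <= 2 * pi -> normc (f (c + circ r t)) <= K.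
  by move=> _; apply: fK; rewrite addrC addKr normc_circ // ltW.
have [h [ch dh hE dhw hK]] := @divided_difference R [::] f c r rho rr K w rho0 rr1 rr2
  (fun z zr => cdiffable_ccont (df z zr)) (fun z zr _ => df z zr)
  fKc wr isT.
have hb z : normc (z - c) < rho -> normc (h z) <= 4 * K / (rr - rho).
  move=> zr; have -> : 4 * K / (rr - rho) = 2 * K / (r - rho).
    have n1 : rr - rho != 0 by rewrite subr_eq0 gt_eqF.
    have -> : r - rho = (rr - rho) / 2 by rewrite /r; field.
    by field.
  by apply: (max_principle r0 rr2 _ ch dh hK); apply: lt_trans zr rr1.
split; first by rewrite (cdiffE dhw); exact: hb.
by move=> z zr; rewrite hE normcM mulrC ler_wpM2r ?normc_ge0 // hb.
Qed.

(** L / (2 A - L) vanishes at [c] and has modulus at most 1, because the real part of [L] is at most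
    [A]. Schwarz's lemma bounds it by [rho / r] with [r] midway between [rho] and [rr], and solving
    for [L] gives the constant. *)
Lemma borel_caratheodory L c rr rho A : 0 < rho -> rho < rr -> 0 < A ->
  (forall w, normc (w - c) < rr -> cdiffable L w) -> L c = 0 ->
  (forall w, normc (w - c) < rr -> Re (L w) <= A) ->
  forall w, normc (w - c) < rho -> normc (L w) <= 4 * A * rho / (rr - rho).
Proof.
move=> rho0 rhor A0 dL Lc LA w wr.
pose r := (rho + rr) / 2.
have [rr1 [rr2 r0]] : rho < r /\ r < rr /\ 0 < r by rewrite /r; lra.
pose D z := (2 * A)%:C - L z.
have ReD z : Re (D z) = 2 * A - Re (L z) by rewrite /D ReB.
have D0 z : normc (z - c) < rr -> D z != 0.
  move=> /LA h; apply/eqP => /(congr1 (@Re R)); rewrite ReD /=; lra.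
have LD z : normc (z - c) < rr -> normc (L z) <= normc (D z).
  move=> /LA h; rewrite -(ler_pXn2r (n := 2)) ?nnegrE ?normc_ge0 // !sqr_normcE ReD.
  rewrite /D ImB /= sub0r sqrrN lerD2r; nra.
pose f z := L z / D z.
have df z : normc (z - c) < rr -> cdiffable f z.
  move=> zr; have [l dl] := dL _ zr; eexists.
  exact: cderiv_div dl (cderivB (cderiv_cst _ _) dl) (D0 _ zr).
have f1 z : normc (z - c) < rr -> normc (f z) <= 1.
  move=> zr; rewrite normcM normcV ler_pdivrMr ?normc_gt0 ?D0 // mul1r; exact: LD.
have fc : f c = 0 by rewrite /f Lc mul0r.
have cr : normc (c - c) < rho by rewrite subrr normc0.
have f1c t : 0 <= t <= 2 * pi -> normc (f (c + circ r t)) <= 1.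
  by move=> _; apply: f1; rewrite addrC addKr normc_circ // ltW.
have [h [ch dh hE dhw _]] := @divided_difference R [::] f c r rho rr 1 c rho0 rr1 rr2
  (fun z zr => cdiffable_ccont (df z zr)) (fun z zr _ => df z zr)
  f1c cr isT.
have hw : normc (h w) <= 1 / r.
  apply: (max_principle r0 rr2 _ ch dh); first exact: lt_trans wr rr1.
  move=> t tt; have := f1c t tt; have := hE (c + circ r t).
  rewrite fc subr0 [c + _]addrC addrK => ->.
  by rewrite normcM normc_circ ?(ltW r0) // mul1r -[r^-1]mul1r ler_pdivlMr // mulrC.
have wrr : normc (w - c) < rr by lra.
have fw : normc (f w) <= rho / r.
  have := hE w; rewrite fc subr0 => ->; rewrite normcM.
  by apply: ler_pM; rewrite ?normc_ge0 // ?(ltW wr) // -[r^-1]mul1r.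
(* Inverting f = L / (2 A - L) gives L = 2 A f / (1 + f). *)
have LE : L w * (1 + f w) = (2 * A)%:C * f w.
  have -> : (2 * A)%:C = D w + L w by rewrite /D subrK.
  by rewrite /f; have := D0 _ wrr; move: (D w) => d d0; field.
have q1 : 1 - rho / r <= normc (1 + f w).
  by have := lerB_normcD 1 (f w); rewrite normc1; lra.
have q0 : 0 < 1 - rho / r by rewrite subr_gt0 ltr_pdivrMr // mul1r.
have : normc (L w) * (1 - rho / r) <= 2 * A * (rho / r).
  apply: le_trans (ler_wpM2l (normc_ge0 _) q1) _.
  rewrite -normcM LE normcM ger0_normcr ?ler_pM2l ?mulr_gt0 // mulr_ge0 // ltW //.
rewrite -ler_pdivlMr // => /le_trans; apply.
rewrite le_eqVlt; apply/orP; left; apply/eqP.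
have n1 : r - rho != 0 by rewrite subr_eq0 gt_eqF.
have -> : rr - rho = 2 * (r - rho) by rewrite /r; field.
by field; rewrite n1 gt_eqF.
Qed.

(** The constant depends on the radii alone and the bound is linear in [M], so the lemma can be used
    with [M] of order N and of order gamma. A logarithm of Q / Q c has real part at most [2 * M];
    Borel-Caratheodory bounds it, and two divided-difference estimates bound its derivative and the
    Lipschitz constant of the derivative. Each estimate gives up a quarter of the gap between the
    radii. *)
Lemma log_derivative_bound rr rho : 0 < rho -> rho < rr -> exists2 K : R, 0 < K &
  forall Q c M, 0 < M -> (forall w, normc (w - c) < rr -> cdiffable Q w) ->
  (forall w, normc (w - c) < rr -> Q w != 0) ->
  (forall w, normc (w - c) < rr -> normc (Q w) <= expR M) ->
  expR (- M) <= normc (Q c) ->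
  forall w, normc (w - c) < rho -> normc (cdiff Q w / Q w) <= K * M /\
    forall z, normc (z - c) < rho ->
     normc (cdiff Q z / Q z - cdiff Q w / Q w) <= K * M * normc (z - w).
Proof.
move=> rho0 rhor; pose g := (rr - rho) / 4; pose r3 := rho + g; pose r2 := rho + 2 * g.
pose r1 := rho + 3 * g.
have g0 : 0 < g by rewrite divr_gt0 // subr_gt0.
have [h3 [h2 [h1 [h0 [p3 p2]]]]] : rho < r3 /\ r3 < r2 /\ r2 < r1 /\ r1 < rr /\ 0 < r3 /\ 0 < r2.
  by rewrite /r1 /r2 /r3; move: g0; rewrite /g; lra.
pose K1 := 8 * r2 / (r1 - r2); pose K2 := 4 * K1 / (r2 - r3); pose K3 := 4 * K2 / (r3 - rho).
have K10 : 0 < K1 by rewrite divr_gt0 ?subr_gt0 // mulr_gt0.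
have K20 : 0 < K2 by rewrite divr_gt0 ?subr_gt0 // mulr_gt0.
have K30 : 0 < K3 by rewrite divr_gt0 ?subr_gt0 // mulr_gt0.
exists (K2 + K3); first by rewrite addr_gt0.
move=> Q c M M0 dQ Q0 QM Qc w wr.
have r10 : 0 < r1 by lra.
have [L [Lc dL LE]] := logarithm_exists r10 h0 dQ Q0.
have A0 : 0 < 2 * M by rewrite mulr_gt0.
have LA z : normc (z - c) < r1 -> Re (L z) <= 2 * M.
  move=> zr; have := QM z (lt_trans zr h0); rewrite LE // => h.
  rewrite -ler_expR; have : expR (- M) * expR (Re (L z)) <= expR M.
    by apply: le_trans h; rewrite ler_wpM2r // expR_ge0.
  by rewrite -ler_pdivlMl ?expR_gt0 // -expRN opprK -expRD -mulr2n mulr_natl.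
have dL' z : normc (z - c) < r1 -> cdiffable L z by move=> /dL ?; eexists; eassumption.
have B1 z : normc (z - c) < r2 -> normc (L z) <= K1 * M.
  move=> zr; have := @borel_caratheodory L c r1 r2 (2 * M) p2 h1 A0 dL' Lc LA z zr.
  have -> : 4 * (2 * M) * r2 / (r1 - r2) = K1 * M.
    by rewrite /K1; ring.
  by [].
have dLE z : normc (z - c) < r1 -> cdiff L z = cdiff Q z / Q z by move=> /dL /cdiffE.
have dL2 z : normc (z - c) < r2 -> cdiffable L z by move=> h; apply: dL'; exact: lt_trans h1.
have B2 z : normc (z - c) < r3 -> normc (cdiff L z) <= K2 * M.
  move=> zr; have [B _] := bounded_lipschitz p3 h2 dL2 B1 zr.
  by move: B; have -> : 4 * (K1 * M) / (r2 - r3) = K2 * M by rewrite /K2; ring.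
have dL3 z : normc (z - c) < r3 -> cdiffable (cdiff L) z.
  by move=> zr; apply: (cdiff_cdiffable dL2); exact: lt_trans h2.
have lt1 z : normc (z - c) < rho -> normc (z - c) < r1 by lra.
have [_ B3] := bounded_lipschitz rho0 h3 dL3 B2 wr.
rewrite -dLE ?lt1 //; split.
  apply: le_trans (B2 _ (lt_trans wr h3)) _; rewrite ler_pM2r //; lra.
move=> z zr; rewrite -dLE ?lt1 //; apply: le_trans (B3 z zr) _.
have -> : 4 * (K2 * M) / (r3 - rho) = K3 * M by rewrite /K3; ring.
by rewrite ler_wpM2r ?normc_ge0 // ler_pM2r //; lra.
Qed.

End HolomorphicLogarithm.

Section ZeroFactorization.
Variable R : realType.
Local Notation C := R[i].
Implicit Types (f g e : C -> C) (z w l c p : C) (zs : seq C) (r : R).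

Definition dlog f z := cdiff f z / f z.

Definition zprod zs z : C := \prod_(p <- zs) (z - p).

Lemma cdiffable_cst c z : cdiffable (fun=> c) z.
Proof. by exists 0; exact: cderiv_cst. Qed.

Lemma cdiffableB f g z : cdiffable f z -> cdiffable g z -> cdiffable (fun w => f w - g w) z.
Proof. by move=> [a ?] [b ?]; exists (a - b); exact: cderivB. Qed.

Lemma cdiffableM f g z : cdiffable f z -> cdiffable g z -> cdiffable (fun w => f w * g w) z.
Proof. by move=> [a ?] [b ?]; eexists; apply: cderivM; eassumption. Qed.

Lemma cdiffable_div f g z : cdiffable f z -> cdiffable g z -> g z != 0 ->
  cdiffable (fun w => f w / g w) z.
Proof. by move=> [a ?] [b ?] ?; eexists; apply: cderiv_div; eassumption. Qed.

Lemma cderiv_subr p z : cderiv (fun w => w - p) z 1.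
Proof. by have := cderivB (@cderiv_id R z) (cderiv_cst p z); rewrite subr0. Qed.

Lemma cdiffable_subr p z : cdiffable (fun w => w - p) z.
Proof. by exists 1; exact: cderiv_subr. Qed.

Lemma cdiffable_eq f g z : (forall w, f w = g w) -> cdiffable f z -> cdiffable g z.
Proof. by move=> fg [l dl]; exists l; apply: (cderiv_eq_near ltr01 _ dl). Qed.

Lemma cdiffable_prod (I : Type) (s : seq I) (F : I -> C -> C) z :
  (forall i, cdiffable (F i) z) -> cdiffable (fun w => \prod_(i <- s) F i w) z.
Proof.
move=> dF; elim: s => [|i s IH].
  by apply: (cdiffable_eq _ (cdiffable_cst 1 z)) => w; rewrite big_nil.
by apply: (cdiffable_eq _ (cdiffableM (dF i) IH)) => w; rewrite big_cons.
Qed.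

Lemma cdiffable_zprod zs z : cdiffable (zprod zs) z.
Proof. by apply: cdiffable_prod => p; exact: cdiffable_subr. Qed.

Lemma cdiff_eq f g z : (forall w, f w = g w) -> cdiff f z = cdiff g z.
Proof. by move=> fg; congr cdiff; apply/funext. Qed.

Lemma dlogM f g z : cdiffable f z -> cdiffable g z -> f z != 0 -> g z != 0 ->
  dlog (fun w => f w * g w) z = dlog f z + dlog g z.
Proof.
move=> df dg f0 g0; rewrite /dlog (cdiffE (cderivM (cdiffP df) (cdiffP dg))).
by field; rewrite ?f0 ?g0.
Qed.

Lemma dlog_div f g z : cdiffable f z -> cdiffable g z -> f z != 0 -> g z != 0 ->
  dlog (fun w => f w / g w) z = dlog f z - dlog g z.
Proof.
move=> df dg f0 g0; rewrite /dlog (cdiffE (cderiv_div (cdiffP df) (cdiffP dg) g0)).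
by field; rewrite ?f0 ?g0.
Qed.

Lemma dlog_prod (I : eqType) (s : seq I) (F : I -> C -> C) z :
  (forall i, cdiffable (F i) z) -> (forall i, i \in s -> F i z != 0) ->
  dlog (fun w => \prod_(i <- s) F i w) z = \sum_(i <- s) dlog (F i) z.
Proof.
move=> dF; elim: s => [|i s IH] F0.
  rewrite big_nil /dlog (@cdiff_eq _ (fun=> 1)); last by move=> w; rewrite big_nil.
  by rewrite (cdiffE (cderiv_cst 1 z)) mul0r.
have Fs j : j \in s -> F j z != 0 by move=> js; apply: F0; rewrite inE js orbT.
have P0 : \prod_(j <- s) F j z != 0.
  by rewrite prodf_seq_neq0; apply/allP => j js; exact: Fs.
rewrite big_cons -IH // -dlogM //; last first.
- by apply: F0; rewrite inE eqxx.
- exact: cdiffable_prod.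
by congr dlog; apply/funext => w; rewrite big_cons.
Qed.

Lemma zprod_root (zs : seq C) (p : C) : p \in zs -> zprod zs p = 0.
Proof.
move=> pzs; apply/eqP; rewrite /zprod prodf_seq_eq0; apply/hasP.
by exists p => //=; rewrite subrr.
Qed.

Lemma zprod_neq0 zs z : z \notin zs -> zprod zs z != 0.
Proof.
move=> zzs; rewrite prodf_seq_neq0; apply/allP => p pzs /=.
by rewrite subr_eq0; apply: contraNneq zzs => ->.
Qed.

Lemma dlog_zprod zs z : z \notin zs -> dlog (zprod zs) z = \sum_(p <- zs) (z - p)^-1.
Proof.
move=> zzs; rewrite /zprod dlog_prod; last 2 first.
- by move=> p; exact: cdiffable_subr.
- by move=> p pzs; rewrite subr_eq0; apply: contraNneq zzs => ->.
by apply: eq_bigr => p _; rewrite /dlog (cdiffE (cderiv_subr p z)) mul1r.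
Qed.

Lemma zprod_cat zs1 zs2 z : zprod (zs1 ++ zs2) z = zprod zs1 z * zprod zs2 z.
Proof. by rewrite /zprod big_cat. Qed.

(** The quotient is the slope of [f] at [p]; its differentiability at [p] itself is the removable
    singularity theorem. *)
Lemma divide_zero f p r : 0 < r -> (forall z, normc (z - p) < r -> cdiffable f z) ->
  f p = 0 -> exists h, (forall z, f z = (z - p) * h z) /\
    forall z, cdiffable f z -> cdiffable h z.
Proof.
move=> r0 df fp.
have pr : normc (p - p) < r by rewrite subrr normc0.
have [l dl] := df p pr.
have /cderivP[s [cs sl sE]] := dl.
have away z : z != p -> cdiffable f z -> cdiffable s z.
  move=> zp [m dm]; have d0 : 0 < normc (z - p) by rewrite normc_gt0 subr_eq0.
  have [|k dk] := cdiffable_div (ex_intro _ m dm) (cdiffable_subr p z).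
    by rewrite subr_eq0.
  exists k; apply: (cderiv_eq_near d0 _ dk) => w wz.
  rewrite (sE w) fp add0r mulfK // subr_eq0; apply: contraTneq wz => ->.
  by rewrite normcB ltxx.
exists s; split => [z|z dz]; first by rewrite (sE z) fp add0r mulrC.
have [->|zp] := eqVneq z p; last exact: away.
apply: (@removable R [:: p] s p r) pr => z' zr.
  by have [->//|zp] := eqVneq z' p; apply/cdiffable_ccont/away => //; exact: df.
by rewrite inE => zp; apply: away => //; exact: df.
Qed.

(** The factor for [p] has the modulus of [z - p] on the circle of radius [r] around [c], and no
    zero inside when [p] is inside. Replacing [z - p] by it removes a zero at no cost on the
    circle. *)
Definition blaschke c r zs z : C :=
  \prod_(p <- zs) (((r ^+ 2)%:C - (z - c) * conjc (p - c)) / r%:C).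

Lemma blaschke_circ c r zs z : 0 < r -> normc (z - c) = r ->
  normc (blaschke c r zs z) = normc (zprod zs z).
Proof.
move=> r0 zr; have nc w : normc (conjc w) = normc w by case: w => a b; rewrite /= sqrrN.
rewrite /blaschke /zprod; elim: zs => [|p zs IH]; first by rewrite !big_nil.
rewrite !big_cons !normcM IH; congr (_ * _).
rewrite -zr conjc_normc -mulrBr normcM -rmorphB nc normcV ger0_normcr ?normc_ge0 //.
have -> : z - c - (p - c) = z - p by ring.
by rewrite zr mulrAC divff ?mul1r // gt_eqF.
Qed.

Lemma cderiv_blaschke_factor c r p z :
  cderiv (fun z => ((r ^+ 2)%:C - (z - c) * conjc (p - c)) / r%:C) z (- conjc (p - c) / r%:C).
Proof.
have := cderivM (cderivB (cderiv_cst (r ^+ 2)%:C z)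
  (cderivM (cderiv_subr c z) (cderiv_cst (conjc (p - c)) z))) (cderiv_cst (r%:C)^-1 z).
by rewrite !mulr0 !addr0 mul1r sub0r.
Qed.

Lemma cdiffable_blaschke c r zs z : cdiffable (blaschke c r zs) z.
Proof. by apply: cdiffable_prod => p; eexists; exact: cderiv_blaschke_factor. Qed.

(** Jensen's inequality in product form. Exchanging [zprod] for [blaschke] keeps the bound [B] on
    the circle, hence inside, while at the centre each exchange replaces a factor of modulus at most
    [r2] by one of modulus [r]. *)
Lemma zero_count zs e c r2 r r3 B : 0 < r2 -> r2 < r -> r < r3 ->
  (forall p, p \in zs -> normc (p - c) <= r2) ->
  (forall z, normc (z - c) < r3 -> cdiffable e z) ->
  (forall t, 0 <= t <= 2 * pi -> normc (zprod zs (c + circ r t) * e (c + circ r t)) <= B) ->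
  (forall z, normc (z - c) < r -> normc (e z * blaschke c r zs z) <= B) /\
  normc (zprod zs c * e c) * (r / r2) ^+ size zs <= normc (e c * blaschke c r zs c).
Proof.
move=> r20 r2r rr3 zs2 de fB; have r0 : 0 < r by lra.
have dQ z : normc (z - c) < r3 -> cdiffable (fun z => e z * blaschke c r zs z) z.
  by move=> zr; apply: cdiffableM; [exact: de|exact: cdiffable_blaschke].
split.
  move=> z zr; apply: (@max_principle R [::] (fun z => e z * blaschke c r zs z) c r r3) => //.
  - by move=> w /dQ /cdiffable_ccont.
  - by move=> w wr _; exact: dQ.
  - move=> t tt; have := fB t tt; rewrite !normcM blaschke_circ //; last first.
      by rewrite addrC addKr normc_circ // ltW.
    by rewrite mulrC.
rewrite !normcM mulrAC mulrC ler_wpM2l ?normc_ge0 //.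
rewrite /zprod /blaschke; elim: zs zs2 {fB dQ} => [_|p zs IH zs2].
  by rewrite !big_nil expr0 mulr1.
rewrite !big_cons !normcM [size _]/= exprS mulrACA; apply: ler_pM.
- by rewrite mulr_ge0 ?normc_ge0 // divr_ge0 // ltW.
- by rewrite mulr_ge0 ?normc_ge0 // exprn_ge0 // divr_ge0 // ltW.
- rewrite subrr mul0r subr0 normcV !ger0_normcr ?sqr_ge0 ?(ltW r0) //.
  rewrite expr2 mulfK ?gt_eqF // mulrA ler_pdivrMr // mulrC ler_pM2l //.
  by rewrite normcB zs2 // inE eqxx.
- by apply: IH => q qzs; apply: zs2; rewrite inE qzs orbT.
Qed.

Lemma expr_unbounded (a b q : R) : 0 < a -> 1 < q -> exists n, b < a * q ^+ n.
Proof.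
move=> a0 q1; have bern n : 1 + n%:R * (q - 1) <= q ^+ n.
  elim: n => [|n IH]; first by rewrite mul0r addr0 expr0.
  rewrite exprS -natr1; have qn : 0 <= n%:R * (q - 1) by rewrite mulr_ge0 // subr_ge0 ltW.
  have : q * (1 + n%:R * (q - 1)) <= q * q ^+ n by rewrite ler_pM2l //; lra.
  by move: qn; nra.
pose n := Num.truncn (`|b| / (a * (q - 1))).
exists n.+1; have aq : 0 < a * (q - 1) by rewrite mulr_gt0 // subr_gt0.
apply: le_lt_trans (ler_norm _) _.
have : `|b| < n.+1%:R * (a * (q - 1)) by rewrite -ltr_pdivrMr // truncnS_gt.
have := ler_wpM2l (ltW a0) (bern n.+1); nra.
Qed.

(** Zeros are divided out one at a time. The process stops because [zero_count] bounds the length of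
    the list in terms of [normc (f c)] and the maximum of [f] on a larger circle. *)
Lemma zero_factorization f c r rr : 0 < r -> r < rr ->
  (forall z, normc (z - c) < rr -> cdiffable f z) -> f c != 0 ->
  exists zs e, [/\ forall z, f z = zprod zs z * e z,
    forall p, p \in zs -> normc (p - c) <= r,
    forall z, cdiffable f z -> cdiffable e z
  & forall z, normc (z - c) <= r -> e z != 0].
Proof.
move=> r0 rrr df fc.
pose good := exists zs e, [/\ forall z, f z = zprod zs z * e z,
    forall p, p \in zs -> normc (p - c) <= r,
    forall z, cdiffable f z -> cdiffable e z
  & forall z, normc (z - c) <= r -> e z != 0].
suff step n : good \/ exists zs e, [/\ size zs = n, forall z, f z = zprod zs z * e z,
    forall p, p \in zs -> normc (p - c) <= r & forall z, cdiffable f z -> cdiffable e z].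
  pose r1 := (r + rr) / 2.
  have [r1r [r1rr r10]] : r < r1 /\ r1 < rr /\ 0 < r1 by rewrite /r1; lra.
  have cr t : normc (c + circ r1 t - c) < rr by rewrite addrC addKr normc_circ // ltW.
  have [B fB] := circ_bounded (fun t => cdiffable_ccont (df _ (cr t))).
  have fc0 : 0 < normc (f c) by rewrite normc_gt0.
  have q1 : 1 < r1 / r by rewrite ltr_pdivlMr // mul1r.
  have [n Hn] := expr_unbounded B fc0 q1.
  have [//|[zs [e [zn fE zr de]]]] := step n.
  have := @zero_count zs e c r r1 rr B r0 r1r r1rr zr (fun z h => de _ (df _ h)).
  move=> [t /fB|H1 H2]; first by rewrite -fE.
  rewrite -fE zn in H2; have := H1 c; rewrite subrr normc0 => /(_ r10) h.
  by have := lt_le_trans Hn (le_trans H2 h); rewrite ltxx.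
elim: n => [|n [gd|[zs [e [zn fE zr de]]]]]; [right|by left|].
  exists [::], f; split => // z; by rewrite /zprod big_nil mul1r.
have [nz|] := pselect (forall z, normc (z - c) <= r -> e z != 0).
  by left; exists zs, e.
move=> /existsNP[p /not_implyP[pr /negP]]; rewrite negbK => /eqP ep.
have d0 : 0 < rr - r by rewrite subr_gt0.
have dep z : normc (z - p) < rr - r -> cdiffable e z.
  move=> zp; apply: de; apply: df.
  have -> : z - c = (z - p) + (p - c) by ring.
  by apply: le_lt_trans (ler_normcD _ _) _; lra.
have [h [eE dh]] := divide_zero d0 dep ep.
right; exists (p :: zs), h; split => //=; first by rewrite zn.
- by move=> z; rewrite fE eE /zprod big_cons; ring.
- by move=> q; rewrite inE => /predU1P[->//|]; exact: zr.
- by move=> z /de /dh.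
Qed.

Lemma ler_normc_sum (I : eqType) (s : seq I) (F : I -> C) (m : R) :
  (forall i, i \in s -> normc (F i) <= m) ->
  normc (\sum_(i <- s) F i) <= (size s)%:R * m.
Proof.
elim: s => [|i s IH] H; first by rewrite big_nil normc0 mul0r.
rewrite big_cons [size _]/= -natr1 mulrDl mul1r [leRHS]addrC.
apply: le_trans (ler_normcD _ _) _; apply: lerD; first by rewrite H // inE eqxx.
by apply: IH => j js; rewrite H // inE js orbT.
Qed.

(** [log_derivative_bound] applies to [e] times the Blaschke product, which is zero-free and obeys
    the same bounds as [zprod zs * e]. Returning to [e] costs one term per zero, bounded and
    Lipschitz since its pole lies outside the disc, and the zeros number O(M). *)
Lemma log_derivative_zeros r1 r2 r3 : 0 < r1 -> r1 < r2 -> r2 < r3 ->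
  exists2 K : R, 0 < K & forall c zs e M, 0 < M ->
  (forall p, p \in zs -> normc (p - c) <= r2) ->
  (forall z, normc (z - c) < r3 -> cdiffable e z) ->
  (forall z, normc (z - c) <= r2 -> e z != 0) ->
  (forall z, normc (z - c) < r3 -> normc (zprod zs z * e z) <= expR M) ->
  expR (- M) <= normc (zprod zs c * e c) ->
  (size zs)%:R <= K * M /\
  forall w, normc (w - c) < r1 -> normc (dlog e w) <= K * M /\
    forall z, normc (z - c) < r1 -> normc (dlog e z - dlog e w) <= K * M * normc (z - w).
Proof.
move=> r10 r12 r23; pose r := (r2 + r3) / 2.
have [r2r [rr3 [r20 r0]]] : r2 < r /\ r < r3 /\ 0 < r2 /\ 0 < r by rewrite /r; lra.
have q1 : 1 < r / r2 by rewrite ltr_pdivlMr // mul1r.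
have lq : 0 < ln (r / r2) by rewrite ln_gt0.
have [K1 K10 HK1] := log_derivative_bound r10 r12.
(* From exp (-M) (r / r2)^n <= exp M for n zeros. *)
pose k0 := 2 / ln (r / r2); have k00 : 0 < k0 by rewrite divr_gt0.
have den : 0 < r ^+ 2 - r2 ^+ 2 by rewrite subr_gt0 ltr_pXn2r ?nnegrE ?ltW.
pose b := r2 / (r ^+ 2 - r2 ^+ 2); have b0 : 0 < b by rewrite divr_gt0.
have K2 : 0 < k0 * b by rewrite mulr_gt0.
have K3 : 0 < k0 * b ^+ 2 by rewrite mulr_gt0 // exprn_gt0.
exists (k0 + K1 + k0 * b + k0 * b ^+ 2); first by lra.
move=> c zs e M M0 zs2 de e0 fM fc.
have [|QM Qc] := @zero_count zs e c r2 r r3 (expR M) r20 r2r rr3 zs2 de.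
  by move=> t _; apply: fM; rewrite addrC addKr normc_circ // ltW.
have sz : (size zs)%:R <= k0 * M.
  have h : expR (- M) * (r / r2) ^+ size zs <= expR M.
    apply: le_trans (QM c _); last by rewrite subrr normc0.
    by apply: le_trans Qc; rewrite ler_wpM2r // exprn_ge0 // ltW // (lt_trans ltr01).
  rewrite /k0 mulrAC ler_pdivlMr // mulr_natl -lnXn ?(lt_trans ltr01) //.
  rewrite -(@expRK _ (2 * M)) ler_ln ?posrE ?expR_gt0 ?exprn_gt0 ?(lt_trans ltr01) //.
  move: h; rewrite -ler_pdivlMl ?expR_gt0 // -expRN opprK -expRD.
  by have -> : M + M = 2 * M by ring.
have dQ z : normc (z - c) < r2 -> cdiffable (fun z => e z * blaschke c r zs z) z.
  move=> zr; apply: cdiffableM; last exact: cdiffable_blaschke.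
  by apply: de; exact: lt_trans zr r23.
have nc w : normc (conjc w) = normc w by case: w => ? ?; rewrite /= sqrrN.
pose D p z := (r ^+ 2)%:C - (z - c) * conjc (p - c).
have DN p z : p \in zs -> normc (z - c) < r2 -> r ^+ 2 - r2 ^+ 2 <= normc (D p z).
  move=> pzs zr; apply: le_trans (lerB_normc _ _); rewrite ger0_normcr ?sqr_ge0 //.
  rewrite lerD2l lerN2 normcM nc expr2.
  by apply: ler_pM; rewrite ?normc_ge0 // ?(ltW zr) // zs2.
have D0 p z : p \in zs -> normc (z - c) < r2 -> D p z != 0.
  by move=> pzs zr; rewrite -normc_gt0 (lt_le_trans den) // DN.
have rC : (r%:C : C) != 0 by rewrite -normc_gt0 ger0_normcr ?ltW.
have bl0 z : normc (z - c) < r2 -> blaschke c r zs z != 0.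
  move=> zr; rewrite prodf_seq_neq0; apply/allP => p pzs /=.
  by rewrite mulf_neq0 ?invr_eq0 //; exact: D0.
have Q0 z : normc (z - c) < r2 -> e z * blaschke c r zs z != 0.
  by move=> zr; rewrite mulf_neq0 ?bl0 // e0 // ltW.
have QM' z : normc (z - c) < r2 -> normc (e z * blaschke c r zs z) <= expR M.
  by move=> zr; apply: QM; exact: lt_trans zr r2r.
have Qc' : expR (- M) <= normc (e c * blaschke c r zs c).
  apply: le_trans fc (le_trans _ Qc); rewrite ler_peMr ?normc_ge0 //.
  by rewrite exprn_ege1 // ltW.
have dlE z : normc (z - c) < r2 -> dlog e z =
    dlog (fun z => e z * blaschke c r zs z) z + \sum_(p <- zs) (conjc (p - c) / D p z).
  move=> zr; rewrite dlogM ?bl0 //; last 3 first.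
  - by apply: de; exact: lt_trans zr r23.
  - exact: cdiffable_blaschke.
  - by apply: e0; exact: ltW.
  rewrite /blaschke dlog_prod; last 2 first.
  - by move=> p; eexists; exact: cderiv_blaschke_factor.
  - by move=> p pzs; rewrite mulf_neq0 ?invr_eq0 //; exact: D0.
  rewrite -addrA -big_split big_seq big1 ?addr0 // => p pzs /=.
  rewrite /dlog (cdiffE (cderiv_blaschke_factor c r p z)).
  have := D0 p z pzs zr; rewrite /D.
  move: (conjc _) ((r ^+ 2)%:C) (r%:C) rC => v a r' r'0 h.
  by field; rewrite ?h ?r'0.
have bD p z : p \in zs -> normc (z - c) < r2 -> normc (conjc (p - c) / D p z) <= b.
  move=> pzs zr; rewrite normcM normcV nc; apply: ler_pM.
  - exact: normc_ge0.
  - by rewrite invr_ge0 normc_ge0.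
  - exact: zs2.
  - by rewrite lef_pV2 ?posrE ?DN // normc_gt0 D0.
have sumle := @ler_normc_sum _ zs.
split.
  apply: le_trans sz _; rewrite ler_pM2r //; lra.
move=> w wr; have wr2 := lt_trans wr r12.
have [h1 h2] := HK1 _ c M M0 dQ Q0 QM' Qc' w wr.
split.
  rewrite dlE //; apply: le_trans (ler_normcD _ _) _.
  apply: le_trans (lerD h1 (sumle _ b (fun p pz => bD p w pz wr2))) _.
  have : (size zs)%:R * b <= k0 * M * b by rewrite ler_pM2r.
  by move=> h; have := mulr_gt0 k00 M0; have := mulr_gt0 K3 M0; lra.
move=> z zr; have zr2 := lt_trans zr r12.
rewrite !dlE // opprD addrACA -sumrB; apply: le_trans (ler_normcD _ _) _.
have S2 : normc (\sum_(p <- zs) (conjc (p - c) / D p z - conjc (p - c) / D p w))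
    <= (size zs)%:R * (b ^+ 2 * normc (z - w)).
  apply: sumle => p pzs.
  have -> : conjc (p - c) / D p z - conjc (p - c) / D p w =
     (conjc (p - c) / D p z) * (conjc (p - c) / D p w) * (z - w).
    have := D0 p z pzs zr2; have := D0 p w pzs wr2; rewrite /D.
    by move: (conjc _) ((r ^+ 2)%:C) => v a h3 h4; field; rewrite ?h3 ?h4.
  rewrite normcM ler_wpM2r ?normc_ge0 // normcM expr2.
  by apply: ler_pM; rewrite ?normc_ge0 ?bD.
apply: le_trans (lerD (h2 z zr) S2) _; rewrite mulrA -mulrDl ler_wpM2r ?normc_ge0 //.
have : (size zs)%:R * b ^+ 2 <= k0 * M * b ^+ 2 by rewrite ler_wpM2r // sqr_ge0.
by move=> h; have := mulr_gt0 k00 M0; have := mulr_gt0 K2 M0; lra.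
Qed.

End ZeroFactorization.

(** * Determinants of perturbed matrices *)

Section DeterminantBounds.
Variable R : realType.
Local Notation C := R[i].
Local Open Scope sesquilinear_scope.

Lemma Re_normC (z : C) : Re `|z| = normc z.
Proof. by rewrite normc_def; case: z. Qed.

Lemma conjC_conjc (z : C) : Num.conj z = conjc z.
Proof. by []. Qed.

Definition vsq n (v : 'cV[C]_n) : R := \sum_(i < n) normc (v i 0) ^+ 2.

Lemma vsq_ge0 n (v : 'cV[C]_n) : 0 <= vsq v.
Proof. by apply: sumr_ge0 => i _; rewrite sqr_ge0. Qed.

Lemma vnormE n (v : 'cV[C]_n) : vnorm v = Num.sqrt (vsq v).
Proof. by congr Num.sqrt; apply: eq_bigr => i _; rewrite Re_normC. Qed.

Lemma vnorm_ge0 n (v : 'cV[C]_n) : 0 <= vnorm v.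
Proof. by rewrite vnormE sqrtr_ge0. Qed.

Lemma sqr_vnorm n (v : 'cV[C]_n) : vnorm v ^+ 2 = vsq v.
Proof. by rewrite vnormE sqr_sqrtr // vsq_ge0. Qed.

Lemma vsqE n (v : 'cV[C]_n) : (vsq v)%:C = (v ^t* *m v) 0 0.
Proof.
rewrite mxE (rmorph_sum (real_complex R)) /=; apply: eq_bigr => i _.
by rewrite !mxE -[RHS]/(conjc (v i 0) * v i 0) mulrC -conjc_normc.
Qed.

Lemma vnorm_eq0 n (v : 'cV[C]_n) : vnorm v = 0 -> v = 0.
Proof.
move=> v0; have : vsq v = 0 by rewrite -sqr_vnorm v0 expr0n.
move=> /eqP; rewrite psumr_eq0; last by move=> i _; rewrite sqr_ge0.
move=> /allP H; apply/matrixP => i j; rewrite ord1 mxE.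
have := H i (mem_index_enum i); rewrite sqrf_eq0 => /eqP.
by move=> /Normc.eq0_normc.
Qed.

Lemma vnormZ n (a : C) (v : 'cV[C]_n) : vnorm (a *: v) = normc a * vnorm v.
Proof.
apply/eqP; rewrite -(eqrXn2 (n := 2)) ?mulr_ge0 ?vnorm_ge0 ?normc_ge0 //.
rewrite exprMn !sqr_vnorm /vsq mulr_sumr; apply/eqP; apply: eq_bigr => i _.
by rewrite mxE normcM exprMn.
Qed.

Lemma vnormN n (v : 'cV[C]_n) : vnorm (- v) = vnorm v.
Proof. by rewrite -scaleN1r vnormZ normcN normc1 mul1r. Qed.

Lemma ler_normc_vnorm n (v : 'cV[C]_n) i : normc (v i 0) <= vnorm v.
Proof.
rewrite -(ler_pXn2r (n := 2)) ?nnegrE ?normc_ge0 ?vnorm_ge0 // sqr_vnorm /vsq.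
by rewrite (bigD1 i) //= lerDl sumr_ge0 // => j _; rewrite sqr_ge0.
Qed.

Lemma vnorm_le_sum n (v : 'cV[C]_n) : vnorm v <= \sum_(i < n) normc (v i 0).
Proof.
have S0 : 0 <= \sum_(i < n) normc (v i 0) by apply: sumr_ge0 => i _; exact: normc_ge0.
rewrite -(ler_pXn2r (n := 2)) ?nnegrE ?vnorm_ge0 // sqr_vnorm /vsq expr2 mulr_suml.
apply: ler_sum => i _; rewrite expr2 ler_wpM2l ?normc_ge0 // (bigD1 i) //= lerDl.
by apply: sumr_ge0 => j _; exact: normc_ge0.
Qed.

Lemma Re_dot_le n (v w : 'cV[C]_n) : Re ((v ^t* *m w) 0 0) <= vnorm v * vnorm w.
Proof.
have [v0|v0] := eqVneq (vnorm v) 0.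
  by rewrite (vnorm_eq0 v0) trmx0 map_mx0 mul0mx mxE mulr_ge0 ?vnorm_ge0.
have [w0|w0] := eqVneq (vnorm w) 0.
  by rewrite (vnorm_eq0 w0) mulmx0 mxE mulr_ge0 ?vnorm_ge0.
have vp : 0 < vnorm v by rewrite lt_def v0 vnorm_ge0.
have wp : 0 < vnorm w by rewrite lt_def w0 vnorm_ge0.
(* The weight for which both halves of the arithmetic-geometric inequality sum to
   [vnorm v * vnorm w / 2]. *)
pose s := vnorm w / vnorm v; have s0 : 0 < s by rewrite divr_gt0.
have amgm (a b : C) : Re (conjc a * b) <= (s * normc a ^+ 2 + s^-1 * normc b ^+ 2) / 2.
  apply: le_trans (ler_Re _) _; rewrite normcM.
  have -> : normc (conjc a) = normc a by case: (a) => ? ?; rewrite /= sqrrN.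
  rewrite ler_pdivlMr //; have := sqr_ge0 (s * normc a - normc b) => h.
  have E : s * (s * normc a ^+ 2 + s^-1 * normc b ^+ 2) = s ^+ 2 * normc a ^+ 2 + normc b ^+ 2.
    by field; rewrite gt_eqF.
  by rewrite -(ler_pM2l s0) E; move: h; nra.
rewrite mxE (_ : Re _ = \sum_(i < n) Re (conjc (v i 0) * w i 0)); last first.
  rewrite (big_morph (@Re R) (@ReD R) (erefl : Re 0 = 0)).
  by apply: eq_bigr => i _; rewrite !mxE.
apply: le_trans (ler_sum _ (fun i _ => amgm (v i 0) (w i 0))) _.
rewrite -mulr_suml big_split /= -!mulr_sumr -/(vsq v) -/(vsq w) -!sqr_vnorm /s.
rewrite le_eqVlt; apply/orP; left; apply/eqP; field.
by rewrite v0 w0.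
Qed.

Lemma ler_vnormD n (v w : 'cV[C]_n) : vnorm (v + w) <= vnorm v + vnorm w.
Proof.
rewrite -(ler_pXn2r (n := 2)) ?nnegrE ?addr_ge0 ?vnorm_ge0 //.
have E : vsq (v + w) = vsq v + vsq w + Re ((v ^t* *m w) 0 0) * 2.
  have h : (vsq (v + w))%:C = (vsq v)%:C + (vsq w)%:C + ((v ^t* *m w) 0 0 + (w ^t* *m v) 0 0).
    have tD : (v + w) ^t* = v ^t* + w ^t* by apply/matrixP => i j; rewrite !mxE rmorphD.
    have aE (M N : 'M[C]_1) : (M + N) 0 0 = M 0 0 + N 0 0 by rewrite mxE.
    rewrite !vsqE tD mulmxDl mulmxDr mulmxDr 3!aE.
    by move: (_ 0 0) (_ 0 0) (_ 0 0) (_ 0 0) => x1 x2 x3 x4; ring.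
  have h2 : (w ^t* *m v) 0 0 = conjc ((v ^t* *m w) 0 0).
    rewrite !mxE (rmorph_sum (@conjc R)); apply: eq_bigr => i _.
    rewrite !mxE -[LHS]/(conjc (w i 0) * v i 0) -[in RHS]/(conjc (v i 0)) rmorphM /=.
    by rewrite mulrC [conjc (conjc _)]conjcK.
  have -> : vsq (v + w) = Re ((vsq (v + w))%:C) by [].
  rewrite h h2 !ReD /= ; case: ((v ^t* *m w) 0 0) => a b /=; ring.
rewrite sqr_vnorm E -!sqr_vnorm; have := Re_dot_le v w; nra.
Qed.

Lemma ler_vnormB n (v w : 'cV[C]_n) : vnorm v - vnorm w <= vnorm (v - w).
Proof. by rewrite lerBlDr -{1}(subrK w v) ler_vnormD. Qed.

(** Needed for the supremum in [opnorm] to be over a bounded set. *)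
Lemma vnorm_mul_bounded n (A : 'M[C]_n) :
  exists2 K, 0 <= K & forall v : 'cV[C]_n, vnorm (A *m v) <= K * vnorm v.
Proof.
exists (\sum_(i < n) \sum_(j < n) normc (A i j)).
  by apply: sumr_ge0 => i _; apply: sumr_ge0 => j _; exact: normc_ge0.
move=> v; apply: le_trans (vnorm_le_sum _) _; rewrite mulr_suml.
apply: ler_sum => i _; rewrite mxE mulr_suml.
have tri (s : seq 'I_n) : normc (\sum_(j <- s) A i j * v j 0) <= \sum_(j <- s) normc (A i j) * vnorm v.
  elim: s => [|j s IH]; first by rewrite !big_nil normc0.
  rewrite !big_cons; apply: le_trans (ler_normcD _ _) _; apply: lerD => //.
  by rewrite normcM ler_wpM2l ?normc_ge0 // ler_normc_vnorm.
exact: tri.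
Qed.

Lemma vnorm_mul_opnorm n (A : 'M[C]_n) v : vnorm (A *m v) <= opnorm A * vnorm v.
Proof.
have [v0|v0] := eqVneq (vnorm v) 0.
  by rewrite (vnorm_eq0 v0) mulmx0 -(vnorm_eq0 v0) v0 mulr0.
have vp : 0 < vnorm v by rewrite lt_def v0 vnorm_ge0.
rewrite -ler_pdivrMr //; apply: ub_le_sup.
  have [K K0 HK] := vnorm_mul_bounded A.
  exists K => _ [w w1 <-]; apply: le_trans (HK w) _.
  by rewrite -[leRHS]mulr1 ler_wpM2l.
exists ((vnorm v)^-1%:C *: v).
  by rewrite /= vnormZ ger0_normcr ?invr_ge0 ?vnorm_ge0 // mulVf.
by rewrite -scalemxAr vnormZ ger0_normcr ?invr_ge0 ?vnorm_ge0 // mulrC.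
Qed.

Lemma unitary_vnorm n (X : 'M[C]_n) v : X \is unitarymx -> vnorm (X *m v) = vnorm v.
Proof.
move=> Xu; rewrite !vnormE; congr Num.sqrt; apply: (@complexI R).
rewrite !vsqE trmx_mul map_mxM -mulmxA (mulmxA (X ^t*)).
have -> : X ^t* *m X = 1%:M.
  by rewrite -invmx_unitary // mulVmx // unitarymx_unit.
by rewrite mul1mx.
Qed.

Lemma unitary_det n (X : 'M[C]_n) : X \is unitarymx -> normc (\det X) = 1.
Proof.
move=> /unitarymxP /(congr1 determinant); rewrite det_mulmx det1.
rewrite det_map_mx det_tr => /(congr1 (@normc R)); rewrite normcM normc1.
have -> : normc (Num.conj (\det X)) = normc (\det X).
  by rewrite conjC_conjc; case: (\det X) => a b; rewrite /= sqrrN.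
rewrite -expr2 => /eqP; rewrite -[X in _ == X -> _](expr1n _ 2).
by rewrite eqrXn2 ?normc_ge0 ?ler01 // => /eqP.
Qed.

Lemma normc_prod (I : Type) (s : seq I) (F : I -> C) :
  normc (\prod_(i <- s) F i) = \prod_(i <- s) normc (F i).
Proof. by apply: (big_morph (@normc R) (@normcM R) (@normc1 R)). Qed.

(* Gram-Schmidt on the rows writes A = T B with T triangular and B unitary. *)
Lemma hadamard_row n (A : 'M[C]_n) :
  normc (\det A) <= \prod_(i < n) Num.sqrt (\sum_(j < n) normc (A i j) ^+ 2).
Proof.
pose B := schmidt A; have Bu : B \is unitarymx by exact: schmidt_unitarymx.
pose T := A *m B ^t*.
have AE : A = T *m B.
  by rewrite /T -mulmxA -invmx_unitary // mulVmx ?mulmx1 // unitarymx_unit.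
have trigT : is_trig_mx T.
  apply/is_trig_mxP => i j ij.
  have rA := row_schmidt_sub A i.
  have /sub_sumsmxP[u uE] := rA.
  have -> : T i j = (row i A *m (row j B) ^t*) 0 0.
    by rewrite !mxE; apply: eq_bigr => k _; rewrite !mxE.
  rewrite uE mulmx_suml summxE big1 // => k ki.
  have /sub_rVP[a aE] : (u k *m <<row k (schmidt A)>>%MS <= row k B)%MS.
    by rewrite (submx_trans (submxMl _ _)) // genmxE.
  rewrite aE -scalemxAl mxE.
  have /row_unitarymxP /(_ k j) := Bu; rewrite dotmxE => ->.
  have -> : (k == j) = false by apply/negbTE; rewrite neq_ltn (leq_ltn_trans ki ij).
  by rewrite mulr0.
rewrite {1}AE det_mulmx normcM (unitary_det Bu) mulr1 det_trig // normc_prod.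
apply: ler_prod => i _; rewrite normc_ge0 /=.
have -> : \sum_(j < n) normc (A i j) ^+ 2 = \sum_(j < n) normc (T i j) ^+ 2.
  have h (M : 'M[C]_n) : (\sum_(j < n) normc (M i j) ^+ 2)%:C = (M *m M ^t*) i i.
    rewrite mxE (rmorph_sum (real_complex R)); apply: eq_bigr => j _ /=.
    by rewrite !mxE -[RHS]/(M i j * conjc (M i j)) -conjc_normc.
  apply: (@complexI R); rewrite !h /T trmx_mul map_mxM.
  rewrite -[B ^t* ^t*]/((B ^t*) ^t*) trmxCK -mulmxA (mulmxA (B ^t*)).
  by rewrite -(invmx_unitary Bu) mulVmx ?unitarymx_unit // mul1mx.
rewrite -[leLHS]ger0_norm ?normc_ge0 // -sqrtr_sqr ler_sqrt.
  by rewrite (bigD1 i) //= lerDl sumr_ge0 // => j _; rewrite sqr_ge0.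
by apply: sumr_ge0 => j _; rewrite sqr_ge0.
Qed.

Lemma hadamard_col n (A : 'M[C]_n) : normc (\det A) <= \prod_(i < n) vnorm (col i A).
Proof.
rewrite -det_tr; apply: le_trans (hadamard_row _) _.
rewrite le_eqVlt; apply/orP; left; apply/eqP; apply: eq_bigr => i _.
by rewrite vnormE /vsq; congr Num.sqrt; apply: eq_bigr => j _; rewrite !mxE.
Qed.

(** Multiplying on the right by a unitary X that diagonalises B^* B keeps the modulus of the
    determinant and makes the norms of the columns of B X the singular values s_i of B. The i-th
    column of (A + D B) X has norm at most a + b s_i <= a exp (b s_i), as 1 <= a, and Hadamard's
    inequality multiplies these. *)
Lemma det_perturbation n (A D B : 'M[C]_n) (a b : R) : 1 <= a -> 0 <= b ->
  (forall v : 'cV[C]_n, vnorm (A *m v) <= a * vnorm v) ->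
  (forall v : 'cV[C]_n, vnorm (D *m v) <= b * vnorm v) ->
  normc (\det (A + D *m B)) <= a ^+ n * expR (b * trnorm B).
Proof.
move=> a1 b0 Aa Db.
pose H := B ^t* *m B; pose P := spectralmx H; pose X := P ^t*.
have Pu : P \is unitarymx by exact: spectral_unitarymx.
have Xu : X \is unitarymx by rewrite trmxC_unitary.
have XP : X = invmx P by rewrite invmx_unitary.
have Hn : H \is normalmx.
  apply/normalmxP; rewrite /H trmx_mul map_mxM trmxCK //.
have HE : (B *m X) ^t* *m (B *m X) = diag_mx (spectral_diag H).
  have /orthomx_spectralP HE := Hn.
  rewrite trmx_mul map_mxM trmxCK -mulmxA (mulmxA (B ^t*)) -/H {1}HE -/P XP.
  rewrite -!mulmxA mulmxV ?unitarymx_unit // mulmx1 !mulmxA mulmxV ?unitarymx_unit //.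
  by rewrite mul1mx.
have sigma i : vnorm (col i (B *m X)) = Num.sqrt (Re (spectral_diag H 0 i)).
  rewrite vnormE; congr Num.sqrt.
  have := congr1 (fun M : 'M[C]_n => M i i) HE.
  rewrite [X in _ = X -> _]mxE eqxx mulr1n => <-.
  have -> : vsq (col i (B *m X)) = Re ((vsq (col i (B *m X)))%:C) by [].
  rewrite vsqE; congr Re; rewrite !mxE; apply: eq_bigr => k _; by rewrite !mxE.
have -> : normc (\det (A + D *m B)) = normc (\det ((A + D *m B) *m X)).
  by rewrite det_mulmx normcM (unitary_det Xu) mulr1.
apply: le_trans (hadamard_col _) _.
have an : a ^+ n = \prod_(i < n) a by rewrite prodr_const card_ord.
rewrite /trnorm mulr_sumr expR_sum an -big_split /=.
apply: ler_prod => i _; rewrite vnorm_ge0 /=.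
have -> : col i ((A + D *m B) *m X) = A *m (X *m delta_mx i 0) + D *m col i (B *m X).
  by rewrite !colE !mulmxA -!mulmxDl.
apply: le_trans (ler_vnormD _ _) _.
have e1 : vnorm (X *m delta_mx i 0) = 1.
  have dE j : normc ((delta_mx i 0 : 'cV[C]_n) j 0) ^+ 2 = (j == i)%:R.
    rewrite mxE eqxx andbT; case: (j == i); last by rewrite normc0 expr0n.
    by rewrite normc1 expr1n.
  rewrite (unitary_vnorm _ Xu) vnormE /vsq (eq_bigr _ (fun j _ => dE j)).
  rewrite (bigD1 i) //= eqxx big1 ?addr0 ?sqrtr1 // => j ji.
  by rewrite (negbTE ji).
have h1 := Aa (X *m delta_mx i 0); rewrite e1 mulr1 in h1.
have h2 := Db (col i (B *m X)); rewrite sigma in h2.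
apply: le_trans (lerD h1 h2) _.
set s := Num.sqrt _ in h2 *; have s0 : 0 <= s by rewrite sqrtr_ge0.
have bs : 0 <= b * s by rewrite mulr_ge0.
apply: (@le_trans _ _ (a * (1 + b * s))); first by rewrite mulrDr mulr1 lerD2l ler_peMl.
by rewrite ler_pM2l ?expR_ge1Dx // (lt_le_trans ltr01).
Qed.

End DeterminantBounds.

(** * Order of vanishing of a determinant and dimension of the kernel *)

Section DeterminantZeros.
Variable R : realType.
Local Notation C := R[i].
Local Open Scope sesquilinear_scope.
Implicit Types (f g e : C -> C) (z w p : C).

Lemma normC_E z : `|z| = (normc z)%:C.
Proof. by rewrite normc_def; case: z. Qed.

(** The positive elements of [C] are real, so the epsilons and deltas of [is_derive_epsP] over [C]
    are those of [cderiv]. *)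
Lemma is_derive_cderiv f z l : is_derive z 1 f l <-> cderiv f z l.
Proof.
rewrite is_derive_epsP; split=> H e e0.
  have [|d d0 Hd] := H e%:C; first by rewrite ltcR.
  have dE : d = (Re d)%:C by rewrite RRe_real // realE ltW.
  exists (Re d) => [|w wd]; first by rewrite -ltcR -dE.
  have := Hd w; rewrite !normC_E dE ltcR => /(_ wd).
  by rewrite -rmorphM lecR.
have eE : e = (Re e)%:C by rewrite RRe_real // realE ltW.
have [|d d0 Hd] := H (Re e); first by rewrite -ltcR -eE.
exists d%:C; first by rewrite ltcR.
move=> w; rewrite !normC_E ltcR => /Hd; rewrite [in X in _ -> X]eE.
by rewrite -rmorphM lecR.
Qed.

Lemma derivable_cdiffable f z : derivable f z 1 <-> cdiffable f z.
Proof.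
split=> [df|[l /is_derive_cderiv [df _]]] //.
by exists ('D_1 f z); apply/is_derive_cderiv; exact/derivableP.
Qed.

Lemma derive1_cdiff f z : cdiffable f z -> derive1 f z = cdiff f z.
Proof.
move=> [l dl]; rewrite (cdiffE dl) derive1E.
by have /is_derive_cderiv [_ ->] := dl.
Qed.

Lemma near_normcP (P : C -> Prop) z : (\forall w \near z, P w) <->
  exists2 d : R, 0 < d & forall w, normc (w - z) < d -> P w.
Proof.
split.
  move=> /nbhs_ballP[d /= d0 H].
  have dE : d = (Re d)%:C by rewrite RRe_real // realE ltW.
  exists (Re d) => [|w wd]; first by rewrite -ltcR -dE.
  by apply: H; rewrite -ball_normE /ball_ /= distrC normC_E dE ltcR.
move=> [d d0 H]; apply/nbhs_ballP; exists d%:C => /=; first by rewrite ltcR.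
by move=> w; rewrite -ball_normE /ball_ /= distrC normC_E ltcR => /H.
Qed.

Lemma cdiffable_sum (I : Type) (s : seq I) (F : I -> C -> C) z :
  (forall i, cdiffable (F i) z) -> cdiffable (fun w => \sum_(i <- s) F i w) z.
Proof.
move=> dF; elim: s => [|i s IH].
  by apply: (cdiffable_eq _ (cdiffable_cst 0 z)) => w; rewrite big_nil.
have [a da] := dF i; have [b db] := IH.
apply: (cdiffable_eq (f := fun w => F i w + \sum_(j <- s) F j w)).
  by move=> w; rewrite big_cons.
by exists (a + b); exact: cderivD.
Qed.

Lemma cdiffable_det n (A : C -> 'M[C]_n) z :
  (forall i j, cdiffable (fun w => A w i j) z) -> cdiffable (fun w => \det (A w)) z.
Proof.
move=> dA; apply: cdiffable_sum => s; apply: cdiffableM; first exact: cdiffable_cst.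
exact: cdiffable_prod.
Qed.

(** If another factorisation had exponent [m > k], then [g] would agree with
    [(w - p) ^+ (m - k) * h w] off [p], and continuity would force [g p = 0]. *)
Lemma vanishing_orderE f g p (k : nat) (d : R) : 0 < d ->
  (forall w, normc (w - p) < d -> f w = (w - p) ^+ k * g w) ->
  (forall w, normc (w - p) < d -> cdiffable g w) -> g p != 0 ->
  vanishing_order f p = k%:R%:E.
Proof.
move=> d0 fE dg gp; apply/eqP; rewrite eq_le; apply/andP; split.
  apply: ge_ereal_sup => _ [m [h /near_normcP[d' d'0 H]] <-].
  rewrite lee_fin ler_nat leqNgt; apply/negP => km.
  have pp (r : R) : 0 < r -> normc (p - p) < r by rewrite subrr normc0.
  have ch : ccont h p.
    by have [/derivable_cdiffable/cdiffable_ccont] := H p (pp _ d'0).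
  have cg : ccont g p by apply: cdiffable_ccont; exact: dg (pp _ d0).
  pose q w := (w - p) ^+ (m - k) * h w - g w.
  have cq : ccont q p.
    apply: ccontD.
      apply: ccontM => //; have [l] : cdiffable (fun w => (w - p) ^+ (m - k)) p.
        apply: (cdiffable_eq (f := fun w => \prod_(i <- iota 0 (m - k)) (w - p))).
          by move=> w; rewrite big_const_seq count_predT size_iota -Monoid.iteropE.
        by apply: cdiffable_prod => _; exact: cdiffable_subr.
      exact: cderiv_ccont.
    by apply: (ccont_eq_near ltr01 _ (ccontM (ccont_cst (-1) p) cg)) => w _; rewrite mulN1r.
  have qp : q p = - g p by rewrite /q subrr expr0n subn_eq0 leqNgt km mul0r sub0r.
  have qp0 : q p != 0 by rewrite qp oppr_eq0.
  have [d2 d20 H2] := ccont_neq0 cq qp0.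
  have m0 : 0 < Num.min d2 (Num.min d d') by rewrite !lt_min d20 d0.
  have [w] := seq_avoid [:: p] p m0.
  rewrite inE !lt_min => wp /andP[w2 /andP[wd wd']].
  have [_ h1] := H w wd'; have := fE w wd; rewrite h1 => E.
  have /H2 := w2; rewrite leNgt => /negP; apply.
  have -> : q w = 0.
    have wp0 : (w - p) ^+ k != 0 by rewrite expf_neq0 // subr_eq0.
    apply: (mulfI wp0); rewrite /q mulrBr mulr0 mulrA -exprD subnKC ?(ltnW km) //.
    by rewrite E subrr.
  by rewrite normc0 divr_gt0 // normc_gt0.
apply: ereal_sup_ubound; exists k => //; exists g; apply/near_normcP.
exists d => // w wd; split; first exact/derivable_cdiffable/dg.
exact: fE.
Qed.

Lemma vanishing_order_zprod f e zs p (d : R) : 0 < d ->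
  (forall w, normc (w - p) < d -> f w = zprod zs w * e w) ->
  (forall w, normc (w - p) < d -> cdiffable e w) -> e p != 0 ->
  vanishing_order f p = (count_mem p zs)%:R%:E.
Proof.
move=> d0 fE de ep.
have zE w : zprod zs w = (w - p) ^+ count_mem p zs * zprod [seq q <- zs | q != p] w.
  rewrite /zprod; elim: zs {fE} => [|q zs IH]; first by rewrite !big_nil mulr1.
  rewrite big_cons IH /=; case: eqVneq => [->|_] /=; first by rewrite exprS mulrA.
  by rewrite big_cons add0n mulrCA.
apply: (@vanishing_orderE f (fun w => zprod [seq q <- zs | q != p] w * e w) p _ d) => //.
- by move=> w wd; rewrite fE // zE mulrA.
- by move=> w /de; apply: cdiffableM; exact: cdiffable_zprod.
- by rewrite mulf_neq0 // zprod_neq0 // mem_filter eqxx.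
Qed.

(* Column operations bring the kernel of B z into the last columns, each of
   which can then be divided by w - z. *)
Lemma det_kernel_factor n (B : C -> 'M[C]_n) z (d : R) : 0 < d ->
  (forall i j w, normc (w - z) < d -> cdiffable (fun w => B w i j) w) ->
  exists g, [/\ forall w, \det (B w) = (w - z) ^+ (\rank (kermx (B z)^T)) * g w,
   forall w, normc (w - z) < d -> cdiffable g w &
   (forall u : 'cV[C]_n, B z *m u = 0 -> u ^t* *m B z = 0) ->
   (forall u : 'cV[C]_n, B z *m u = 0 ->
      (u ^t* *m (\matrix_(i, j) cdiff (fun w => B w i j) z) *m u) 0 0 = 0 -> u = 0) ->
   g z != 0].
Proof.
move=> d0 dB.
have zd : normc (z - z) < d by rewrite subrr normc0.
pose r := \rank (B z); pose L := col_ebase (B z); pose Q := row_ebase (B z).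
pose P := invmx Q.
have Qu : Q \in unitmx by exact: row_ebase_unit.
have Lu : L \in unitmx by exact: col_ebase_unit.
have BP : B z *m P = L *m pid_mx r.
  by rewrite -{1}(mulmx_ebase (B z)) -/L -/Q -/r /P mulmxK.
pose W w := B w *m P.
have dW i j w : normc (w - z) < d -> cdiffable (fun w => W w i j) w.
  move=> wd; apply: (cdiffable_eq (f := fun w => \sum_k B w i k * P k j)).
    by move=> v; rewrite mxE.
  by apply: cdiffable_sum => k; apply: cdiffableM; [exact: dB|exact: cdiffable_cst].
have Wz i (j : 'I_n) : (r <= j)%N -> W z i j = 0.
  move=> rj; rewrite /W BP mxE big1 // => k _; rewrite mxE.
  case: eqP => [kj|_] /=; last by rewrite mulr0.
  by rewrite kj ltnNge rj mulr0.
have exS (ij : 'I_n * 'I_n) : exists s : C -> C, (r <= ij.2)%N ->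
    (forall w, W w ij.1 ij.2 = (w - z) * s w) /\
    forall w, cdiffable (fun w => W w ij.1 ij.2) w -> cdiffable s w.
  case: ij => i j /=; have [rj|//] := boolP (r <= j)%N; last by exists (fun=> 0).
  have [s [sE ds]] := divide_zero d0 (fun w wd => dW i j w wd) (Wz i j rj).
  by exists s.
have [S SP] := choice exS.
pose M w := \matrix_(i, j) (if (r <= j)%N then S (i, j) w else W w i j).
have kE : \rank (kermx (B z)^T) = (n - r)%N by rewrite mxrank_ker mxrank_tr.
have rn : (r <= n)%N by exact: rank_leq_row.
pose D w : 'rV[C]_n := \row_j (if (r <= j)%N then w - z else 1).
have WE w : W w = M w *m diag_mx (D w).
  apply/matrixP => i j; rewrite mul_mx_diag [RHS]mxE ![_ 0 j]mxE [M w i j]mxE.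
  case: ifP => [rj|_]; last by rewrite mulr1.
  by have [-> _] := SP (i, j) rj; rewrite mulrC.
have detD w : \det (diag_mx (D w)) = (w - z) ^+ (n - r).
  rewrite det_diag.
  rewrite (eq_bigr (fun j : 'I_n => if (r <= j)%N then w - z else 1)); last by move=> j _; rewrite mxE.
  rewrite -big_mkcond /= prodr_const; congr (_ ^+ _).
  rewrite -sum1_card -(big_mkord (fun j => (r <= j)%N) (fun=> 1%N)).
  have := @big_nat_widenl _ 0%N addn r 0 n predT (fun=> 1%N) (leq0n r).
  by rewrite sum_nat_const_nat muln1 /= => <-.
exists (fun w => \det (M w) * \det Q); split.
- move=> w; rewrite kE -detD.
  have -> : B w = W w *m Q by rewrite /W /P -mulmxA mulVmx // mulmx1.
  by rewrite det_mulmx WE det_mulmx; ring.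
- move=> w wd; apply: cdiffableM; last exact: cdiffable_cst.
  apply: cdiffable_det => i j; have [rj|rj] := boolP (r <= j)%N.
    apply: (cdiffable_eq (f := S (i, j))); first by move=> v; rewrite mxE rj.
    by have [_] := SP (i, j) rj; apply; exact: dW.
  apply: (cdiffable_eq (f := fun w => W w i j)); last exact: dW.
  by move=> v; rewrite [RHS]mxE (negbTE rj).
- move=> Hadj Hpos.
  have detQ : \det Q != 0 by have := Qu; rewrite unitmxE unitfE.
  rewrite mulf_neq0 //; apply/negP => /eqP detM0.
  have : \rank (M z)^T != n.
    rewrite mxrank_tr -[X in _ != X]/n; apply/negP => /eqP h.
    have : M z \in unitmx by rewrite -row_full_unit /row_full h.
    by rewrite unitmxE unitfE detM0 eqxx.
  move=> rk; have : kermx (M z)^T != 0.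
    rewrite kermx_eq0 /row_free; exact: rk.
  move=> /rowV0Pn[x /sub_kermxP xM x0].
  pose v := x^T; have v0 : v != 0 by rewrite trmx_eq0.
  have Mv : M z *m v = 0 by rewrite -[LHS]trmxK trmx_mul trmxK xM trmx0.
  pose B' := \matrix_(i, j) cdiff (fun w => B w i j) z : 'M[C]_n.
  (* The last columns of [B z *m P] vanish, and dividing them by [w - z] leaves their derivatives;
     so [M z] has the columns of [B z *m P] before [r] and those of [B' *m P] from [r] on. *)
  have ME : M z = B z *m P + B' *m P *m copid_mx r.
    apply/matrixP => i j; rewrite mxE -/(W z) [RHS]mxE.
    have cop (X : 'M[C]_n) : (X *m copid_mx r) i j = if (r <= j)%N then X i j else 0.
      rewrite mxE (bigD1 j) //= big1 => [|k kj]; last first.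
        have kj' : (k == j :> nat) = false by apply/negbTE.
        by rewrite !mxE (negbTE kj) kj' /= subrr mulr0.
      rewrite addr0 /copid_mx !mxE !eqxx [(r <= j)%N]leqNgt.
      by case: (j < r)%N; rewrite /= ?subrr ?subr0 ?mulr0 ?mulr1.
    rewrite cop; case: ifP => rj; last by rewrite addr0.
    rewrite Wz // add0r; have [sE ds] := SP (i, j) rj; rewrite /= in sE ds.
    have dS : cdiffable (S (i, j)) z by apply: ds; exact: dW.
    have h1 := cderivM (cderiv_subr z z) (cdiffP dS).
    rewrite mul1r subrr mul0r addr0 in h1.
    have h2 : cderiv (fun w => W w i j) z (S (i, j) z).
      by apply: (cderiv_eq_near ltr01 _ h1) => w _; rewrite sE.
    have h3 : cderiv (fun w => W w i j) z ((B' *m P) i j).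
      rewrite mxE.
      have sumd (s : seq 'I_n) : cderiv (fun w => \sum_(k <- s) B w i k * P k j) z
          (\sum_(k <- s) B' i k * P k j).
        elim: s => [|k s IH].
          rewrite big_nil; apply: (cderiv_eq_near ltr01 _ (cderiv_cst 0 z)) => w _.
          by rewrite big_nil.
        rewrite big_cons; have dk := cdiffP (dB i k z zd).
        have := cderivM dk (cderiv_cst (P k j) z); rewrite mulr0 addr0 => dk'.
        have := cderivD dk' IH; rewrite mxE.
        by apply: (cderiv_eq_near ltr01) => w _; rewrite big_cons.
      by apply: (cderiv_eq_near ltr01 _ (sumd _)) => w _; rewrite mxE.
    exact: cderiv_uniq h2 h3.
  (* [u2] lies in the kernel of [B z]. Pairing [eqn] with its adjoint kills the [B z] term by the
     first hypothesis and leaves the quadratic form of [B'] at [u2], so [u2 = 0] by the second. What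
     remains of [eqn] is [L *m v = 0]. *)
  pose u2 := P *m (copid_mx r *m v).
  have Bu2 : B z *m u2 = 0.
    rewrite /u2 mulmxA BP -mulmxA (mulmxA (pid_mx r)) /copid_mx mulmxBr mulmx1.
    by rewrite pid_mx_id // subrr mul0mx mulmx0.
  have eqn : B z *m (P *m v) + B' *m u2 = 0.
    by rewrite -Mv ME mulmxDl -!mulmxA.
  have u20 : u2 = 0.
    apply: Hpos => //; rewrite -/B'.
    have key (l : 'rV[C]_n) (X : 'M[C]_n) (p q : 'cV[C]_n) :
        l *m X = 0 -> X *m p + q = 0 -> l *m q = 0.
      by move=> lX h; rewrite -[RHS](mulmx0 _ l) -h mulmxDr mulmxA lX mul0mx add0r.
    by rewrite -mulmxA (key _ _ _ _ (Hadj _ Bu2) eqn) mxE.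
  have Pu : P \in unitmx by rewrite unitmx_inv.
  have cv : copid_mx r *m v = 0.
    by rewrite -[LHS]mul1mx -(mulVmx Pu) -mulmxA -/u2 u20 mulmx0.
  have pv : pid_mx r *m v = v.
    apply/eqP; rewrite -subr_eq0 -opprB oppr_eq0; apply/eqP.
    by rewrite -[RHS]cv /copid_mx mulmxBl mul1mx.
  move: eqn; rewrite u20 mulmx0 addr0 mulmxA BP -mulmxA pv => Lv.
  by move: v0; rewrite -[v]mul1mx -(mulVmx Lu) -mulmxA Lv mulmx0 eqxx.
Qed.

End DeterminantZeros.

(** * Counting resonances *)

Section Counting.
Variables (R : realType) (Y0 : \bar R).
Local Notation C := R[i].
Local Open Scope sesquilinear_scope.

Lemma lower_domain_open (z : C) : lower_domain Y0 z ->
  exists2 d : R, 0 < d & forall w, normc (w - z) < d -> lower_domain Y0 w.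
Proof.
rewrite /lower_domain /=; case: (Y0) => [y| |] //=.
  rewrite lte_fin => zy; exists (y - Im z); first by rewrite subr_gt0.
  move=> w wz; rewrite lte_fin -(subrK (Im z) (Im w)) -ltrBrDr -ImB.
  by apply: le_lt_trans wz; rewrite (le_trans (ler_norm _)) // ler_normIm.
by move=> _; exists 1 => // w _; rewrite ltry.
Qed.

Lemma holomorphic_mx_cdiffable n (A : C -> 'M[C]_n) z i j :
  holomorphic_mx Y0 A -> lower_domain Y0 z -> cdiffable (fun w => A w i j) z.
Proof. by move=> hA zD; apply/derivable_cdiffable; exact: hA. Qed.

Lemma cdiffable_sub1 n (A : C -> 'M[C]_n) z i j :
  holomorphic_mx Y0 A -> lower_domain Y0 z -> cdiffable (fun w => (A w - 1%:M) i j) z.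
Proof.
move=> hA zD; apply: (cdiffable_eq (f := fun w => A w i j - (1%:M : 'M[C]_n) i j)).
  by move=> w; rewrite !mxE.
by apply: cdiffableB; [exact: holomorphic_mx_cdiffable|exact: cdiffable_cst].
Qed.

Lemma cdiffable_det_sub1 n (A : C -> 'M[C]_n) z :
  holomorphic_mx Y0 A -> lower_domain Y0 z -> cdiffable (fun w => \det (A w - 1%:M)) z.
Proof. by move=> hA zD; apply: cdiffable_det => i j; exact: cdiffable_sub1. Qed.

Lemma ker_mult_le n (A : C -> 'M[C]_n) z : holomorphic_mx Y0 A -> lower_domain Y0 z ->
  (ker_mult A z <= det_mult A z)%E.
Proof.
move=> hA zD; have [d d0 Hd] := lower_domain_open zD.
have [g [gE dg _]] := @det_kernel_factor _ n (fun w => A w - 1%:M) z d d0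
  (fun i j w wd => cdiffable_sub1 i j hA (Hd w wd)).
apply: ereal_sup_ubound; exists (\rank (kermx (A z - 1%:M)^T)) => //.
exists g; apply/near_normcP; exists d => // w wd; split; last exact: gE.
exact/derivable_cdiffable/dg.
Qed.

(** On the kernel of A - 1 the inverse of A is also the identity. Unitarity then makes a fixed
    vector fixed on the left as well, and monotonicity makes -i u^* A' u at least c |u|^2; these are
    the two conditions under which [det_kernel_factor] gives the exact order. *)
Lemma ker_mult_reference n (A : C -> 'M[C]_n) (x c : R) : 0 < c ->
  holomorphic_mx Y0 A -> lower_domain Y0 x%:C -> A x%:C \is unitarymx ->
  positive_mx ((0 -i* 1) *: (Defs.derive_mx A x%:C *m invmx (A x%:C)) - (c%:C)%:M) ->
  ker_mult A x%:C = det_mult A x%:C.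
Proof.
move=> c0 hA zD uA [_ posA]; have [d d0 Hd] := lower_domain_open zD.
have [g [gE dg g0]] := @det_kernel_factor _ n (fun w => A w - 1%:M) x%:C d d0
  (fun i j w wd => cdiffable_sub1 i j hA (Hd w wd)).
apply/esym/(vanishing_orderE d0 _ dg); first by move=> w _; rewrite gE.
have fixA (u : 'cV[C]_n) : (A x%:C - 1%:M) *m u = 0 -> A x%:C *m u = u.
  by rewrite mulmxBl mul1mx => /eqP; rewrite subr_eq0 => /eqP.
have fixV (u : 'cV[C]_n) : (A x%:C - 1%:M) *m u = 0 -> invmx (A x%:C) *m u = u.
  by move=> /fixA {1}<-; rewrite mulmxA mulVmx ?mul1mx // unitarymx_unit.
apply: g0 => u Bu.
  have := fixV u Bu; rewrite invmx_unitary // => /(congr1 (fun X : 'cV[C]_n => X ^t*)).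
  rewrite trmx_mul map_mxM trmxCK => E.
  by rewrite mulmxBr mulmx1 E subrr.
move=> E; have := posA u.
have dE : \matrix_(i, j) cdiff (fun w => (A w - 1%:M) i j) x%:C = Defs.derive_mx A x%:C.
  apply/matrixP => i j; rewrite !mxE derive1_cdiff; last exact: holomorphic_mx_cdiffable.
  have dAi := cdiffP (holomorphic_mx_cdiffable i j hA zD).
  have := cderivB dAi (cderiv_cst ((1%:M : 'M[C]_n) i j) x%:C); rewrite subr0 => h.
  by apply: cdiffE; apply: (cderiv_eq_near ltr01 _ h) => w _; rewrite !mxE.
rewrite dE in E; rewrite mulmxBr mulmxBl -scalemxAr -scalemxAl -!mulmxA fixV // mul_scalar_mx -scalemxAr.
have q (X Y : 'M[C]_1) (a b : C) : (a *: X - b *: Y) 0 0 = a * X 0 0 - b * Y 0 0.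
  by rewrite !mxE.
rewrite q mulmxA E mulr0 sub0r -vsqE -(rmorphM (real_complex R)).
rewrite -(rmorphN (real_complex R)) ler0c oppr_ge0 => h.
have v0 : vsq u = 0.
  by apply/eqP; rewrite eq_le vsq_ge0 andbT -(pmulr_rle0 _ c0).
by apply: vnorm_eq0; rewrite vnormE v0 sqrtr0.
Qed.

(** Carries the unordered sums of multiplicities over to lists of zeros with repetition, on which
    the analysis works. *)
Lemma esum_count_mem (S : set C) (zs : seq C) (Q : pred C) (mult : C -> \bar R) :
  (forall z, S z <-> z \in zs /\ Q z) ->
  (forall z, S z -> mult z = (count_mem z zs)%:R%:E) ->
  \esum_(z in S) mult z = (count Q zs)%:R%:E.
Proof.
move=> SE multE; pose s := [seq z <- undup zs | Q z].
have SsE : S = [set` s].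
  apply/seteqP; split=> z; rewrite /= mem_filter mem_undup => H.
    by have [-> ->] := (SE z).1 H.
  by apply/(SE z).2; move: H => /andP[].
have us : uniq s by rewrite filter_uniq // undup_uniq.
rewrite (eq_esum multE) SsE esum_fset; last 2 first.
- exact: finite_seq.
- by move=> z _; rewrite lee_fin.
rewrite -(fsbig_seq _ _ us) sumEFin -natr_sum; congr (_%:R%:E).
rewrite big_filter -sum1_count -[RHS](big_undup_iterop_count _ zs Q (fun=> 1%N)).
apply: eq_bigr => z _; rewrite Monoid.iteropE.
by elim: (count_mem z zs) => [|k IH] //; rewrite iterS -IH.
Qed.

Lemma resonance_count_zeros n (A : C -> 'M[C]_n) zs e (a b c1 c2 : R) :
  (c2%:E < Y0)%E ->
  (forall w, \det (A w - 1%:M) = zprod zs w * e w) ->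
  (forall w, lower_domain Y0 w -> cdiffable e w) ->
  (forall w, a <= Re w <= b -> c1 <= Im w <= c2 -> e w != 0) ->
  resonance_count Y0 (@det_mult R n) a b c1 c2 A =
  (count (fun z => (a <= Re z <= b) && (c1 <= Im z <= c2)) zs)%:R%:E.
Proof.
move=> c2Y AE de e0; apply: esum_count_mem.
  move=> z; rewrite /= /resonance AE; split.
    move=> [[_ /eqP]]; rewrite mulf_eq0 => + zx zy; rewrite (negbTE (e0 z zx zy)) orbF zx zy.
    by move=> z0; split=> //; apply: contraLR z0 => /zprod_neq0.
  move=> [zs_z /andP[zx zy]]; split => //; split.
    by rewrite /lower_domain /=; apply: le_lt_trans c2Y; rewrite lee_fin; case/andP: zy.
  apply/eqP; rewrite mulf_eq0; apply/orP; left; rewrite /zprod prodf_seq_eq0.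
  by apply/hasP; exists z => //=; rewrite subrr.
move=> z [[zD _] zx zy]; have [d d0 Hd] := lower_domain_open zD.
apply: (@vanishing_order_zprod _ _ e zs z d d0) => //.
- by move=> w /Hd; exact: de.
- exact: e0.
Qed.

Lemma real_resonance_count_zeros n (A : C -> 'M[C]_n) ws e (a b : R) :
  (0 < Y0)%E ->
  (forall w, \det (A w - 1%:M) = zprod ws w * e w) ->
  (forall w, lower_domain Y0 w -> cdiffable e w) ->
  (forall x : R, a <= x <= b -> e x%:C != 0) ->
  (forall x : R, ker_mult A x%:C = det_mult A x%:C) ->
  real_resonance_count Y0 a b A =
  (count (fun z => (a <= Re z <= b) && (Im z == 0)) ws)%:R%:E.
Proof.
move=> Y00 AE de e0 kd; have D0 (x : R) : lower_domain Y0 x%:C by [].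
apply: esum_count_mem.
  move=> z; rewrite /= /resonance; split.
    move=> [x [-> xab [_ /eqP]]]; rewrite AE mulf_eq0 (negbTE (e0 x xab)) orbF /= eqxx xab.
    by move=> z0; split=> //; apply: contraLR z0 => /zprod_neq0.
  move=> [zs_z /andP[zx /eqP zy]]; exists (Re z); split => //.
    by apply: complexP.
  split; first by rewrite /lower_domain /= zy.
  rewrite AE; apply/eqP; rewrite mulf_eq0; apply/orP; left; rewrite /zprod prodf_seq_eq0.
  by apply/hasP; exists z => //=; rewrite subrr.
move=> _ [x [-> xab _]]; rewrite kd; have [d d0 Hd] := lower_domain_open (D0 x).
apply: (@vanishing_order_zprod _ _ e ws x%:C d d0) => //.
- by move=> w /Hd; exact: de.
- exact: e0.
Qed.

Lemma resonance_count_ker_le n (A : C -> 'M[C]_n) (a b c1 c2 : R) : holomorphic_mx Y0 A ->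
  (resonance_count Y0 (@ker_mult R n) a b c1 c2 A <=
   resonance_count Y0 (@det_mult R n) a b c1 c2 A)%E.
Proof. by move=> hA; apply: le_esum => z [[zD _] _ _]; exact: ker_mult_le. Qed.

End Counting.

(** * Comparison of the zeros of two functions *)

Section PoissonKernels.
Variable R : realType.
Local Notation C := R[i].
Implicit Types (z w p : C) (x u d s t : R).

(** The Poisson kernel of the half-plane at height [d], without the factor 1 / pi; its total mass is
    pi. *)
Definition poisson d x u : R := d / ((x - u) ^+ 2 + d ^+ 2).

Lemma poisson_Im x d p : 0 < d -> Im p = 0 ->
  Im ((x +i* d - p)^-1 - (x +i* (- d) - p)^-1) = - 2 * poisson d x (Re p).
Proof.
case: p => u v d0 /= ->; rewrite /poisson !subr0 sqrrN; ring.
Qed.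

(** If [Re p] is within 1 of [x], moving [p] to the axis changes the two inverses by at most [d] and
    [2 * d], the displacement being at most [d ^+ 3] and the denominators at least [d * d] and
    [d / 2 * d]. Otherwise all distances are at least 1, and the jumps at [p] and at its projection
    are each at most [2 * d]. *)
Lemma poisson_perturb x d eta p : 0 < d -> d <= 1 / 2 -> eta <= d ^+ 3 ->
  Im p <= 0 -> (`|x - Re p| <= 1 -> - eta <= Im p) ->
  `|Im ((x +i* d - p)^-1 - (x +i* (- d) - p)^-1) + 2 * poisson d x (Re p)| <= 4 * d.
Proof.
move=> d0 d1 etad p0 near.
pose z : C := x +i* d; pose zb : C := x +i* (- d); pose q : C := (Re p)%:C.
have zq : d <= normc (z - q).
  by apply: le_trans (ler_normIm _); rewrite ImB /= subr0 ger0_norm // ltW.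
have zbq : d <= normc (zb - q).
  by apply: le_trans (ler_normIm _); rewrite ImB /= subr0 normrN ger0_norm // ltW.
have zp : d <= normc (z - p).
  apply: le_trans (ler_normIm _); rewrite ImB /=; apply: le_trans (ler_norm _); lra.
have E : - (2 * poisson d x (Re p)) = Im ((z - q)^-1 - (zb - q)^-1).
  by rewrite (@poisson_Im x d q) // mulNr.
rewrite -/z -/zb -[X in `|_ + X|]opprK E -ImB.
apply: le_trans (ler_normIm _) _.
have [h|h] := leP `|x - Re p| 1.
  have {}near := near h.
  have d34 : d ^+ 3 <= d / 4.
    rewrite exprS mulrC -mulrA ler_wpM2l //; first exact: ltW.
    have dd : d * d <= (1 / 2) * (1 / 2) by apply: ler_pM => //; exact: ltW.
    by lra.
  have zbp : d / 2 <= normc (zb - p).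
    apply: le_trans (ler_normIm _); rewrite ImB /= -normrN; apply: le_trans (ler_norm _); lra.
  have pq : normc (p - q) <= d ^+ 3.
    apply: le_trans (ler_normcReIm _) _; rewrite ReB ImB /= subrr normr0 add0r subr0.
    by rewrite ler0_norm //; lra.
  have n1 : z - p != 0 by rewrite -normc_gt0 (lt_le_trans d0).
  have n2 : z - q != 0 by rewrite -normc_gt0 (lt_le_trans d0).
  have n3 : zb - q != 0 by rewrite -normc_gt0 (lt_le_trans d0).
  have n4 : zb - p != 0 by rewrite -normc_gt0; apply: lt_le_trans zbp; rewrite divr_gt0.
  have -> : (z - p)^-1 - (zb - p)^-1 - ((z - q)^-1 - (zb - q)^-1) =
     (p - q) / ((z - p) * (z - q)) - (p - q) / ((zb - p) * (zb - q)).
    by field; rewrite n1 n2 n3 n4.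
  apply: le_trans (ler_normcB _ _) _; rewrite !normcM !normcV !normcM.
  have d20 : 0 < d / 2 by rewrite divr_gt0.
  have b1 : normc (p - q) / (normc (z - p) * normc (z - q)) <= d.
    rewrite ler_pdivrMr ?mulr_gt0 ?normc_gt0 //; apply: le_trans pq _.
    have : d * d <= normc (z - p) * normc (z - q) by apply: ler_pM => //; exact: ltW.
    by move=> hh; rewrite exprS expr2 ler_pM2l.
  have b2 : normc (p - q) / (normc (zb - p) * normc (zb - q)) <= 2 * d.
    rewrite ler_pdivrMr ?mulr_gt0 ?normc_gt0 //; apply: le_trans pq _.
    have : d / 2 * d <= normc (zb - p) * normc (zb - q) by apply: ler_pM => //; exact: ltW.
    set X := normc (zb - p) * normc (zb - q) => hh.
    by rewrite (_ : 2 * d * X = d * (2 * X)) ?exprS ?expr2 ?ler_pM2l //; [lra|ring].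
  lra.
have one (w v : C) : Re (w - v) = x - Re p -> 1 <= normc (w - v).
  by move=> e; apply: le_trans (ler_normRe _); rewrite e ltW.
have zp1 : 1 <= normc (z - p) by apply: one; rewrite ReB.
have zbp1 : 1 <= normc (zb - p) by apply: one; rewrite ReB.
have zq1 : 1 <= normc (z - q) by apply: one; rewrite ReB.
have zbq1 : 1 <= normc (zb - q) by apply: one; rewrite ReB.
have far v : 1 <= normc (z - v) -> 1 <= normc (zb - v) -> normc ((z - v)^-1 - (zb - v)^-1) <= 2 * d.
  move=> h1 h2; have v1 : z - v != 0 by rewrite -normc_gt0 (lt_le_trans ltr01).
  have v2 : zb - v != 0 by rewrite -normc_gt0 (lt_le_trans ltr01).
  have -> : (z - v)^-1 - (zb - v)^-1 = (zb - z) / ((z - v) * (zb - v)) by field; rewrite v1 v2.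
  rewrite normcM normcV normcM ler_pdivrMr ?mulr_gt0 ?normc_gt0 //.
  have -> : normc (zb - z) = 2 * d.
    have -> : zb - z = - ('i * (2 * d)%:C) by apply: complexP; rewrite /=; ring.
    by rewrite normcN normcM normc_i mul1r ger0_normcr // mulr_ge0 // ltW.
  rewrite ler_peMr ?mulr_ge0 ?(ltW d0) //.
  by rewrite -[1]mulr1; apply: ler_pM.
apply: le_trans (ler_normcB _ _) _.
have := far p zp1 zbp1; have := far q zq1 zbq1; lra.
Qed.

Lemma atan_window (th eps : R) : 0 < th -> 0 < eps -> exists2 d0 : R, 0 < d0 &
  forall d s t u, 0 < d -> d <= d0 -> s <= t ->
  [/\ 0 <= atan ((t - u) / d) - atan ((s - u) / d) <= pi,
    s + eps <= u <= t - eps -> pi - th <= atan ((t - u) / d) - atan ((s - u) / d)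
  & (u < s - eps) || (t + eps < u) -> atan ((t - u) / d) - atan ((s - u) / d) <= th].
Proof.
move=> th0 eps0; pose th1 := Num.min th 1.
have th10 : 0 < th1 by rewrite lt_min th0 ltr01.
have th1th : th1 <= th by rewrite ge_min lexx.
have th11 : th1 <= 1 by rewrite ge_min lexx orbT.
have pi2 := @pi_ge2 R.
(* Two arctangents, each within [th1 / 2] of its limit, lose at most [th1] in total; [th1 <= 1]
   keeps [y] where [tan] is inverted by [atan]. *)
pose y := pi / 2 - th1 / 2; pose M := tan y.
have aM : atan M = y by rewrite tanK // in_itv /= /y; apply/andP; split; lra.
have M1 : 0 < `|M| + 1 by rewrite ltr_wpDl.
exists (eps / (`|M| + 1)); first by rewrite divr_gt0.
move=> d s t u dp dd st.
have big v : eps <= v -> y <= atan (v / d).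
  move=> ev; rewrite -aM; apply: le_atan; rewrite ler_pdivlMr //.
  apply: le_trans (ler_wpM2r (ltW dp) (ler_norm M)) _.
  have : (`|M| + 1) * d <= eps by rewrite mulrC -ler_pdivlMr.
  by have := normr_ge0 M; nra.
have small v : v <= - eps -> atan (v / d) <= - y.
  move=> ev; have := big (- v); rewrite mulNr atanN; lra.
have le_ts : atan ((s - u) / d) <= atan ((t - u) / d).
  by apply: le_atan; rewrite ler_pM2r ?invr_gt0 // lerD2r.
have u1 := atan_ltpi2 ((t - u) / d); have u2 := atan_gtNpi2 ((s - u) / d).
have u3 := atan_ltpi2 ((s - u) / d); have u4 := atan_gtNpi2 ((t - u) / d).
split.
- by apply/andP; split; lra.
- move=> /andP[h1 h2]; have b := big (t - u); have c := small (s - u).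
  have {}b : y <= atan ((t - u) / d) by apply: b; lra.
  have {}c : atan ((s - u) / d) <= - y by apply: c; lra.
  by move: b c; rewrite /y; lra.
- move=> /orP[h|h].
    have b : y <= atan ((s - u) / d) by apply: big; lra.
    by move: b; rewrite /y; lra.
  have c : atan ((t - u) / d) <= - y by apply: small; lra.
  by move: c; rewrite /y; lra.
Qed.

Lemma is_derive_sum_atan (d x : R) (zs : seq C) : 0 < d ->
  is_derive x 1 (fun x => \sum_(p <- zs) atan ((x - Re p) / d))
    (\sum_(p <- zs) poisson d x (Re p)).
Proof.
move=> d0; elim: zs => [|p zs IH].
  rewrite big_nil; apply: (near_eq_is_derive _ (is_derive_cst 0 x 1)).
  by near=> y; rewrite /cst big_nil.
have dl : is_derive x 1 (fun y : R => (y - Re p) / d) d^-1.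
  apply/is_derive_epsP => e e0; exists 1 => // w _.
  have -> : (w - Re p) / d - (x - Re p) / d - d^-1 * (w - x) = 0 by ring.
  by rewrite normr0 mulr_ge0 // ltW.
have da := @is_derive1_comp R atan (fun y : R => (y - Re p) / d) x _ _ (is_derive1_atan _) dl.
have := is_deriveD da IH; rewrite big_cons.
have -> : (1 + ((x - Re p) / d) ^+ 2)^-1 * d^-1 = poisson d x (Re p).
  have h : 0 < (x - Re p) ^+ 2 + d ^+ 2 by rewrite ltr_wpDl ?sqr_ge0 // exprn_gt0.
  rewrite /poisson -invfM; have -> : d / ((x - Re p) ^+ 2 + d ^+ 2) = (((x - Re p) ^+ 2 + d ^+ 2) / d)^-1 by rewrite invf_div.
  by congr (_^-1); field; rewrite gt_eqF.
apply: near_eq_is_derive; near=> y.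
by rewrite big_cons.
Unshelve. all: by end_near. Qed.

(** The difference of the two arctangent sums has the difference of the kernel sums as its
    derivative, so one application of the mean value theorem does the work of an integral. *)
Lemma sum_atan_diff (d s t B : R) (zs ws : seq C) : 0 < d -> s <= t ->
  (forall x, s <= x <= t ->
    `|\sum_(p <- zs) poisson d x (Re p) - \sum_(p <- ws) poisson d x (Re p)| <= B) ->
  `|\sum_(p <- zs) (atan ((t - Re p) / d) - atan ((s - Re p) / d)) -
    \sum_(p <- ws) (atan ((t - Re p) / d) - atan ((s - Re p) / d))| <= (t - s) * B.
Proof.
move=> d0 st HB.
pose T := (fun x => \sum_(p <- zs) atan ((x - Re p) / d)) \-
          (fun x => \sum_(p <- ws) atan ((x - Re p) / d)).
have dT (x : R) : is_derive x 1 T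
    (\sum_(p <- zs) poisson d x (Re p) - \sum_(p <- ws) poisson d x (Re p)).
  exact: (is_deriveB (is_derive_sum_atan x zs d0) (is_derive_sum_atan x ws d0)).
have [|x] := @MVT_segment _ T _ s t st (fun x _ => dT x).
  apply: continuous_in_subspaceT => x _; exact: is_derive_cont (dT x).
rewrite in_itv /= => xst TE.
have -> : \sum_(p <- zs) (atan ((t - Re p) / d) - atan ((s - Re p) / d)) -
    \sum_(p <- ws) (atan ((t - Re p) / d) - atan ((s - Re p) / d)) = T t - T s.
  by rewrite /T /= !sumrB; ring.
rewrite TE normrM mulrC [`|t - s|]ger0_norm ?subr_ge0 // ler_wpM2l ?subr_ge0 //.
exact: HB.
Qed.

Lemma count_sum_bounds (zs : seq C) (A : C -> R) (Q1 Q2 : pred C) (P th : R) :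
  0 <= th -> (forall p, p \in zs -> [/\ 0 <= A p <= P, Q1 p -> P - th <= A p & ~~ Q2 p -> A p <= th]) ->
  (P - th) * (count Q1 zs)%:R <= \sum_(p <- zs) A p <= P * (count Q2 zs)%:R + th * (size zs)%:R.
Proof.
move=> th0; elim: zs => [|p zs IH] H; first by rewrite big_nil !mulr0 addr0 lexx.
have /andP[h1 h2] := IH (fun q qs => H q (ltac:(by rewrite inE qs orbT))).
have [/andP[a0 a1] aQ1 aQ2] := H p (mem_head _ _).
rewrite big_cons /= -natr1 !natrD; apply/andP; split.
  by case: (Q1 p) aQ1 => [/(_ isT) hh|_]; rewrite ?mulr1n ?mulr0n; lra.
by case: (Q2 p) aQ2 => [_|/(_ isT) hh]; rewrite ?mulr1n ?mulr0n; lra.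
Qed.

End PoissonKernels.

Section ZeroComparison.
Variables (R : realType) (Y0 : \bar R) (Y1 : R).
Local Notation C := R[i].
Implicit Types (z w p : C) (zs ws : seq C) (e : C -> C) (N : nat).

Definition growth_bounded (H : nat -> C -> C) := forall x1 x2 y1 y2 : R, (y2%:E < Y0)%E ->
  exists2 K : R, 0 < K & forall N z, (0 < N)%N -> x1 <= Re z <= x2 -> y1 <= Im z <= y2 ->
    normc (H N z) <= expR (K * N%:R).

Definition lower_bounded_at (H : nat -> C -> C) := forall z : C, Im z <= - Y1 ->
  exists2 K : R, 0 < K & forall N, (0 < N)%N -> expR (- (K * N%:R)) <= normc (H N z).

(** The analytic data drawn from the two families of determinants. Above the axis the ratio is
    bounded on both sides. Below it [F] may vanish, so [cp_lower] bounds the ratio only from above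
    and [cp_ratio_point] gives a lower bound only at depth at least [Y1]. *)
Record comparable_pair (F G : nat -> C -> C) (gamma : nat -> R) : Prop := ComparablePair {
  cp_diffF : forall N z, lower_domain Y0 z -> cdiffable (F N) z ;
  cp_diffG : forall N z, lower_domain Y0 z -> cdiffable (G N) z ;
  cp_F0 : forall N z, lower_domain Y0 z -> 0 < Im z \/ Im z <= - Y1 -> F N z != 0 ;
  cp_G0 : forall N z, lower_domain Y0 z -> Im z != 0 -> G N z != 0 ;
  cp_gamma : forall N, 0 < gamma N ;
  cp_growthF : growth_bounded F ;
  cp_growthG : growth_bounded G ;
  cp_pointF : lower_bounded_at F ;
  cp_pointG : lower_bounded_at G ;
  cp_ratio_point : forall z, Im z <= - Y1 -> exists2 K : R, 0 < K & forall N,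
    expR (- (K * gamma N)) <= normc (F N z / G N z) ;
  cp_lower : forall x1 x2 y1 y2 : R, y2 < 0 -> exists2 K : R, 0 < K & forall N z,
    x1 <= Re z <= x2 -> y1 <= Im z <= y2 -> normc (F N z / G N z) <= expR (K * gamma N) ;
  cp_upper : forall x1 x2 y1 y2 : R, 0 < y1 -> (y2%:E < Y0)%E ->
    exists2 K : R, 0 < K & forall N z, x1 <= Re z <= x2 -> y1 <= Im z <= y2 ->
    expR (- (K * gamma N)) <= normc (F N z / G N z) <= expR (K * gamma N)
}.

Lemma lower_domain_Im z (y : R) : (y%:E < Y0)%E -> Im z <= y -> lower_domain Y0 z.
Proof. by move=> yY zy; rewrite /lower_domain /=; apply: le_lt_trans yY; rewrite lee_fin. Qed.

Lemma disc_box z c (r : R) : normc (z - c) <= r ->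
  Re c - r <= Re z <= Re c + r /\ Im c - r <= Im z <= Im c + r.
Proof.
move=> zr; have := le_trans (ler_normRe _) zr; have := le_trans (ler_normIm _) zr.
by rewrite ReB ImB !ler_norml => /andP[? ?] /andP[? ?]; split; apply/andP; split; lra.
Qed.

(** The disc has its centre below the zeros and may reach above the axis, up to height [sg < Y0]. On
    such a disc the logarithmic derivative of the zero-free part is Lipschitz with constant O(N), so
    it changes by O(N d) between x + i d and x - i d. *)
Lemma big_factorization (H : nat -> C -> C) (c : C) (r1 r2 r3 sg : R) :
  0 < r1 -> r1 < r2 -> r2 < r3 -> (sg%:E < Y0)%E -> Im c + r3 <= sg -> Im c <= - Y1 ->
  (forall N z, lower_domain Y0 z -> cdiffable (H N) z) -> growth_bounded H ->
  lower_bounded_at H -> exists2 K : R, 0 < K & forall N, (0 < N)%N ->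
  exists zs e, [/\ forall z, H N z = zprod zs z * e z,
    forall p, p \in zs -> normc (p - c) <= r2,
    forall z, lower_domain Y0 z -> cdiffable e z,
    forall z, normc (z - c) <= r2 -> e z != 0
  & (size zs)%:R <= K * N%:R /\ forall z w, normc (z - c) < r1 -> normc (w - c) < r1 ->
      normc (dlog e z - dlog e w) <= K * N%:R * normc (z - w)].
Proof.
move=> r10 r12 r23 sgY csg cY1 dH gH pH.
have [K K0 HK] := log_derivative_zeros r10 r12 r23.
have [K1 K10 HK1] := gH (Re c - r3) (Re c + r3) (Im c - r3) sg sgY.
have [K2 K20 HK2] := pH c cY1.
exists (K * (K1 + K2)); first by rewrite mulr_gt0 // addr_gt0.
move=> N N0; have NR : 0 < N%:R :> R by rewrite ltr0n.
have inD z : normc (z - c) <= r3 -> lower_domain Y0 z.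
  move=> /disc_box[_ /andP[_ h]]; apply: (lower_domain_Im sgY); lra.
have Hc : H N c != 0 by rewrite -normc_gt0; apply: lt_le_trans (HK2 N N0); exact: expR_gt0.
have r20 : 0 < r2 by lra.
have [zs [e [HE zr de e0]]] := zero_factorization r20 r23
  (fun z zr => dH N z (inD z (ltW zr))) Hc.
exists zs, e.
have M0 : 0 < (K1 + K2) * N%:R by rewrite mulr_gt0 // addr_gt0.
have h1 := mulr_gt0 K10 NR; have h2 := mulr_gt0 K20 NR.
have [|||sz lip] := HK c zs e ((K1 + K2) * N%:R) M0 zr _ e0.
- by move=> z zc; apply: de; apply: dH; apply: inD; exact: ltW.
- move=> z zc; rewrite -HE; have [b1 /andP[b2 b3]] := disc_box (ltW zc).
  apply: le_trans (HK1 N z N0 b1 _) _; first by rewrite b2 /=; lra.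
  rewrite ler_expR mulrDl; lra.
- rewrite -HE; apply: le_trans (HK2 N N0); rewrite ler_expR mulrDl; lra.
split => //; first by move=> z zD; apply: de; exact: dH.
rewrite -mulrA; split => // z w zc wc.
by have [_ ->] := lip w wc.
Qed.

Section Pair.
Variables (F G : nat -> C -> C) (gamma : nat -> R).
Hypothesis FG : comparable_pair F G gamma.

(** The disc of radius [d / 2] around x + i d stays at heights between [d / 2] and [2 * d], where F
    / G has neither zeros nor poles and is between exponentials of multiples of [gamma N]. The
    constant depends on [d]. *)
Lemma upper_estimate (s t d : R) : 0 < d -> ((2 * d)%:E < Y0)%E ->
  exists2 K : R, 0 < K & forall N (x : R), s <= x <= t ->
    normc (dlog (fun w => F N w / G N w) (x +i* d)) <= K * gamma N.
Proof.
move=> d0 dY; have r0 : 0 < d / 4 by rewrite divr_gt0.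
have r1 : d / 4 < d / 2 by rewrite ltr_pM2l //; lra.
have [K K0 HK] := log_derivative_bound r0 r1.
have d20 : 0 < d / 2 by rewrite divr_gt0.
have [K1 K10 HK1] := cp_upper FG (s - d) (t + d) d20 dY.
exists (K * K1); first by rewrite mulr_gt0.
move=> N x /andP[xs xt]; pose c : C := x +i* d.
have M0 : 0 < K1 * gamma N by rewrite mulr_gt0 // (cp_gamma FG).
have box z : normc (z - c) < d / 2 -> s - d <= Re z <= t + d /\ d / 2 <= Im z <= 2 * d.
  move=> /ltW /disc_box[/andP[h1 h2] /andP[h3 h4]]; rewrite /= in h1 h2 h3 h4.
  by split; apply/andP; split; lra.
have cc : normc (c - c) < d / 4 by rewrite subrr normc0.
have inD z : normc (z - c) < d / 2 -> lower_domain Y0 z /\ 0 < Im z.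
  by move=> /box[_ /andP[h1 h2]]; split; [exact: lower_domain_Im dY h2|lra].
rewrite -mulrA; apply: (HK (fun w => F N w / G N w) c _ M0 _ _ _ _ c cc).1.
- move=> w /inD[wD w0]; apply: cdiffable_div; first exact: cp_diffF FG _ _ wD.
    exact: cp_diffG FG _ _ wD.
  by apply: (cp_G0 FG) => //; rewrite gt_eqF.
- move=> w /inD[wD w0]; rewrite mulf_neq0 ?invr_eq0 //.
    by apply: (cp_F0 FG) => //; left.
  by apply: (cp_G0 FG) => //; rewrite gt_eqF.
- by move=> w /box[h1 h2]; have /andP[] := HK1 N w h1 h2.
- have [h1 h2] := box c (lt_trans cc r1).
  by have /andP[] := HK1 N c h1 h2.
Qed.

End Pair.

End ZeroComparison.

(* Seen from a centre far below the real axis, the circle of radius T - eta / 2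
   is flat enough to pass above every point of depth eta over the window. *)
Lemma deep_disc (R : realType) (Y1 L m d eta : R) : 0 <= L -> 0 < eta -> eta <= 1 / 8 ->
  4 * eta <= d -> d <= 1 -> 0 <= Y1 -> exists T q1 q2 q3 : R,
  [/\ [/\ 0 < q1, q1 < q2, q2 < q3 & q3 + eta / 4 <= T], 0 < T, Y1 <= T,
    forall x y : R, `|x - m| <= L -> - T <= y -> y <= - eta -> normc (x +i* y - (m +i* (- T))) <= q2
  & forall x : R, `|x - m| <= L -> normc (x +i* (- d) - (m +i* (- T))) < q1].
Proof.
move=> L0 eta0 eta8 etad d1 Y10.
(* Both inclusions reduce to comparing [L ^+ 2] with a multiple of [T * eta], up to terms in
   [eta ^+ 2]; hence a depth of order [L ^+ 2 / eta]. *)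
have [T [T1 TY TL]] : exists T : R, [/\ 1 <= T, Y1 <= T & L ^+ 2 + eta <= T * eta].
  have q0 : 0 <= L ^+ 2 / eta by rewrite divr_ge0 ?sqr_ge0 // ltW.
  exists (Y1 + L ^+ 2 / eta + 1); split; try by clear -q0 Y10; lra.
  rewrite !mulrDl mul1r divfK ?gt_eqF //.
  by have h := mulr_ge0 Y10 (ltW eta0); clear -h; lra.
have eta2 : eta ^+ 2 <= eta / 8.
  by rewrite expr2 mulrC [eta / 8]mulrC ler_pM2r //; clear -eta8; lra.
have geo (x y k r : R) : `|x - m| <= L -> - T <= y -> y <= - k -> 0 <= r ->
    L ^+ 2 + (T - k) ^+ 2 <= r ^+ 2 -> normc (x +i* y - (m +i* (- T))) <= r.
  move=> xm yT yk r0 h; rewrite -(ler_pXn2r (n := 2)) ?nnegrE ?normc_ge0 // sqr_normcE ReB ImB /=.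
  apply: le_trans h; rewrite opprK; apply: lerD.
    by rewrite -[(x - m) ^+ 2]real_normK ?num_real // ler_pXn2r ?nnegrE.
  by rewrite ler_pXn2r ?nnegrE //; clear -yT yk; lra.
exists T, (T - 3 / 4 * eta), (T - eta / 2), (T - eta / 4); split => //.
- by split; clear -T1 eta0 eta8; lra.
- by clear -T1; lra.
- move=> x y xm yT yeta; apply: (geo x y eta) => //; first by clear -T1 eta8; lra.
  have -> : (T - eta) ^+ 2 = T ^+ 2 - 2 * (T * eta) + eta ^+ 2 by ring.
  have -> : (T - eta / 2) ^+ 2 = T ^+ 2 - T * eta + eta ^+ 2 / 4 by field.
  by move: TL eta2 eta0; move: (T * eta) (eta ^+ 2) (T ^+ 2) (L ^+ 2) => u v w l; clear; lra.
- move=> x xm; apply: (@le_lt_trans _ _ (T - eta)); last by clear -eta0; lra.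
  apply: (geo x (- d) d) => //; [by clear -T1 d1; lra|by clear -T1 eta8; lra|].
  have h : (T - d) ^+ 2 <= (T - 4 * eta) ^+ 2.
    by rewrite ler_pXn2r ?nnegrE //; clear -T1 d1 etad eta0 eta8; lra.
  apply: le_trans (lerD (lexx _) h) _.
  have -> : (T - eta) ^+ 2 = T ^+ 2 - 2 * (T * eta) + eta ^+ 2 by ring.
  have -> : (T - 4 * eta) ^+ 2 = T ^+ 2 - 8 * (T * eta) + 16 * eta ^+ 2 by ring.
  have te : 0 <= L ^+ 2 by rewrite sqr_ge0.
  move: te TL eta2 eta0; move: (T * eta) (eta ^+ 2) (T ^+ 2) (L ^+ 2) => u v w l; clear; lra.
Qed.

(** [log_derivative_zeros] is applied to F / G on a deep disc, so the zeros of [F] in it number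
    O(gamma). That disc may stick out of the disc of radius [r2] on which [F] was factored, so these
    zeros form two lists: [z2], taken out of [zs] and described by [Q], and [z3], whose members are
    zeros of the cofactor [e]. *)
Lemma lower_estimate (R : realType) (Y0 : \bar R) (Y1 : R) (F G : nat -> R[i] -> R[i])
    (gamma : nat -> R) (c : R[i]) (r1 r2 s t L m d eta : R) :
  comparable_pair Y0 Y1 F G gamma -> r1 < r2 -> 0 < r1 ->
  0 <= L -> 0 < eta -> eta <= 1 / 8 -> 4 * eta <= d -> d <= 1 -> 0 <= Y1 ->
  (0 < Y0)%E ->
  (forall x : R, s <= x <= t -> `|x - m| <= L) ->
  (forall x : R, s <= x <= t -> normc (x +i* (- d) - c) < r1) ->
  exists2 K : R, 0 < K & forall N, (0 < N)%N -> forall (zs : seq R[i]) (e : R[i] -> R[i]) (ws : seq R[i]) (e2 : R[i] -> R[i]),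
    (forall z, F N z = zprod zs z * e z) -> (forall z, G N z = zprod ws z * e2 z) ->
    (forall z, lower_domain Y0 z -> cdiffable e z) ->
    (forall z, lower_domain Y0 z -> cdiffable e2 z) ->
    (forall z, normc (z - c) <= r2 -> e z != 0) ->
    exists Q : pred R[i], [/\ (count Q zs)%:R <= K * gamma N,
      forall p : R[i], p \in zs -> ~~ Q p -> `|Re p - m| <= L -> Im p <= 0 -> - Y1 <= Im p -> - eta <= Im p
    & forall x : R, s <= x <= t ->
      normc (\sum_(p <- zs | ~~ Q p) (x +i* (- d) - p)^-1 + dlog e (x +i* (- d))
        - (\sum_(p <- ws) (x +i* (- d) - p)^-1 + dlog e2 (x +i* (- d)))) <= K * gamma N].
Proof.
move=> FG r12 r10 L0 eta0 eta8 etad d1 Y10 Y00 xL xr1.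
have [T [q1 [q2 [q3 [[q10 q12 q23 q3e] T0 TY geo1 geo2]]]]] :=
  deep_disc m L0 eta0 eta8 etad d1 Y10.
pose c' : R[i] := m +i* (- T).
have q20 : 0 < q2 := lt_trans q10 q12.
have q3T : q3 < T by clear -q3e eta0; lra.
have q2T := lt_trans q23 q3T.
have inlow (z : R[i]) : normc (z - c') < T -> Im z < 0.
  by move=> h; have := le_lt_trans (ler_normIm _) h; rewrite ImB /= opprK ltr_norml => /andP[_ h']; clear -h'; lra.
have lowD (z : R[i]) : Im z < 0 -> lower_domain Y0 z.
  by move=> z0; apply: (lower_domain_Im Y00); exact: ltW.
have [K K0 HK] := log_derivative_zeros q10 q12 q23.
have eta40 : - (eta / 4) < 0 by rewrite oppr_lt0 divr_gt0.
have [K1 K10 HK1] := cp_lower FG (m - T) (m + T) (- (2 * T)) eta40.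
have c'Y : Im c' <= - Y1 by rewrite lerN2.
have [K2 K20 HK2] := cp_ratio_point FG c'Y.
pose B := K * (K1 + K2); have B0 : 0 < B by rewrite mulr_gt0 // addr_gt0.
pose k := (r2 - r1)^-1; have k0 : 0 < k by rewrite invr_gt0 subr_gt0.
exists (B + B * k); first by rewrite addr_gt0 // mulr_gt0.
move=> N N0 zs e ws e2 FE GE de de2 e0.
(* The zeros in the deep disc. By the choice of radii this includes those of depth at least [eta]
   over the window, and it may include shallower ones; only their number matters. *)
pose Q := fun p : R[i] => normc (p - c') <= q2.
pose z2 := [seq p <- zs | Q p]; pose z1 := [seq p <- zs | ~~ Q p].
have zE z : zprod zs z = zprod z2 z * zprod z1 z.
  rewrite -zprod_cat; apply: perm_big; rewrite perm_sym.
  exact/permPl/perm_filterC.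
pose f1 z := zprod z1 z * e z.
have FE1 z : F N z = zprod z2 z * f1 z by rewrite FE zE mulrA.
have df1 z : lower_domain Y0 z -> cdiffable f1 z.
  by move=> zD; apply: cdiffableM; [exact: cdiffable_zprod|exact: de].
have c'D : lower_domain Y0 c' by apply: lowD; rewrite /= oppr_lt0.
have Fc : F N c' != 0 by apply: (cp_F0 FG) => //; right.
have f1c : f1 c' != 0.
  by move: Fc; rewrite FE1 mulf_eq0 negb_or => /andP[].
have [z3 [e' [f1E z3r de' e'0]]] := zero_factorization q20 (lt_trans q23 q3T)
  (fun z zr => df1 z (lowD z (inlow z zr))) f1c.
have g0 : 0 < gamma N := cp_gamma FG N.
have M0 : 0 < (K1 + K2) * gamma N by rewrite mulr_gt0 // addr_gt0.
have G0 (z : R[i]) : Im z < 0 -> G N z != 0.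
  by move=> z0; apply: (cp_G0 FG); [exact: lowD|rewrite lt_eqF].
pose e3 z := e' z / G N z.
have de3 (z : R[i]) : Im z < 0 -> cdiffable e3 z.
  move=> z0; apply: cdiffable_div; last exact: G0.
    by apply/de'/df1/lowD.
  by apply: (cp_diffG FG); exact: lowD.
have RE z : zprod (z2 ++ z3) z * e3 z = F N z / G N z.
  by rewrite zprod_cat FE1 f1E /e3; ring.
have a1 p : p \in z2 ++ z3 -> normc (p - c') <= q2.
  by rewrite mem_cat mem_filter => /orP[/andP[]//|/z3r].
have a2 z : normc (z - c') < q3 -> cdiffable e3 z.
  by move=> h; apply/de3/inlow; exact: lt_trans h q3T.
have a3 z : normc (z - c') <= q2 -> e3 z != 0.
  move=> h; rewrite mulf_neq0 ?e'0 ?invr_eq0 //; apply/G0/inlow.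
  exact: le_lt_trans h q2T.
have h1 := mulr_gt0 K10 g0; have h2 := mulr_gt0 K20 g0.
have a4 z : normc (z - c') < q3 -> normc (zprod (z2 ++ z3) z * e3 z) <= expR ((K1 + K2) * gamma N).
  move=> h; rewrite RE; have [/andP[b1 b2] /andP[b3 b4]] := disc_box (ltW h).
  rewrite /= in b1 b2 b3 b4; apply: le_trans (HK1 N z _ _) _.
  - by clear -b1 b2 q3T; apply/andP; split; lra.
  - by clear -b3 b4 q3T q3e; apply/andP; split; lra.
  - by rewrite ler_expR mulrDl lerDl ltW.
have a5 : expR (- ((K1 + K2) * gamma N)) <= normc (zprod (z2 ++ z3) c' * e3 c').
  by rewrite RE; apply: le_trans (HK2 N); rewrite ler_expR lerN2 mulrDl lerDr ltW.
have [sz dl] := HK c' (z2 ++ z3) e3 _ M0 a1 a2 a3 a4 a5.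
move: sz; rewrite mulrA -/B size_cat natrD => sz.
have Bg : 0 < B * gamma N by rewrite mulr_gt0.
have Bkg : 0 < B * k * gamma N by rewrite mulr_gt0 // mulr_gt0.
have sz2 : (size z2)%:R <= B * gamma N by apply: le_trans sz; rewrite lerDl.
have sz3 : (size z3)%:R <= B * gamma N by apply: le_trans sz; rewrite lerDr.
exists Q; split.
- by rewrite -size_filter -/z2 mulrDl (le_trans sz2) // lerDl ltW.
- move=> p pzs /negP pQ pm p0 pY; rewrite leNgt; apply/negP => peta; apply: pQ.
  rewrite /Q; have -> : p = (Re p) +i* (Im p) by case: (p).
  apply: geo1 => //; last exact: ltW.
  by apply: le_trans pY; rewrite lerN2.
- move=> x xst; set zb := x +i* (- d).
  have zbI : Im zb < 0 by rewrite /= oppr_lt0 (lt_le_trans _ etad) // mulr_gt0.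
  have zbD := lowD zb zbI.
  have zbc' : normc (zb - c') < q1 by apply: geo2; exact: xL.
  have zbr1 : normc (zb - c) < r1 := xr1 x xst.
  have zbz1 : zb \notin z1.
    by rewrite mem_filter negb_and negbK /Q (ltW (lt_trans zbc' q12)).
  have ezb : e zb != 0 by apply: e0; rewrite ltW // (lt_trans zbr1).
  (* A member of [z3] is a zero of [e], hence outside the disc of radius [r2], whereas x - i d is
     inside that of radius [r1]. Each such term is thus bounded, and together they are O(gamma). *)
  have z3far p : p \in z3 -> r2 - r1 <= normc (zb - p).
    move=> pz3; have ep : e p = 0.
      have : f1 p = 0.
        by rewrite f1E zprod_root ?mul0r.
      have pz1 : p \notin z1 by rewrite mem_filter negb_and negbK /Q z3r.
      by move=> /eqP; rewrite mulf_eq0 (negbTE (zprod_neq0 pz1)) => /eqP.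
    have pr2 : r2 < normc (p - c).
      by rewrite ltNge; apply/negP => /e0; rewrite ep eqxx.
    have := ler_normcB (zb - c) (zb - p).
    have -> : zb - c - (zb - p) = p - c by ring.
    by clear -pr2 zbr1; lra.
  have zbz3 : zb \notin z3.
    by apply/negP => /z3far; rewrite subrr normc0 leNgt subr_gt0 r12.
  have e'zb : e' zb != 0 by apply: e'0; rewrite ltW // (lt_trans zbc').
  have d1E : dlog f1 zb = \sum_(p <- zs | ~~ Q p) (zb - p)^-1 + dlog e zb.
    rewrite dlogM ?zprod_neq0 //; [|exact: cdiffable_zprod|exact: de].
    by rewrite dlog_zprod // big_filter.
  have d2E : dlog f1 zb = \sum_(p <- z3) (zb - p)^-1 + dlog e' zb.
    have -> : f1 = (fun z => zprod z3 z * e' z) by apply/funext.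
    rewrite dlogM ?zprod_neq0 //; [|exact: cdiffable_zprod|exact/de'/df1].
    by rewrite dlog_zprod.
  have Gzb := G0 zb zbI.
  have d3E : dlog (G N) zb = \sum_(p <- ws) (zb - p)^-1 + dlog e2 zb.
    have GE' : G N = (fun z => zprod ws z * e2 z) by apply/funext.
    move: Gzb; rewrite GE mulf_eq0 negb_or => /andP[w0 e20].
    have zbws : zb \notin ws by apply: contra w0 => /zprod_root ->.
    rewrite GE' dlogM //; [|exact: cdiffable_zprod|exact: de2].
    by rewrite dlog_zprod.
  have d4E : dlog e3 zb = dlog e' zb - dlog (G N) zb.
    by rewrite dlog_div //; [exact/de'/df1|exact: (cp_diffG FG)].
  rewrite -d1E -d3E d2E -addrA -d4E.
  apply: le_trans (ler_normcD _ _) _; rewrite mulrDl addrC; apply: lerD.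
    by have [h _] := dl zb zbc'; rewrite mulrA in h.
  have : normc (\sum_(p <- z3) (zb - p)^-1) <= (size z3)%:R * k.
    apply: ler_normc_sum => p pz3; rewrite normcV lef_pV2 ?posrE ?subr_gt0 ?z3far //.
    by apply: lt_le_trans (z3far p pz3); rewrite subr_gt0.
  by move=> /le_trans; apply; rewrite mulrAC ler_pM2r.
Qed.

Section CountComparison.
Variables (R : realType) (Y0 : \bar R) (Y1 : R).
Local Notation C := R[i].
Implicit Types (z w p : C) (zs ws : seq C) (e : C -> C) (N : nat).

Lemma sum_poisson_bound (x d B : R) zs ws : 0 < d ->
  (forall p, p \in zs -> `|Im ((x +i* d - p)^-1 - (x +i* (- d) - p)^-1)
     + 2 * poisson d x (Re p)| <= 4 * d) ->
  (forall p, p \in ws -> Im p = 0) ->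
  normc (\sum_(p <- zs) ((x +i* d - p)^-1 - (x +i* (- d) - p)^-1)
    - \sum_(p <- ws) ((x +i* d - p)^-1 - (x +i* (- d) - p)^-1)) <= B ->
  `|\sum_(p <- zs) poisson d x (Re p) - \sum_(p <- ws) poisson d x (Re p)|
    <= B / 2 + 2 * d * (size zs)%:R.
Proof.
move=> d0 zsP wsP HB.
pose J p := (x +i* d - p)^-1 - (x +i* (- d) - p)^-1.
have ImS (s : seq C) : Im (\sum_(p <- s) J p) = \sum_(p <- s) Im (J p).
  by apply: (big_morph (@Im R) (@ImD R)).
have wE : \sum_(p <- ws) Im (J p) = - 2 * \sum_(p <- ws) poisson d x (Re p).
  rewrite mulr_sumr big_seq [RHS]big_seq; apply: eq_bigr => p pws.
  by rewrite /J poisson_Im ?wsP.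
have zE : `|\sum_(p <- zs) Im (J p) + 2 * \sum_(p <- zs) poisson d x (Re p)| <= (size zs)%:R * (4 * d).
  rewrite mulr_sumr -big_split /=.
  elim: (zs) zsP => [|p s IH] H; first by rewrite big_nil normr0 mul0r.
  have -> : (size (p :: s))%:R * (4 * d) = 4 * d + (size s)%:R * (4 * d) :> R.
    by rewrite [size _]/= -natr1; ring.
  rewrite big_cons.
  apply: le_trans (ler_normD _ _) (lerD _ _); first by apply: H; rewrite mem_head.
  by apply: IH => q qs; apply: H; rewrite inE qs orbT.
have := le_trans (ler_normIm _) HB; rewrite ImB !ImS wE.
move: zE; rewrite !ler_norml.
move: (\sum_(p <- zs) Im (J p)) (\sum_(p <- zs) poisson _ _ _) (\sum_(p <- ws) poisson _ _ _) => a b c'.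
by move=> /andP[h1 h2] /andP[h3 h4]; apply/andP; split; lra.
Qed.

Lemma ereal_gap : (0 < Y0)%E -> exists2 sg : R, 0 < sg & (sg%:E < Y0)%E.
Proof.
case: Y0 => [y| |] //=; last by exists 1; rewrite ?ltry.
rewrite lte_fin => y0; exists (y / 2); first by rewrite divr_gt0.
by rewrite lte_fin ltr_pdivrMr // ltr_pMr // ltr1n.
Qed.

Lemma dlog_factorization (h e : C -> C) zs z : (forall w, h w = zprod zs w * e w) ->
  cdiffable e z -> h z != 0 -> dlog h z = \sum_(p <- zs) (z - p)^-1 + dlog e z.
Proof.
move=> hE de hz; have -> : h = (fun w => zprod zs w * e w) by apply/funext.
move: hz; rewrite hE mulf_eq0 negb_or => /andP[zz0 ee0].
rewrite dlogM //; last exact: cdiffable_zprod.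
by rewrite dlog_zprod //; apply: contra zz0 => /zprod_root ->.
Qed.

(** [b1] and [b2] bound the logarithmic derivatives of the ratio above and below the axis, [b3] and
    [b4] the variation of the zero-free parts between the two points. The zeros in [Q] are missing
    from the lower sum only; in the upper one each contributes at most [1 / d], which gives
    [b5 / d]. *)
Lemma poisson_jump (x d eta b1 b2 b3 b4 b5 : R) zs ws (Q : pred C) (u u' v v' : C) :
  0 < d -> d <= 1 / 2 -> eta <= d ^+ 3 ->
  (forall p, p \in zs -> Im p <= 0) -> (forall p, p \in ws -> Im p = 0) ->
  (forall p, p \in zs -> ~~ Q p -> `|x - Re p| <= 1 -> - eta <= Im p) ->
  normc (\sum_(p <- zs) (x +i* d - p)^-1 + u - (\sum_(p <- ws) (x +i* d - p)^-1 + v)) <= b1 ->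
  normc (\sum_(p <- zs | ~~ Q p) (x +i* (- d) - p)^-1 + u'
    - (\sum_(p <- ws) (x +i* (- d) - p)^-1 + v')) <= b2 ->
  normc (u - u') <= b3 -> normc (v - v') <= b4 -> (count Q zs)%:R <= b5 ->
  `|\sum_(p <- zs | ~~ Q p) poisson d x (Re p) - \sum_(p <- ws) poisson d x (Re p)|
    <= (b1 + b5 / d + b2 + b3 + b4) / 2 + 2 * d * (size zs)%:R.
Proof.
move=> d0 d12 etad zs0 wsI near; set z := x +i* d; set zb := x +i* (- d).
move=> h1 h2 h3 h4 h5.
have SQ : normc (\sum_(p <- zs | Q p) (z - p)^-1) <= b5 / d.
  rewrite -big_filter; apply: (@le_trans _ _ ((size [seq p <- zs | Q p])%:R * d^-1)).
    apply: ler_normc_sum => p; rewrite mem_filter => /andP[_ /zs0 p0].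
    have h : d <= normc (z - p).
      apply: le_trans (ler_normIm _); rewrite ImB /=; apply: le_trans (ler_norm _).
      by clear -p0; lra.
    by rewrite normcV lef_pV2 ?posrE // (lt_le_trans d0).
  by rewrite size_filter ler_pM2r ?invr_gt0.
pose J p := (z - p)^-1 - (zb - p)^-1.
pose z1 := [seq p <- zs | ~~ Q p].
have XY : normc (\sum_(p <- z1) J p - \sum_(p <- ws) J p) <= b1 + b5 / d + b2 + b3 + b4.
  have -> : \sum_(p <- z1) J p - \sum_(p <- ws) J p =
    (\sum_(p <- zs) (z - p)^-1 + u - (\sum_(p <- ws) (z - p)^-1 + v))
    - \sum_(p <- zs | Q p) (z - p)^-1
    - (\sum_(p <- zs | ~~ Q p) (zb - p)^-1 + u' - (\sum_(p <- ws) (zb - p)^-1 + v'))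
    - (u - u') + (v - v').
    rewrite /J !sumrB /z1 !big_filter.
    have -> : \sum_(p <- zs) (z - p)^-1 =
      \sum_(p <- zs | Q p) (z - p)^-1 + \sum_(p <- zs | ~~ Q p) (z - p)^-1 by exact: (bigID Q).
    by clear; ring.
  apply: le_trans (ler_normcD _ _) (lerD _ h4).
  apply: le_trans (ler_normcB _ _) (lerD _ h3).
  apply: le_trans (ler_normcB _ _) (lerD _ h2).
  exact: le_trans (ler_normcB _ _) (lerD h1 SQ).
have pp p : p \in z1 -> `|Im (J p) + 2 * poisson d x (Re p)| <= 4 * d.
  rewrite mem_filter => /andP[pQ pzs]; apply: (@poisson_perturb _ x d eta p) => //.
    exact: zs0.
  exact: near.
rewrite -big_filter; apply: le_trans (sum_poisson_bound d0 pp wsI XY) _.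
by rewrite lerD2l ler_pM2l ?mulr_gt0 // ler_nat size_filter count_size.
Qed.

(** A disc with a deep centre is so flat at the top that it can rise above height [sg / 8] over the
    whole window while the larger disc of radius [r3] stays below [sg]. Here [T * sg >= 4 * L ^+ 2]
    is what flatness requires; the 1 in [L] makes room for zeros at horizontal distance up to 1 from
    the window. *)
Lemma disc_choice (s t eps cc sg : R) : s <= t -> 0 < eps -> 0 < cc -> 0 < sg -> 0 < Y1 ->
  exists (c : C) (r1 r2 r3 m L : R), [/\ [/\ 0 < r1, r1 < r2, r2 < r3, Im c + r3 <= sg & Im c <= - Y1],
    0 <= L, forall x : R, s - eps <= x <= t + eps -> `|x - m| <= L,
    forall x u : R, s <= x <= t -> `|x - u| <= 1 -> `|u - m| <= L
  & forall x y : R, `|x - m| <= L -> - (cc + 1) <= y -> y <= sg / 8 -> normc (x +i* y - c) < r1].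
Proof.
move=> st eps0 cc0 sg0 Y10.
pose m := (s + t) / 2; have [L L1 L0] : exists2 L : R, L = (t - s) / 2 + eps + 1 & 0 < L.
  by exists ((t - s) / 2 + eps + 1) => //; clear -st eps0; lra.
have q0 : 0 <= 4 * L ^+ 2 / sg by rewrite divr_ge0 ?mulr_ge0 ?sqr_ge0 // ltW.
have [T [T0 TY Tcc TL]] : exists T : R, [/\ 0 < T, Y1 <= T, cc + 1 <= T & 4 * L ^+ 2 + sg <= T * sg].
  exists (Y1 + cc + 4 * L ^+ 2 / sg + 1); split.
  - by move: q0; move: (_ / sg) => q; clear -Y10 cc0; lra.
  - by move: q0; move: (_ / sg) => q; clear -Y10 cc0; lra.
  - by move: q0; move: (_ / sg) => q; clear -Y10 cc0; lra.
  - rewrite !mulrDl mul1r divfK ?gt_eqF //.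
    by have := mulr_gt0 Y10 sg0; have := mulr_gt0 cc0 sg0; clear; lra.
exists (m +i* (- T)), (T + sg / 4), (T + sg / 2), (T + 3 / 4 * sg), m, L; split.
- by split; rewrite /=; clear -sg0 TY T0; lra.
- exact: ltW.
- by move=> x /andP[h1 h2]; rewrite ler_norml /m L1; clear -h1 h2; apply/andP; split; lra.
- move=> x u /andP[h1 h2]; rewrite !ler_norml /m L1 => /andP[h3 h4].
  by clear -h1 h2 h3 h4 eps0; apply/andP; split; lra.
- move=> x y xm yT yk.
  have r10 : 0 < T + sg / 4 by clear -T0 sg0; lra.
  rewrite -(ltr_pXn2r (n := 2)) ?nnegrE ?normc_ge0 ?(ltW r10) // sqr_normcE ReB ImB /=.
  rewrite opprK.
  have h1 : (x - m) ^+ 2 <= L ^+ 2.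
    by rewrite -[(x - m) ^+ 2]real_normK ?num_real // ler_pXn2r ?nnegrE // ltW.
  have h2 : (y + T) ^+ 2 <= (T + sg / 8) ^+ 2.
    by rewrite ler_pXn2r ?nnegrE //; clear -yT yk Tcc sg0 T0; lra.
  have h3 : 0 < sg * sg by rewrite mulr_gt0.
  apply: le_lt_trans (lerD h1 h2) _; clear -TL h3 sg0.
  have -> : (T + sg / 8) ^+ 2 = T ^+ 2 + T * sg / 4 + sg * sg / 64 by field.
  have -> : (T + sg / 4) ^+ 2 = T ^+ 2 + T * sg / 2 + sg * sg / 16 by field.
  have := sqr_ge0 L; move: TL h3; move: (T * sg) (L ^+ 2) (T ^+ 2) (sg * sg) => a b c' q.
  by lra.
Qed.

Lemma width_choice (A D d0 sg kappa cc : R) : 0 < A -> 0 <= D -> 0 < d0 -> 0 < sg -> 0 < kappa ->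
  0 < cc -> exists d eta : R, [/\ [/\ 0 < d, d <= d0, d <= sg / 16, d <= 1 / 2
      & D * (4 * A * d) <= kappa / 2],
    0 < eta, eta <= d ^+ 3, eta <= cc & eta <= 1 / 8 /\ 4 * eta <= d].
Proof.
move=> A0 D0 d00 sg0 kappa0 cc0.
have ts1 : 0 < 8 * A * (D + 1) by rewrite mulr_gt0 ?mulr_gt0 // ltr_wpDl.
have [d [dP dd0 dsg d12 dk]] : exists d : R, [/\ 0 < d, d <= d0, d <= sg / 16, d <= 1 / 2
    & d <= kappa / (8 * A * (D + 1))].
  exists (Num.min (Num.min d0 (sg / 16)) (Num.min (1 / 2) (kappa / (8 * A * (D + 1))))).
  by split; rewrite ?lt_min ?d00 ?divr_gt0 // ?ge_min ?lexx ?orbT.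
have [eta [eta0 etad etac]] : exists eta : R, [/\ 0 < eta, eta <= d ^+ 3 & eta <= cc].
  exists (Num.min (d ^+ 3) cc).
  by split; rewrite ?lt_min ?exprn_gt0 // ?ge_min ?lexx ?orbT.
have d3 : d ^+ 3 <= d / 4.
  have dd : d * d <= (1 / 2) * (1 / 2) by apply: ler_pM => //; exact: ltW.
  by rewrite exprS expr2 ler_pM2l //; clear -dd; lra.
exists d, eta; split => //; last by clear -d3 etad d12; lra.
split => //; move: dk; rewrite ler_pdivlMr // => dk.
by have := mulr_gt0 A0 dP; clear -dk; lra.
Qed.

End CountComparison.

(** Three errors, each at most [kappa / 2 * N]: the tails of the arctangents, the O(N d) terms and
    the O(gamma) terms. The order of choices is forced: the big disc fixes [KF] and [KG], these fix
    [th], then come [d] and [eta], on which [K1] and [K2] depend, and last the threshold for [N]. *)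
Lemma zero_comparison (R : realType) (Y0 : \bar R) (Y1 : R) (F G : nat -> R[i] -> R[i])
    (gamma : nat -> R) (s t eps cc kappa : R) :
  comparable_pair Y0 Y1 F G gamma -> (0 < Y0)%E -> 0 < Y1 ->
  (forall k : R, 0 < k -> exists N0, forall N, (N0 <= N)%N -> gamma N <= k * N%:R) ->
  s <= t -> 0 < eps -> 0 < cc -> 0 < kappa ->
  exists N0, forall N, (N0 <= N)%N -> exists (zs : seq R[i]) (e : R[i] -> R[i]) (ws : seq R[i]) (e2 : R[i] -> R[i]),
  [/\ (forall z, F N z = zprod zs z * e z) /\ (forall z, G N z = zprod ws z * e2 z),
    (forall z, lower_domain Y0 z -> cdiffable e z) /\ (forall z, lower_domain Y0 z -> cdiffable e2 z),
    forall z : R[i], s - eps <= Re z <= t + eps -> - cc <= Im z <= 0 -> e z != 0 /\ e2 z != 0,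
    (count (fun z : R[i] => (s + eps <= Re z <= t - eps) && (- cc <= Im z <= 0)) zs)%:R <=
    (count (fun z : R[i] => (s - eps <= Re z <= t + eps) && (Im z == 0)) ws)%:R + kappa * N%:R
  & (count (fun z : R[i] => (s + eps <= Re z <= t - eps) && (Im z == 0)) ws)%:R <=
    (count (fun z : R[i] => (s - eps <= Re z <= t + eps) && (- cc <= Im z <= 0)) zs)%:R + kappa * N%:R].
Proof.
move=> FG Y00 Y10 gamma_o st eps0 cc0 kappa0.
have [sg sg0 sgY] := ereal_gap Y00.
have [c [r1 [r2 [r3 [m [L [[r10 r12 r23 r3sg cY] L0 xL1 xL2 geo]]]]]]] :=
  disc_choice st eps0 cc0 sg0 Y10.
have xL (x : R) : s <= x <= t -> `|x - m| <= L.
  by move=> /andP[h1 h2]; apply: xL1; clear -h1 h2 eps0; apply/andP; split; lra.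
have [KF KF0 HKF] := big_factorization r10 r12 r23 sgY r3sg cY (cp_diffF FG) (cp_growthF FG) (cp_pointF FG).
have [KG KG0 HKG] := big_factorization r10 r12 r23 sgY r3sg cY (cp_diffG FG) (cp_growthG FG) (cp_pointG FG).
have A0 : 0 < KF + KG by rewrite addr_gt0.
(* A tail costs at most [th] per zero, and the two lists have at most [(KF + KG) * N] entries
   together. *)
have [th th0 thE] : exists2 th : R, 0 < th & th * (KF + KG) = kappa / 2.
  exists (kappa / (2 * (KF + KG))); first by rewrite divr_gt0 // mulr_gt0.
  by field; rewrite gt_eqF.
have [d0 d00 Hd0] := atan_window th0 eps0.
have ts0 : 0 <= t - s by rewrite subr_ge0.
have [d [eta [[dP dd0 dsg d12 dk] eta0 etad3 etacc [eta8 etad]]]] :=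
  width_choice A0 ts0 d00 sg0 kappa0 cc0.
have d1 : d <= 1 by clear -d12; lra.
have xr1 (x : R) : s <= x <= t -> normc (x +i* (- d) - c) < r1.
  by move=> xst; apply: geo; [exact: xL|clear -cc0 d12; lra|clear -sg0 dP; lra].
have xr1' (x : R) : s <= x <= t -> normc (x +i* d - c) < r1.
  by move=> xst; apply: geo; [exact: xL|clear -cc0 dP; lra|clear -sg0 dsg; lra].
have d2Y : ((2 * d)%:E < Y0)%E by apply: le_lt_trans sgY; rewrite lee_fin; clear -sg0 dsg; lra.
have [K1 K10 HK1] := upper_estimate FG s t dP d2Y.
have [K2 K20 HK2] := lower_estimate FG r12 r10 L0 eta0 eta8 etad d1 (ltW Y10) Y00 xL xr1.
have [Cg CgE Cg0] : exists2 Cg : R, Cg = K1 + K2 / d + K2 & 0 < Cg.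
  by exists (K1 + K2 / d + K2) => //; rewrite !addr_gt0 // divr_gt0.
(* [(t - s) * Cg] is the gamma term of the kernel estimate over the window; [4 * K2] accounts for
   the at most [K2 * gamma N] removed zeros, put back with weight [pi <= 4]. *)
have den : 0 < (t - s) * Cg + 4 * K2 + 1.
  by have := mulr_ge0 ts0 (ltW Cg0); clear -K20; lra.
have kg0 : 0 < kappa / (2 * ((t - s) * Cg + 4 * K2 + 1)) by rewrite divr_gt0 // mulr_gt0.
have [N1 HN1] := gamma_o _ kg0.
exists N1.+1 => N N1N; have N0 : (0 < N)%N by exact: leq_trans N1N.
have NR : 0 < N%:R :> R by rewrite ltr0n.
have g0 : 0 < gamma N := cp_gamma FG N.
have gk : ((t - s) * Cg + 4 * K2) * gamma N <= kappa / 2 * N%:R.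
  have := ler_wpM2l (ltW den) (HN1 N (ltnW N1N)); rewrite mulrA.
  rewrite (_ : _ * (kappa / _) = kappa / 2); last by clear -den; field; rewrite gt_eqF.
  by move: g0; clear; lra.
have [zs [e [FE zr de e0 [szF lipF]]]] := HKF N N0.
have [ws [e2 [GE wr de2 e20 [szG lipG]]]] := HKG N N0.
have [Q [QK Qeta Qest]] := HK2 N N0 zs e ws e2 FE GE de de2 e0.
have inD (z : R[i]) : normc (z - c) <= r2 -> lower_domain Y0 z.
  move=> /disc_box[_ /andP[_ h]]; apply: (lower_domain_Im sgY).
  by clear -h r3sg r23; lra.
have zsI p : p \in zs -> - Y1 <= Im p /\ Im p <= 0.
  move=> pzs; have pD := inD p (zr p pzs).
  have Fp : F N p = 0 by rewrite FE zprod_root ?mul0r.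
  have F0 := cp_F0 FG N pD; split; rewrite leNgt; apply/negP => h.
    by have := F0 (or_intror (ltW h)); rewrite Fp eqxx.
  by have := F0 (or_introl h); rewrite Fp eqxx.
have wsI p : p \in ws -> Im p = 0.
  move=> pws; have pD := inD p (wr p pws).
  have Gp : G N p = 0 by rewrite GE zprod_root ?mul0r.
  by apply/eqP; apply: contraT => /(cp_G0 FG N pD); rewrite Gp eqxx.
pose z1 := [seq p <- zs | ~~ Q p].
have Sx (x : R) : s <= x <= t ->
    `|\sum_(p <- z1) poisson d x (Re p) - \sum_(p <- ws) poisson d x (Re p)|
    <= Cg * gamma N + 4 * (KF + KG) * d * N%:R.
  move=> xst; pose z : R[i] := x +i* d; pose zb : R[i] := x +i* (- d).
  have zc : normc (z - c) < r1 := xr1' x xst.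
  have zbc : normc (zb - c) < r1 := xr1 x xst.
  have zD : lower_domain Y0 z by apply: inD; exact: ltW (lt_trans zc r12).
  have Fz : F N z != 0 by apply: (cp_F0 FG) => //; left.
  have Gz : G N z != 0 by apply: (cp_G0 FG) => //; rewrite /= gt_eqF.
  have U1 : normc (dlog (fun w => F N w / G N w) z) <= K1 * gamma N := HK1 N x xst.
  have zzb : normc (z - zb) = 2 * d.
    have -> : z - zb = 'i * (2 * d)%:C by apply: complexP; rewrite /=; ring.
    by rewrite normcM normc_i mul1r ger0_normcr // mulr_ge0 // ltW.
  have l1 := lipF z zb zc zbc; have l2 := lipG z zb zc zbc; rewrite zzb in l1 l2.
  have U3 : normc (\sum_(p <- zs) (z - p)^-1 + dlog e z
      - (\sum_(p <- ws) (z - p)^-1 + dlog e2 z)) <= K1 * gamma N.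
    rewrite -(dlog_factorization FE (de z zD) Fz) -(dlog_factorization GE (de2 z zD) Gz).
    rewrite -dlog_div //; [exact: (cp_diffF FG)|exact: (cp_diffG FG)].
  have near p : p \in zs -> ~~ Q p -> `|x - Re p| <= 1 -> - eta <= Im p.
    by move=> pzs pQ xp; have [p1 p0] := zsI p pzs; apply: Qeta => //; exact: xL2 xp.
  have := poisson_jump dP d12 etad3 (fun p pzs => (zsI p pzs).2) wsI near U3 (Qest x xst) l1 l2 QK.
  rewrite -big_filter => /le_trans; apply.
  have g1 := mulr_gt0 Cg0 g0.
  have g2 : 0 < d * (KG * N%:R) by rewrite mulr_gt0 // mulr_gt0.
  have g3 : d * (size zs)%:R <= d * (KF * N%:R) by rewrite ler_pM2l.
  have CE : Cg * gamma N = K1 * gamma N + K2 * gamma N / d + K2 * gamma N.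
    by rewrite CgE !mulrDl [K2 / d * _]mulrAC.
  have g4 : 0 < d * (KF * N%:R) by rewrite mulr_gt0 // mulr_gt0.
  move: CE g1 g2 g3 g4; move: (Cg * _) (K2 * _) (K2 * _ / d) (K1 * _) (size zs)%:R => y1 y2 y3 y4 y5.
  by clear; lra.
have := sum_atan_diff dP st Sx.
have pi2 := @pi_ge2 R; have pi4 : pi <= 4 :> R.
  by have := @pihalf_lt2 R; rewrite ltr_pdivrMr // => /ltW; rewrite -natrM.
pose at_ (p : R[i]) : R := atan ((t - Re p) / d) - atan ((s - Re p) / d).
have atP (p : R[i]) : [/\ 0 <= at_ p <= pi, (s + eps <= Re p <= t - eps) -> pi - th <= at_ p
    & ~~ (s - eps <= Re p <= t + eps) -> at_ p <= th].
  have [h1 h2 h3] := Hd0 d s t (Re p) dP dd0 st; split => //.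
  by rewrite negb_and -!ltNge.
pose Q1 (p : R[i]) := s + eps <= Re p <= t - eps; pose Q2 (p : R[i]) := s - eps <= Re p <= t + eps.
have /andP[b1 b2] := @count_sum_bounds R z1 at_ Q1 Q2 pi th (ltW th0) (fun p _ => atP p).
have /andP[b3 b4] := @count_sum_bounds R ws at_ Q1 Q2 pi th (ltW th0) (fun p _ => atP p).
rewrite -/(at_ _); have -> : \sum_(p <- z1) (atan ((t - Re p) / d) - atan ((s - Re p) / d)) = \sum_(p <- z1) at_ p by [].
have -> : \sum_(p <- ws) (atan ((t - Re p) / d) - atan ((s - Re p) / d)) = \sum_(p <- ws) at_ p by [].
rewrite ler_norml => /andP[b5 b6].
have thA : th * ((size z1)%:R + (size ws)%:R) <= kappa / 2 * N%:R.
  have sz1 : (size z1)%:R <= KF * N%:R.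
    by apply: le_trans szF; rewrite ler_nat size_filter count_size.
  by rewrite -thE -mulrA ler_pM2l // mulrDl lerD.
have dkN : (t - s) * (4 * (KF + KG) * d) * N%:R <= kappa / 2 * N%:R by rewrite ler_pM2r.
have cQ : (count Q zs)%:R <= K2 * gamma N by [].
have cle (P P' : pred R[i]) (s' : seq R[i]) : (forall p, p \in s' -> P p -> P' p) ->
    (count P s')%:R <= (count P' s')%:R :> R.
  move=> H; rewrite ler_nat; elim: s' H => //= p s' IH H.
  rewrite leq_add ?IH // => [|q qs]; last by apply: H; rewrite inE qs orbT.
  by have := H p (mem_head _ _); case: (P p) => // ->.
(* The three errors add up to [3 / 2 * kappa * N], and [pi >= 2] absorbs the factor. *)
have fin (y : R) : pi * y <= 3 / 2 * kappa * N%:R -> y <= kappa * N%:R.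
  move=> h; rewrite leNgt; apply/negP => ky; have kN := mulr_gt0 kappa0 NR.
  have : 2 * y <= pi * y by rewrite ler_pM2r //; clear -ky kN; lra.
  by clear -h ky kN; lra.
exists zs, e, ws, e2; split => //.
- move=> z zx /andP[zy1 zy2]; have zc : normc (z - c) <= r2.
    apply: ltW; apply: lt_trans r12; have -> : z = (Re z) +i* (Im z) by case: (z).
    by apply: geo; [exact: xL1|clear -zy1; lra|clear -zy2 sg0; lra].
  by split; [exact: e0|exact: e20].
- have n1 : (count (fun z : R[i] => (s + eps <= Re z <= t - eps) && (- cc <= Im z <= 0)) zs)%:R
     <= (count Q1 z1)%:R + (count Q zs)%:R :> R.
    apply: (@le_trans _ _ (count Q1 zs)%:R); first by apply: cle => p _ /andP[].
    rewrite -natrD ler_nat /z1 count_filter -count_predUI.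
    apply: leq_trans (leq_addr _ _); apply: sub_count => p /=.
    by case: (Q p); rewrite ?orbT ?andbT // orbF.
  have n2 : (count Q2 ws)%:R <= (count (fun z : R[i] => (s - eps <= Re z <= t + eps) && (Im z == 0)) ws)%:R :> R.
    by apply: cle => p /wsI p0 pQ; rewrite /= p0 eqxx andbT.
  have w1 : th * (count Q1 z1)%:R <= th * (size z1)%:R.
    by rewrite ler_pM2l // ler_nat count_size.
  have w2 : pi * (count Q zs)%:R <= 4 * (count Q zs)%:R :> R by rewrite ler_wpM2r.
  have w3 : pi * (count Q2 ws)%:R <= pi * (count (fun z : R[i] => (s - eps <= Re z <= t + eps) && (Im z == 0)) ws)%:R :> R.
    by rewrite ler_wpM2l // pi_ge0.
  rewrite -lerBlDl; apply: (le_trans (lerB n1 (lexx _))).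
  apply: fin; move: b1 b4 b6 w1 w2 w3 thA dkN gk cQ.
  by clear; lra.
- have n1 : (count (fun z : R[i] => (s + eps <= Re z <= t - eps) && (Im z == 0)) ws)%:R <= (count Q1 ws)%:R :> R.
    by apply: cle => p _ /andP[].
  have n2 : (count Q2 z1)%:R <= (count (fun z : R[i] => (s - eps <= Re z <= t + eps) && (- cc <= Im z <= 0)) zs)%:R :> R.
    rewrite /z1 count_filter; apply: cle => p pzs /= /andP[pQ2 pQ].
    have [p1 p0] := zsI p pzs; rewrite p0 andbT; apply/andP; split => //.
    apply: (@le_trans _ _ (- eta)); first by rewrite lerN2.
    by apply: Qeta => //; exact: xL1.
  have w1 : th * (count Q1 ws)%:R <= th * (size ws)%:R.
    by rewrite ler_pM2l // ler_nat count_size.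
  have w3 : pi * (count Q2 z1)%:R <= pi * (count (fun z : R[i] => (s - eps <= Re z <= t + eps) && (- cc <= Im z <= 0)) zs)%:R :> R.
    by rewrite ler_wpM2l // pi_ge0.
  rewrite -lerBlDl; apply: (le_trans (lerB n1 (lexx _))).
  have K2g := mulr_gt0 K20 g0.
  apply: fin; move: b2 b3 b5 w1 w3 thA dkN gk K2g.
  by clear; lra.
Qed.

(** * Resolvents and determinant ratios *)

Section MatrixBounds.
Variable R : realType.
Local Notation C := R[i].

Lemma vnorm_unit_inv n (A : 'M[C]_n) (k : R) : 0 < k ->
  (forall v : 'cV[C]_n, k * vnorm v <= vnorm (A *m v)) ->
  A \in unitmx /\ forall v : 'cV[C]_n, vnorm (invmx A *m v) <= k^-1 * vnorm v.
Proof.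
move=> k0 HA; have uA : A \in unitmx.
  rewrite -unitmx_tr -row_free_unit; apply: inj_row_free => v vA.
  apply: trmx_inj; rewrite trmx0; apply: vnorm_eq0; apply/eqP.
  rewrite eq_le vnorm_ge0 andbT -(ler_pM2l k0) mulr0.
  apply: le_trans (HA _) _; rewrite -[A]trmxK -trmx_mul vA trmx0.
  by rewrite -[0](scale0r 0) vnormZ normc0 mul0r.
split=> // v; rewrite ler_pdivlMl //; apply: le_trans (HA _) _.
by rewrite mulmxA mulmxV // mul1mx.
Qed.

Lemma normc_det_le n (A : 'M[C]_n) (a : R) : 1 <= a ->
  (forall v : 'cV[C]_n, vnorm (A *m v) <= a * vnorm v) -> normc (\det A) <= a ^+ n.
Proof.
move=> a1 HA; have D0 (v : 'cV[C]_n) : vnorm ((0 : 'M[C]_n) *m v) <= 0 * vnorm v.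
  by rewrite mul0mx mul0r -[0](scale0r 0) vnormZ normc0 mul0r.
have := det_perturbation 0 a1 (lexx 0) HA D0.
by rewrite mul0mx addr0 mul0r expR0 mulr1.
Qed.

Lemma normc_det_ratio n (A B D : 'M[C]_n) (b : R) : A \in unitmx -> 0 <= b ->
  (forall v : 'cV[C]_n, vnorm (invmx A *m v) <= b * vnorm v) ->
  B = A + D \/ B = A - D -> normc (\det B / \det A) <= expR (b * trnorm D).
Proof.
move=> uA b0 HA BE; have dA : \det A != 0 by rewrite -unitfE -unitmxE.
have one1 (v : 'cV[C]_n) : vnorm ((1%:M : 'M[C]_n) *m v) <= 1 * vnorm v by rewrite mul1mx mul1r.
have [X [XE HX]] : exists X : 'M[C]_n, B = A *m (1%:M + X *m D) /\
    forall v : 'cV[C]_n, vnorm (X *m v) <= b * vnorm v.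
  case: BE => ->; [exists (invmx A)|exists (- invmx A)]; split.
  - by rewrite mulmxDr mulmx1 mulmxA mulmxV // mul1mx.
  - exact: HA.
  - by rewrite mulmxDr mulmx1 mulNmx mulmxN mulmxA mulmxV // mul1mx.
  - by move=> v; rewrite mulNmx vnormN; exact: HA.
rewrite XE det_mulmx mulrAC divff // mul1r.
by have := det_perturbation D (lexx 1) b0 one1 HX; rewrite expr1n mul1r.
Qed.

Lemma det_sub1 n (A : 'M[C]_n) : \det (A - 1%:M) = (-1) ^+ n * \det (1%:M - A).
Proof. by rewrite -[in LHS]opprB -scaleN1r detZ. Qed.

Lemma normc_det_sub1 n (A : 'M[C]_n) : normc (\det (A - 1%:M)) = normc (\det (1%:M - A)).
Proof. by rewrite det_sub1 normcM normcX normcN normc1 expr1n mul1r. Qed.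

Lemma unitmx_sub1 n (A : 'M[C]_n) : (1%:M - A \in unitmx) = (\det (A - 1%:M) != 0).
Proof. by rewrite unitmxE unitfE det_sub1 mulf_eq0 signr_eq0. Qed.

Lemma vnorm_sub1 n (A : 'M[C]_n) (a : R) : (forall v : 'cV[C]_n, vnorm (A *m v) <= a * vnorm v) ->
  forall v : 'cV[C]_n, vnorm ((1%:M - A) *m v) <= (1 + a) * vnorm v.
Proof.
move=> HA v; rewrite mulmxBl mul1mx mulrDl mul1r.
by apply: le_trans (ler_vnormD _ _) _; rewrite vnormN lerD2l.
Qed.

Lemma normc_div_det_sub1 n (A B : 'M[C]_n) :
  normc (\det (A - 1%:M) / \det (B - 1%:M)) = normc (\det (1%:M - A) / \det (1%:M - B)).
Proof. by rewrite !normcM !normcV !normc_det_sub1. Qed.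

Lemma rectangle_compact (x1 x2 y1 y2 : R) :
  compact [set z : C | x1 <= Re z <= x2 /\ y1 <= Im z <= y2].
Proof.
have -> : [set z : C | x1 <= Re z <= x2 /\ y1 <= Im z <= y2] =
    [set p.1 +i* p.2 | p in `[x1, x2] `*` `[y1, y2]].
  apply/seteqP; split=> [[x y] /= [h1 h2]|_ [[x y] [/= h1 h2] <-]].
    by exists (x, y) => //; split; rewrite /= in_itv.
  by move: h1 h2; rewrite !in_itv.
apply: continuous_compact; last by apply: compact_setX; exact: segment_compact.
apply: continuous_subspaceT => -[x y] /=; apply/cvgrPdist_lt => e e0.
have eE : e = (Re e)%:C by rewrite RRe_real // realE ltW.
have e2 : 0 < Re e / 2 by rewrite divr_gt0 // -ltcR -eE.
near=> p; rewrite normC_E eE ltcR.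
apply: le_lt_trans (ler_normcReIm _) _; rewrite ReB ImB /= (splitr (Re e)).
apply: ltrD.
- near: p; exists (ball x (Re e / 2), setT); last by move=> [u v] [].
  by split; [exact: nbhsx_ballx|exact: filterT].
- near: p; exists (setT, ball y (Re e / 2)); last by move=> [u v] [].
  by split; [exact: filterT|exact: nbhsx_ballx].
Unshelve. all: by end_near.
Qed.

End MatrixBounds.

Section ResolventBounds.
Variables (R : realType) (Y0 : \bar R) (Y0_gt0 : (0 < Y0)%E) (d : nat -> nat).
Variables (U V : forall N : nat, R[i] -> 'M[R[i]]_(d N)) (gamma : nat -> R).
Local Notation C := R[i].

Hypothesis H1 : hypothesis1 Y0 U.
Hypothesis H2 : hypothesis2 Y0 U V gamma.
Hypothesis H3 : hypothesis3 Y0 U V gamma.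

Lemma lower_domain_le0 (z : C) : Im z <= 0 -> lower_domain Y0 z.
Proof. exact: lower_domain_Im. Qed.

(* Off the real axis V expands or contracts strictly, so 1 - V is coercive. *)
Lemma reference_resolvent (K : set C) (y : R) : compact K -> K `<=` lower_domain Y0 -> 0 < y ->
  (forall z, K z -> y <= `|Im z|) ->
  exists2 b : R, 0 < b & forall N z, K z -> 1%:M - V N z \in unitmx /\
    forall v : 'cV[C]_(d N), vnorm (invmx (1%:M - V N z) *m v) <= b * vnorm v.
Proof.
move=> cK KD y0 Ky; have [c c0 Hc] := expansion_bound H2 cK KD.
have cy : 0 < c * y by rewrite mulr_gt0.
have cy1 : 0 < 1 + c * y by rewrite addr_gt0.
have k0 : 0 < c * y / (1 + c * y) by rewrite divr_gt0.
exists (c * y / (1 + c * y))^-1; first by rewrite invr_gt0.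
move=> N z Kz; apply: vnorm_unit_inv => // v.
have [Hp Hn] := Hc N z Kz; have yz := Ky z Kz.
have qE (t : R) : y <= t -> (1 + c * t)^-1 <= (1 + c * y)^-1.
  move=> yt; rewrite lef_pV2 ?posrE ?lerD2l ?ler_pM2l //.
  by apply: lt_le_trans cy1 _; rewrite lerD2l ler_pM2l.
rewrite mulmxBl mul1mx.
have [z0|z0|z0] := ltgtP 0 (Im z); last by move: yz; rewrite -z0 normr0 leNgt y0.
- have h3 := ler_vnormB v (V N z *m v).
  have h1 := vnorm_mul_opnorm (V N z) v.
  have h2 : opnorm (V N z) * vnorm v <= (1 + c * y)^-1 * vnorm v.
    apply: ler_wpM2r; first exact: vnorm_ge0.
    by apply: le_trans (Hp z0) (qE _ _); rewrite -(gtr0_norm z0).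
  have -> : c * y / (1 + c * y) = 1 - (1 + c * y)^-1.
    by field; rewrite gt_eqF.
  rewrite mulrBl mul1r; apply: le_trans h3.
  by rewrite lerD2l lerN2; exact: le_trans h1 h2.
- have uV := reference_unit H2 N (KD z Kz).
  have := ler_vnormB (V N z *m v) v; rewrite -[vnorm (_ - v)]vnormN opprB.
  have := vnorm_mul_opnorm (invmx (V N z)) (V N z *m v).
  rewrite mulmxA mulVmx // mul1mx.
  have : opnorm (invmx (V N z)) * vnorm (V N z *m v) <= (1 + c * y)^-1 * vnorm (V N z *m v).
    apply: ler_wpM2r; first exact: vnorm_ge0.
    by apply: le_trans (Hn z0) (qE _ yz).
  have v0 := vnorm_ge0 v.
  move=> h1 h2 h3.
  have h4 : (1 + c * y) * vnorm v <= vnorm (V N z *m v).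
    by rewrite -ler_pdivlMl //; exact: le_trans h2 h1.
  have h5 : c * y / (1 + c * y) * vnorm v <= c * y * vnorm v.
    by rewrite ler_wpM2r // ler_pdivrMr // ler_peMr ?(ltW cy) // lerDl ltW.
  apply: le_trans h5 (le_trans _ h3).
  by rewrite lerBrDl -[X in X + _]mul1r -mulrDl.
Qed.

Lemma trnorm_bound_pos (K : set C) : compact K -> K `<=` lower_domain Y0 ->
  exists2 k : R, 0 < k & forall N z, K z -> trnorm (U N z - V N z) <= k * gamma N.
Proof.
move=> cK KD; have [k Hk] := trnorm_bound H2 cK KD.
exists (`|k| + 1); first by rewrite ltr_wpDl.
move=> N z Kz; apply: le_trans (Hk N z Kz) _.
rewrite ler_pM2r ?(gamma_gt0 H2) //; apply: le_trans (ler_norm k) _.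
by rewrite lerDl.
Qed.

Lemma gamma_small_eps (k : R) : 0 < k -> exists N0, forall N, (N0 <= N)%N -> gamma N <= k * N%:R.
Proof.
move=> k0; have /eqoP/(_ _ k0) := gamma_small H3.
move=> [N0 _ HN]; exists N0 => N /HN /=.
by rewrite !ger0_norm // ltW // (gamma_gt0 H2).
Qed.

(** The indices below the threshold are finitely many, and for them [gamma N] is at most the sum of
    all such values. *)
Lemma gamma_linear : exists2 k : R, 0 < k & forall N, (0 < N)%N -> gamma N <= k * N%:R.
Proof.
have [N0 HN] := gamma_small_eps ltr01.
have S0 : 0 <= \sum_(i < N0) gamma i by apply: sumr_ge0 => i _; exact: ltW (gamma_gt0 H2 i).
exists (1 + \sum_(i < N0) gamma i); first by rewrite ltr_wpDr.
move=> N N1; have N1R : 1 <= N%:R :> R by rewrite ler1n.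
case: (leqP N0 N) => [/HN h|h].
  by apply: le_trans h _; rewrite ler_wpM2r // lerDl.
apply: (@le_trans _ _ (\sum_(i < N0) gamma i)).
  rewrite (bigD1 (Ordinal h)) //= lerDl; apply: sumr_ge0 => i _.
  exact: ltW (gamma_gt0 H2 i).
by apply: (@le_trans _ _ (1 + \sum_(i < N0) gamma i)); rewrite ?lerDr // ler_peMr // addr_ge0.
Qed.

End ResolventBounds.

Section DeterminantPair.
Variables (R : realType) (Y0 : \bar R) (Y0_gt0 : (0 < Y0)%E) (d : nat -> nat).
Variables (U V : forall N : nat, R[i] -> 'M[R[i]]_(d N)) (gamma : nat -> R).
Local Notation C := R[i].

Hypothesis U_holo : forall N, holomorphic_mx Y0 (U N).
Hypothesis H1 : hypothesis1 Y0 U.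
Hypothesis H2 : hypothesis2 Y0 U V gamma.
Hypothesis H3 : hypothesis3 Y0 U V gamma.

Let F N z := \det (U N z - 1%:M).
Let G N z := \det (V N z - 1%:M).

Lemma rectangle_lower_domain (x1 x2 y1 y2 : R) : (y2%:E < Y0)%E ->
  [set z : C | x1 <= Re z <= x2 /\ y1 <= Im z <= y2] `<=` lower_domain Y0.
Proof. by move=> y2Y z [_ /andP[_]]; exact: lower_domain_Im. Qed.

Lemma exp_dimension (a : R) : 1 <= a -> exists2 K : R, 0 < K &
  forall N, a ^+ d N <= expR (K * N%:R).
Proof.
move=> a1; have [D0 [D1 [D00 D10 HD]]] := dimension_bound H3.
have la : 0 <= ln a by rewrite ln_ge0.
exists (D1 * ln a + 1); first by rewrite ltr_wpDl // mulr_ge0 // ltW.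
move=> N; have a0 : 0 < a by apply: lt_le_trans a1.
rewrite -[a in a ^+ _](@lnK R) ?posrE // -expRM_natl ler_expR.
have /andP[_ h] := HD N; have := ler_wpM2r la h.
by have : 0 <= N%:R :> R by [rewrite ler0n]; move=> h1 h2; rewrite mulrDl mul1r -[D1 * _ * _]mulrAC (le_trans h2) // lerDl.
Qed.

Lemma det_reference_neq0 N (z : C) : lower_domain Y0 z -> Im z != 0 -> G N z != 0.
Proof.
move=> zD z0; have KD : [set z] `<=` lower_domain Y0 by move=> _ ->.
have yz : 0 < `|Im z| by rewrite normr_gt0.
have [b _ /(_ N z erefl)[uV _]] := reference_resolvent H2 (@compact_set1 _ z) KD yz
  (fun w wz => ltac:(by rewrite wz)).
by rewrite /G -unitmx_sub1.
Qed.

Lemma growth_opnorm (x1 x2 y1 y2 : R) : (y2%:E < Y0)%E -> exists2 a : R, 1 <= a &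
  forall N z, x1 <= Re z <= x2 -> y1 <= Im z <= y2 ->
  forall v : 'cV[C]_(d N), vnorm ((1%:M - U N z) *m v) <= a * vnorm v.
Proof.
move=> y2Y; have KD := @rectangle_lower_domain x1 x2 y1 y2 y2Y.
have [C1 C10 HC] := opnorm_bound H1 (rectangle_compact (y1 := y1) (y2 := y2)) KD.
exists (1 + C1); first by rewrite lerDl ltW.
move=> N z zx zy v; apply: vnorm_sub1 => w; apply: le_trans (vnorm_mul_opnorm _ _) _.
by rewrite ler_wpM2r ?vnorm_ge0 // HC.
Qed.

Lemma det_growth : growth_bounded Y0 F.
Proof.
move=> x1 x2 y1 y2 y2Y; have [a a1 Ha] := growth_opnorm x1 x2 y1 y2Y.
have [K K0 HK] := exp_dimension a1; exists K => // N z _ zx zy.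
rewrite /F normc_det_sub1; apply: le_trans (HK N).
exact: normc_det_le (Ha N z zx zy).
Qed.

(** Below the axis [expansion_bound] controls the inverse of V and not V itself, so 1 - V is treated
    as a trace-norm perturbation of 1 - U, at the price of a factor exp (C gamma_N), which is at
    most exponential in N. *)
Lemma det_reference_growth : growth_bounded Y0 G.
Proof.
move=> x1 x2 y1 y2 y2Y; have [a a1 Ha] := growth_opnorm x1 x2 y1 y2Y.
have KD := @rectangle_lower_domain x1 x2 y1 y2 y2Y.
have [k k0 Hk] := trnorm_bound_pos H2 (rectangle_compact (y1 := y1) (y2 := y2)) KD.
have [l l0 Hl] := gamma_linear H2 H3.
have [K K0 HK] := exp_dimension a1; exists (K + k * l).
  by rewrite addr_gt0 // mulr_gt0.
move=> N z N0 zx zy; rewrite /G normc_det_sub1.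
have one1 (v : 'cV[C]_(d N)) : vnorm ((1%:M : 'M[C]_(d N)) *m v) <= 1 * vnorm v.
  by rewrite mul1mx mul1r.
have := det_perturbation (U N z - V N z) a1 ler01 (Ha N z zx zy) one1.
rewrite mul1mx mul1r (_ : 1%:M - U N z + (U N z - V N z) = 1%:M - V N z); last by rewrite addrA subrK.
move=> /le_trans; apply; rewrite mulrDl expRD.
apply: ler_pM; rewrite ?exprn_ge0 ?expR_ge0 //; first exact: le_trans a1.
rewrite ler_expR; apply: le_trans (Hk N z (conj zx zy)) _.
by rewrite -mulrA ler_pM2l // Hl.
Qed.

(** The inverse of the determinant is the determinant of the inverse, and a matrix of norm at most
    [b] has determinant at most the power of [Num.max 1 b] to the dimension, which is linear in
    [N]. *)
Lemma det_lower_bound (W : forall N : nat, C -> 'M[C]_(d N)) (z : C) (b : R) :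
  (forall N, 1%:M - W N z \in unitmx /\
    forall v : 'cV[C]_(d N), vnorm (invmx (1%:M - W N z) *m v) <= b * vnorm v) ->
  exists2 K : R, 0 < K & forall N, (0 < N)%N ->
    expR (- (K * N%:R)) <= normc (\det (W N z - 1%:M)).
Proof.
move=> HW; have a1 : 1 <= Num.max 1 b by rewrite le_max lexx.
have [K K0 HK] := exp_dimension a1; exists K => // N _; have [uW bW] := HW N.
rewrite normc_det_sub1 expRN.
have dW : 0 < normc (\det (1%:M - W N z)) by rewrite normc_gt0 -unitfE -unitmxE.
rewrite invf_ple ?posrE ?expR_gt0 //; apply: le_trans (HK N).
rewrite -normcV -det_inv; apply: normc_det_le => // v.
by apply: le_trans (bW v) _; rewrite ler_wpM2r ?vnorm_ge0 // le_max lexx orbT.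
Qed.

Lemma resolvent_vnorm (K : set C) (b : R) :
  (forall N z, K z -> lower_domain Y0 z /\ ~ resonance Y0 (U N) z) ->
  (forall N z, K z -> opnorm (invmx (1%:M - U N z)) <= b) ->
  forall N z, K z -> 1%:M - U N z \in unitmx /\
    forall v : 'cV[C]_(d N), vnorm (invmx (1%:M - U N z) *m v) <= b * vnorm v.
Proof.
move=> Kres HK N z Kz; have [zD nz] := Kres N z Kz; split.
  by rewrite unitmx_sub1; apply/eqP => h; apply: nz.
move=> v; apply: le_trans (vnorm_mul_opnorm _ _) _.
by rewrite ler_wpM2r ?vnorm_ge0 // HK.
Qed.

Lemma ratio_le (K : set C) (b : R) : compact K -> K `<=` lower_domain Y0 -> 0 < b ->
  (forall N z, K z -> 1%:M - V N z \in unitmx /\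
    forall v : 'cV[C]_(d N), vnorm (invmx (1%:M - V N z) *m v) <= b * vnorm v) ->
  exists2 k : R, 0 < k & forall N z, K z -> normc (F N z / G N z) <= expR (k * gamma N).
Proof.
move=> cK KD b0 HV; have [k k0 Hk] := trnorm_bound_pos H2 cK KD.
exists (b * k) => [|N z Kz]; first by rewrite mulr_gt0.
have [uV bV] := HV N z Kz; rewrite /F /G normc_div_det_sub1.
apply: le_trans (normc_det_ratio (D := U N z - V N z) uV (ltW b0) bV _) _.
  by right; rewrite opprB addrA subrK.
by rewrite ler_expR -mulrA ler_pM2l // Hk.
Qed.

(** The perturbation bound is applied to G / F, so here it is the resolvent of U that must be
    bounded. This is available above the axis and at depth at least Y1. *)
Lemma ratio_ge (K : set C) (b : R) : compact K -> K `<=` lower_domain Y0 -> 0 < b ->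
  (forall N z, K z -> 1%:M - U N z \in unitmx /\
    forall v : 'cV[C]_(d N), vnorm (invmx (1%:M - U N z) *m v) <= b * vnorm v) ->
  (forall N z, K z -> G N z != 0) ->
  exists2 k : R, 0 < k & forall N z, K z -> expR (- (k * gamma N)) <= normc (F N z / G N z).
Proof.
move=> cK KD b0 HU G0; have [k k0 Hk] := trnorm_bound_pos H2 cK KD.
exists (b * k) => [|N z Kz]; first by rewrite mulr_gt0.
have [uU bU] := HU N z Kz.
have F0 : F N z != 0.
  by rewrite /F -unitmx_sub1.
rewrite expRN invf_ple ?posrE ?expR_gt0 //; last by rewrite normc_gt0 mulf_neq0 ?invr_eq0 ?G0.
rewrite -normcV invf_div /F /G normc_div_det_sub1.
apply: le_trans (normc_det_ratio (D := U N z - V N z) uU (ltW b0) bU _) _.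
  by left; rewrite addrA subrK.
by rewrite ler_expR -mulrA ler_pM2l // Hk.
Qed.

Lemma determinant_pair : exists2 Y1 : R, 0 < Y1 & comparable_pair Y0 Y1 F G gamma.
Proof.
have [Y1 Y10 [nores below]] := resolvent_below H1; exists Y1 => //.
have bD (z : C) : Im z <= - Y1 -> lower_domain Y0 z.
  by move=> h; apply: (lower_domain_le0 Y0_gt0); apply: le_trans h _; rewrite oppr_le0 ltW.
have pointU (z : C) : Im z <= - Y1 -> exists2 b : R, 0 < b & forall N w, [set z] w ->
    1%:M - U N w \in unitmx /\
    forall v : 'cV[C]_(d N), vnorm (invmx (1%:M - U N w) *m v) <= b * vnorm v.
  move=> zY; have Kz : [set z] `<=` [set z : C | Im z <= - Y1] by move=> _ ->.
  have [b b0 Hb] := below _ (@compact_set1 _ z) Kz; exists b => //.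
  apply: resolvent_vnorm => // N _ ->; split; [exact: bD|exact: nores].
have G0 N (z : C) : Im z <= - Y1 -> G N z != 0.
  move=> zY; apply: det_reference_neq0; first exact: bD.
  by rewrite lt_eqF // (le_lt_trans zY) // oppr_lt0.
split.
- by move=> N z; exact: cdiffable_det_sub1.
- by move=> N z; apply: cdiffable_det_sub1; exact: reference_holomorphic H2 N.
- move=> N z zD zP; apply/eqP => Fz; case: zP => [/(no_resonance_above H1 (N := N))|/(nores N)]; exact.
- by move=> N z; exact: det_reference_neq0.
- exact: gamma_gt0 H2.
- exact: det_growth.
- exact: det_reference_growth.
- move=> z zY; have [b b0 Hb] := pointU z zY.
  by apply: (@det_lower_bound U z b) => N; exact: Hb.
- move=> z zY; have KD : [set z] `<=` lower_domain Y0 by move=> _ ->; exact: bD.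
  have yz : 0 < `|Im z| by rewrite ltr0_norm ?oppr_gt0 (le_lt_trans zY) // oppr_lt0.
  have [b b0 Hb] := reference_resolvent H2 (@compact_set1 _ z) KD yz
    (fun w wz => ltac:(by rewrite wz)).
  by apply: (@det_lower_bound V z b) => N; exact: Hb.
- move=> z zY; have [b b0 Hb] := pointU z zY.
  have KD : [set z] `<=` lower_domain Y0 by move=> _ ->; exact: bD.
  have [k k0 Hk] := ratio_ge (@compact_set1 _ z) KD b0 Hb (fun N w wz => ltac:(by rewrite wz; exact: G0)).
  by exists k => // N; exact: Hk.
- move=> x1 x2 y1 y2 y20; have y2Y : (y2%:E < Y0)%E by apply: lt_trans Y0_gt0; rewrite lte_fin.
  have KD := @rectangle_lower_domain x1 x2 y1 y2 y2Y.
  have y2n : 0 < - y2 by rewrite oppr_gt0.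
  have Ky (z : C) : x1 <= Re z <= x2 /\ y1 <= Im z <= y2 -> - y2 <= `|Im z|.
    by move=> [_ /andP[_ h]]; rewrite ltr0_norm ?lerN2 // (le_lt_trans h).
  have [b b0 Hb] := reference_resolvent H2 (rectangle_compact (y2 := y2)) KD y2n Ky.
  have [k k0 Hk] := ratio_le (rectangle_compact (y2 := y2)) KD b0 Hb.
  by exists k => // N z zx zy; exact: Hk.
- move=> x1 x2 y1 y2 y10 y2Y; have KD := @rectangle_lower_domain x1 x2 y1 y2 y2Y.
  have cK := rectangle_compact (x1 := x1) (x2 := x2) (y1 := y1) (y2 := y2).
  have Kpos (z : C) : x1 <= Re z <= x2 /\ y1 <= Im z <= y2 -> y1 <= Im z by move=> [_ /andP[]].
  have Ky (z : C) : x1 <= Re z <= x2 /\ y1 <= Im z <= y2 -> y1 <= `|Im z|.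
    by move=> /Kpos h; apply: le_trans h (ler_norm _).
  have [b b0 Hb] := reference_resolvent H2 cK KD y10 Ky.
  have KD' : [set z : C | x1 <= Re z <= x2 /\ y1 <= Im z <= y2] `<=`
      lower_domain Y0 `&` [set z : C | 0 < Im z].
    by move=> z zK; split; [exact: KD|exact: lt_le_trans y10 (Kpos z zK)].
  have [C0 C00 HC] := resolvent_above H1 cK KD'.
  have cy : 0 < C0 / y1 by rewrite divr_gt0.
  have HU := @resolvent_vnorm [set z : C | x1 <= Re z <= x2 /\ y1 <= Im z <= y2] (C0 / y1) _ _.
  have [k k0 Hk] := ratio_le cK KD b0 Hb.
  have [l l0 Hl] : exists2 k : R, 0 < k & forall N z, x1 <= Re z <= x2 /\ y1 <= Im z <= y2 ->
      expR (- (k * gamma N)) <= normc (F N z / G N z).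
    apply: (ratio_ge cK KD cy).
      apply: HU => N z zK; first by have [zD z0] := KD' z zK; split => //; exact: (no_resonance_above H1).
      apply: le_trans (HC N z zK) _; rewrite ler_pM2l // lef_pV2 ?posrE ?Ky //.
      by apply: lt_le_trans y10 _; exact: Ky.
    move=> N z zK; apply: det_reference_neq0; first exact: KD.
    by rewrite gt_eqF // (lt_le_trans y10) // Kpos.
  exists (k + l) => [|N z zx zy]; first by rewrite addr_gt0.
  have g0 := gamma_gt0 H2 N; apply/andP; split.
    apply: le_trans (Hl N z (conj zx zy)).
    by rewrite ler_expR lerN2 ler_pM2r // lerDr ltW.
  apply: le_trans (Hk N z (conj zx zy)) _.
  by rewrite ler_expR ler_pM2r // lerDl ltW.
Qed.

End DeterminantPair.

(** * Passage to the limit and comparison of the normalised counts *)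

Section AsymptoticCounts.
Variable R : realType.

Lemma le_limn_esup_eps (u v : nat -> \bar R) :
  (forall k : R, 0 < k -> exists N0, forall N, (N0 <= N)%N -> (u N <= v N + k%:E)%E) ->
  (limn_esup u <= limn_esup v)%E.
Proof.
move=> H; apply: le_ereal_inf_tmp => _ [A [N1 _ HA] <-]; apply/lee_addgt0Pr => k k0.
have [N0 HN] := H k k0.
apply: le_trans (ereal_inf_lbound _) _.
  exists [set N | (maxn N0 N1 <= N)%N]; last reflexivity.
  by exists (maxn N0 N1) => // N /=.
apply: ge_ereal_sup => _ [N /= + <-]; rewrite geq_max => /andP[NN0 NN1].
apply: le_trans (HN N NN0) _; rewrite leeD2r //; apply: ereal_sup_ubound.
by exists N => //; exact: HA.
Qed.

Lemma le_limn_einf_eps (u v : nat -> \bar R) :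
  (forall k : R, 0 < k -> exists N0, forall N, (N0 <= N)%N -> (u N <= v N + k%:E)%E) ->
  (limn_einf u <= limn_einf v)%E.
Proof.
move=> H; rewrite /limn_einf leeN2; apply: le_limn_esup_eps => k /H[N0 HN].
exists N0 => N /HN; case: (u N) (v N) => [x| |] [y| |] //=; rewrite ?leey ?leNye //.
by rewrite !lee_fin; lra.
Qed.

Lemma scaled_count_le (u v : \bar R) (k : R) N : (0 < N)%N -> (0 <= v)%E ->
  (u <= v + (k * N%:R)%:E)%E -> ((N%:R^-1)%:E * u <= (N%:R^-1)%:E * v + k%:E)%E.
Proof.
move=> N0 v0 uv; have NR : 0 < N%:R :> R by rewrite ltr0n.
have -> : (k%:E = (N%:R^-1)%:E * (k * N%:R)%:E)%E.
  by rewrite -EFinM mulrCA mulVf ?mulr1 // gt_eqF.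
by rewrite -muleDr ?fin_num_adde_defl // lee_pmul2l ?lte_fin ?invr_gt0.
Qed.

End AsymptoticCounts.

Section ResonanceCounts.
Variables (R : realType) (Y0 : \bar R) (Y0_gt0 : (0 < Y0)%E) (d : nat -> nat).
Variables (U V : forall N : nat, R[i] -> 'M[R[i]]_(d N)) (gamma : nat -> R).

Hypothesis U_holo : forall N, holomorphic_mx Y0 (U N).
Hypothesis H1 : hypothesis1 Y0 U.
Hypothesis H2 : hypothesis2 Y0 U V gamma.
Hypothesis H3 : hypothesis3 Y0 U V gamma.

Lemma ker_mult_reference_real N (x : R) : ker_mult (V N) x%:C = det_mult (V N) x%:C.
Proof.
have [c c0 Hc] := reference_monotone H3 (@compact_set1 _ x).
exact: (@ker_mult_reference R Y0 (d N) (V N) x c c0 (@reference_holomorphic _ _ _ _ _ _ H2 N)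
  (@lower_domain_le0 _ _ Y0_gt0 x%:C (lexx 0)) (reference_unitary H3 N x) (Hc N x erefl)).
Qed.

Lemma real_resonance_count_ge0 N (a b : R) : (0 <= real_resonance_count Y0 a b (V N))%E.
Proof. by apply: esum_ge0 => z _; rewrite lee_fin. Qed.

(** Each inequality compares a window shrunk by [eps] with one widened by [eps]. Resonances are
    counted by [det_mult], because the analysis sees orders of zeros; for V the two multiplicities
    agree on the real axis. *)
Lemma resonance_count_comparison (s t eps c k : R) : s <= t -> 0 < eps -> 0 < c -> 0 < k ->
  exists N0, forall N, (N0 <= N)%N ->
  (resonance_count Y0 (@det_mult R (d N)) (s + eps) (t - eps) (- c) 0 (U N) <=
    real_resonance_count Y0 (s - eps) (t + eps) (V N) + (k * N%:R)%:E)%E /\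
  (real_resonance_count Y0 (s + eps) (t - eps) (V N) <=
    resonance_count Y0 (@det_mult R (d N)) (s - eps) (t + eps) (- c) 0 (U N)
    + (k * N%:R)%:E)%E.
Proof.
move=> st eps0 c0 k0.
have [Y1 Y10 FG] := determinant_pair Y0_gt0 U_holo H1 H2 H3.
have [N0 HN] := zero_comparison FG Y0_gt0 Y10 (gamma_small_eps H2 H3) st eps0 c0 k0.
exists N0 => N /HN[zs [e [ws [e2 [[FE GE] [de de2] e0 h1 h2]]]]].
have sub (x : R) : s + eps <= x <= t - eps -> s - eps <= x <= t + eps.
  by move=> /andP[h3 h4]; apply/andP; split; lra.
have eU (z : R[i]) : s - eps <= Re z <= t + eps -> - c <= Im z <= 0 -> e z != 0.
  by move=> zx zy; have [] := e0 z zx zy.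
have eV (x : R) : s - eps <= x <= t + eps -> e2 x%:C != 0.
  move=> xst; have [||//] := e0 x%:C; first exact: xst.
  by rewrite /= lexx andbT oppr_le0 ltW.
have kV := ker_mult_reference_real N.
rewrite !(resonance_count_zeros Y0_gt0 FE de) //; last by move=> z /sub; exact: eU.
rewrite !(real_resonance_count_zeros Y0_gt0 GE de2) //; last by move=> x /sub; exact: eV.
Qed.

End ResonanceCounts.

Theorem theorem2 (R : realType) (Y0 : \bar R) (Y0_gt0 : (0 < Y0)%E)
    (d : nat -> nat) (U V : forall N : nat, R[i] -> 'M[R[i]]_(d N))
    (gamma : nat -> R)
    (U_holo : forall N, holomorphic_mx Y0 (U N))
    (H1 : hypothesis1 Y0 U)
    (H2 : hypothesis2 Y0 U V gamma)
    (H3 : hypothesis3 Y0 U V gamma)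
    (a b c eps : R) (ltab : a < b) (c_gt0 : 0 < c) (eps_gt0 : 0 < eps) :
  [/\ (limn_esup (fun N => (N%:R^-1)%:E *
          resonance_count Y0 (@ker_mult R (d N)) (a + eps) (b - eps) (- c) 0 (U N))
       <= limn_esup (fun N => (N%:R^-1)%:E * real_resonance_count Y0 a b (V N)))%E,
      (limn_esup (fun N => (N%:R^-1)%:E *
          resonance_count Y0 (@det_mult R (d N)) (a + eps) (b - eps) (- c) 0 (U N))
       <= limn_esup (fun N => (N%:R^-1)%:E * real_resonance_count Y0 a b (V N)))%E
    & (limn_einf (fun N => (N%:R^-1)%:E * real_resonance_count Y0 a b (V N))
       <= limn_einf (fun N => (N%:R^-1)%:E *
          resonance_count Y0 (@det_mult R (d N)) (a - eps) (b + eps) (- c) 0 (U N)))%E].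
Proof.
(* Half of [eps] moves the middle window and the other half is lost in the comparison: around
   [a + eps/2, b - eps/2] the two windows are [a + eps, b - eps] and [a, b], around
   [a - eps/2, b + eps/2] they are [a, b] and [a - eps, b + eps]. *)
have e20 : 0 < eps / 2 by rewrite divr_gt0.
have upper : forall k : R, 0 < k -> exists N0, forall N, (N0 <= N)%N ->
  ((N%:R^-1)%:E * resonance_count Y0 (@det_mult R (d N)) (a + eps) (b - eps) (- c) 0 (U N) <=
   (N%:R^-1)%:E * real_resonance_count Y0 a b (V N) + k%:E)%E.
  move=> k k0; have [ab|ab] := leP (a + eps / 2) (b - eps / 2); last first.
    (* If the middle window is empty, so is the rectangle over [a + eps, b - eps], and its count is
       0. *)
    exists 1%N => N N0; apply: scaled_count_le => //; first exact: real_resonance_count_ge0.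
    rewrite /resonance_count (_ : [set z | _] = set0) ?esum_set0.
      by rewrite adde_ge0 ?real_resonance_count_ge0 // lee_fin mulr_ge0 // ltW.
    by apply/seteqP; split=> // z [_ /andP[h1 h2] _]; move: (le_trans h1 h2); lra.
  have [N0 HN] := resonance_count_comparison Y0_gt0 U_holo H1 H2 H3 ab e20 c_gt0 k0.
  exists N0.+1 => N N0N; apply: scaled_count_le; first exact: leq_trans N0N.
    exact: real_resonance_count_ge0.
  have [h _] := HN N (ltnW N0N); move: h.
  rewrite addrK subrK -!addrA -opprD -splitr; exact.
have lower : forall k : R, 0 < k -> exists N0, forall N, (N0 <= N)%N ->
  ((N%:R^-1)%:E * real_resonance_count Y0 a b (V N) <= (N%:R^-1)%:E *
   resonance_count Y0 (@det_mult R (d N)) (a - eps) (b + eps) (- c) 0 (U N) + k%:E)%E.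
  move=> k k0; have ab : a - eps / 2 <= b + eps / 2 by lra.
  have [N0 HN] := resonance_count_comparison Y0_gt0 U_holo H1 H2 H3 ab e20 c_gt0 k0.
  exists N0.+1 => N N0N; apply: scaled_count_le; first exact: leq_trans N0N.
    apply: le_trans (resonance_count_ker_le _ _ _ _ (U_holo N)).
    by apply: esum_ge0 => z _; rewrite lee_fin.
  have [_ h] := HN N (ltnW N0N); move: h.
  rewrite subrK addrK -!addrA -opprD -splitr; exact.
split.
- apply: le_trans (le_limn_esup_eps upper); apply: le_limn_esup_eps => k k0.
  exists 0%N => N _; apply: (@le_trans _ _ ((N%:R^-1)%:E *
    resonance_count Y0 (@det_mult R (d N)) (a + eps) (b - eps) (- c) 0 (U N))%E).
    by rewrite lee_wpmul2l ?lee_fin ?invr_ge0 // resonance_count_ker_le.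
  by rewrite leeDl // lee_fin ltW.
- exact: le_limn_esup_eps.
- exact: le_limn_einf_eps.
Qed.
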